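(* Let $a\in L^\infty(\mathbb T^d;\mathbb R)$ with $a\ge a_{\min}>0$ a.e. and let $f\in L^2(\mathbb T^d;\mathbb R)$ be mean-zero ($\hat f_{\mathbf 0}=0$). Let $a^s,f^s$ be real-valued trigonometric polynomials (Fourier-sparse approximations of $a$ and $f$) with Fourier coefficients $\hat{\mathbf a}^s,\hat{\mathbf f}^s$ of finite support, such that $a^s\ge a^s_{\min}>0$ on $\mathbb T^d$ and $\hat f^s_{\mathbf 0}=0$. Let $a':=a|_{\operatorname{supp}\hat{\mathbf a}^s}$ and $f':=f|_{\operatorname{supp}\hat{\mathbf f}^s}$ be the frequency restrictions, and let $a'_{\min}:=\operatorname{ess\,inf}a'$. Suppose that $$3\sum_{\mathbf k\in\operatorname{supp}(\hat{\mathbf a}^s)\setminus\{\mathbf 0\}}|\hat a_{\mathbf k}|\le \hat a_{\mathbf 0}.$$ Let $u\in H$ be the unique mean-zero weak solution of $-\nabla\cdot(a\nabla u)=f$ on $\mathbb T^d$, let $N\in\mathbb N_0$, and let $u^{N,s}$ be the sparse spectral approximation with stamping level $N$ computed from $a^s,f^s$ (defined in the context). Then $$\begin{aligned}\|u-u^{N,s}\|_H\le{}&\frac{\|f-f'\|_{L^2}}{a_{\min}}+\frac{\|a-a'\|_{L^\infty}\|f'\|_{L^2}}{a_{\min}a'_{\min}}\\&+\left(1+\frac{\|a'\|_{L^\infty}}{a^s_{\min}}\right)\left(\frac{\|a'-\hat a'_{\mathbf 0}\|_{L^\infty}}{a'_{\min}-2\|a'-\hat a'_{\mathbf 0}\|_{L^\infty}}\right)^{N+1}\frac{\|f'\|_{L^2}}{a'_{\min}}\\&+\frac{\|a'-a^s\|_{L^\infty}\|f'\|_{L^2}}{a^s_{\min}a'_{\min}}+\frac{\|f'-f^s\|_{L^2}}{a^s_{\min}},\end{aligned}$$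 where the right-hand side is read as $+\infty$ if $a'_{\min}-2\|a'-\hat a'_{\mathbf 0}\|_{L^\infty}=0$.
   Context: $\mathbb T=\mathbb R/\mathbb Z$; $e_{\mathbf k}(\mathbf x)=e^{2\pi i\mathbf k\cdot\mathbf x}$; $\hat g_{\mathbf k}=\int_{\mathbb T^d}g\,\overline{e_{\mathbf k}}\,d\mathbf x$ for $\mathbf k\in\mathbb Z^d$. $\hat g$ is the sequence of Fourier coefficients of $g$. For $\mathcal D\subset\mathbb Z^d$, the frequency restriction is $g|_{\mathcal D}=\sum_{\mathbf k\in\mathcal D}\hat g_{\mathbf k}e_{\mathbf k}$. $H$ is the space of $u\in H^1(\mathbb T^d;\mathbb C)$ with $\hat u_{\mathbf 0}=0$, with norm $\|u\|_H^2=\int_{\mathbb T^d}|\nabla u|^2$. A weak solution satisfies $\int_{\mathbb T^d}a\nabla u\cdot\overline{\nabla v}=\langle f,v\rangle_{L^2}$ for all $v\in H^1$. In $a'-\hat a'_{\mathbf 0}$ the number $\hat a'_{\mathbf 0}$ is a constant function. Stamping sets: for a sequence $\hat b$ on $\mathbb Z^d$ and $F\subset\mathbb Z^d$, $\mathcal S^0[\hat b](F)=F$ and $\mathcal S^N[\hat b](F)=\mathcal S^{N-1}[\hat b](F)+\operatorname{supp}(\hat b)$ (Minkowski sum) for $N\ge1$. Sparse spectral approximation: put $\mathcal S^N=\mathcal S^N[\hat{\mathbf a}^s](\operatorname{supp}\hat{\mathbf f}^s)$. Then $u^{N,s}=\sum_{\mathbf k\in\mathcal S^N}\hat u^{N,s}_{\mathbf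 k}e_{\mathbf k}$, where $\hat{\mathbf u}^{N,s}\in\mathbb C^{\mathcal S^N}$ is the solution (with $\hat u^{N,s}_{\mathbf 0}=0$ if $\mathbf 0\in\mathcal S^N$) of $$\sum_{\mathbf l\in\mathcal S^N}(2\pi)^2(\mathbf l\cdot\mathbf k)\,\hat a^s_{\mathbf k-\mathbf l}\,\hat u^{N,s}_{\mathbf l}=\hat f^s_{\mathbf k}\quad\text{for all }\mathbf k\in\mathcal S^N.$$ *)

(* Defs.v *)
From HB Require Import structures.
From mathcomp Require Import all_boot all_order all_algebra.
From mathcomp Require Import complex.
From mathcomp Require Import all_classical all_reals all_analysis.

Set Implicit Arguments.
Unset Strict Implicit.
Unset Printing Implicit Defensive.
Import Order.TTheory GRing.Theory Num.Theory numFieldNormedType.Exports.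
Import Normc.

Local Open Scope classical_set_scope.
Local Open Scope complex_scope.
Local Open Scope ring_scope.

(* A function on the torus (R/Z)^d is represented by a function on R^d of which
   only the restriction to the fundamental domain [0,1]^d matters: every
   integral, norm and almost-everywhere statement refers to [haar R d], which is
   carried by that cube.  Periodicity is explicit where it is meaningful, i.e.
   for test functions; the characters are periodic by construction. *)
Definition pt (R : realType) (d : nat) : measurableType _ :=
  d.-tuple (measurableTypeR R).

(* Frequencies, the elements of Z^d. *)
Definition freq (d : nat) := {ffun 'I_d -> int}.

Section Haar.
Variable R : realType.

Definition pt_cons (d : nat) (z : measurableTypeR R * pt R d) : pt R d.+1 :=
  [tuple of z.1 :: z.2].

Lemma measurable_pt_cons d : measurable_fun setT (@pt_cons d).
Proof. exact: measurable_cons. Qed.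

HB.instance Definition _ d :=
  isMeasurableFun.Build _ _ _ _ (@pt_cons d) (@measurable_pt_cons d).

(* Lebesgue measure on [0,1]^d: the d-fold product of the uniform probability
   on [0,1], transported to d-tuples. *)
Fixpoint haar (d : nat) : probability (pt R d) R :=
  match d return probability (pt R d) R with
  | 0 => dirac ([tuple] : pt R 0)
  | d'.+1 => distribution
      ((uniform_prob (@ltr01 R) : probability (measurableTypeR R) R)
         \x haar d')%E
      (@pt_cons d')
  end.

End Haar.

Section Torus.
Variables (R : realType) (d : nat).
Local Notation T := (pt R d).
Local Notation C := R[i].
Local Notation mu := (haar R d).
Implicit Types (g u v : T -> C) (k l : freq d).

Definition cplx (h : T -> R) : T -> C := fun x => (h x)%:C.

Definition cintegral g : C :=
  (\int[mu]_x complex.Re (g x)) +i* (\int[mu]_x complex.Im (g x)).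

Definition cnorm (p : \bar R) g : \bar R :=
  Lnorm mu p (fun x => (normc (g x))%:E).

Definition in_L2 g : Prop :=
  [/\ measurable_fun setT (fun x => complex.Re (g x)),
      measurable_fun setT (fun x => complex.Im (g x)) &
      (cnorm 2%:E g < +oo)%E].

Definition echar k (x : T) : C :=
  let t := 2 * pi * \sum_j (k j)%:~R * tnth x j in cos t +i* sin t.

Definition fourier g k : C := cintegral (fun x => g x * (echar k x)^*).

Definition supp (b : freq d -> C) : set (freq d) := [set k | b k != 0].

(* The finite-support sum is used for finite [D] only. *)
Definition trig (D : set (freq d)) (b : freq d -> C) (x : T) : C :=
  \sum_(k \in D) b k * echar k x.

Definition freq_restr g (D : set (freq d)) : T -> C := trig D (fourier g).

Definition trig_polynomial g : Prop :=
  finite_set (supp (fourier g)) /\ g =1 freq_restr g (supp (fourier g)).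

(* Smoothness: all iterated partial derivatives, in any order, exist and are
   continuous. *)
Definition smooth (phi : 'rV[R]_d -> R) : Prop :=
  forall s : seq 'I_d,
    let psi := foldr (fun j h => 'D_(delta_mx 0 j) h) phi s in
    continuous psi /\ forall j x, derivable psi x (delta_mx 0 j).

Definition test_function (phi : 'rV[R]_d -> R) : Prop :=
  smooth phi /\ forall j x, phi (x + delta_mx 0 j) = phi x.

(* [h] is the distributional derivative of [u] in the j-th direction. *)
Definition weak_partial (j : 'I_d) u (h : T -> C) : Prop :=
  forall phi : 'rV[R]_d -> R, test_function phi ->
    cintegral
      (fun x => u x * ('D_(delta_mx 0 j) phi (\row_i tnth x i : 'rV[R]_d))%:C)
    = - cintegral (fun x => h x * (phi (\row_i tnth x i))%:C).

Definition in_H1 u : Prop :=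
  in_L2 u /\ forall j, exists h, in_L2 h /\ weak_partial j u h.

(* The weak partial derivative, unique up to a null set when [in_H1 u]. *)
Definition wpartial (j : 'I_d) u : T -> C :=
  xget (fun=> 0) [set h | in_L2 h /\ weak_partial j u h].

Definition in_H u : Prop := in_H1 u /\ fourier u 0 = 0.

Definition H_norm u : \bar R :=
  Lnorm mu 2%:E (fun x =>
    (Num.sqrt (\sum_j normc (wpartial j u x) ^+ 2))%:E).

Definition weak_solution (a f : T -> R) u : Prop :=
  forall v, in_H1 v ->
    cintegral (fun x =>
      (a x)%:C * \sum_j wpartial j u x * (wpartial j v x)^*)
    = cintegral (fun x => (f x)%:C * (v x)^*).

Fixpoint stamping (N : nat) (b : freq d -> C) (F : set (freq d)) :
    set (freq d) :=
  match N with
  | 0 => F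
  | N'.+1 => [set (k + l)%R | k in stamping N' b F & l in supp b]
  end.

Definition freq_dot k l : int := \sum_j k j * l j.

(* Values of [c] outside the stamping set are irrelevant. *)
Definition sparse_spectral_approx (as_ fs : T -> R) (N : nat) (uN : T -> C) :
    Prop :=
  let ah := fourier (cplx as_) in
  let fh := fourier (cplx fs) in
  let S := stamping N ah (supp fh) in
  exists c : freq d -> C,
    [/\ S 0 -> c 0 = 0,
        forall k, S k ->
          \sum_(l \in S) (2 * pi)%:C ^+ 2 * (freq_dot l k)%:~R * ah (k - l) * c l
          = fh k
      & uN = trig S c].

End Torus.

(* Main.v *)
(* Let w_M be the M-th partial sum of the Neumann series for
   - div (a' grad u') = f', expanded around the constant a0 = a'^_0; with
   K = ||a' - a0||_oo its terms decay like (K / a0)^M, and 3 K <= a0 by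
   hypothesis.  The residual of w_M is the single term
   - div ((a' - a0) grad (w_M - w_(M-1))), so testing the equation for u against
   u - w_M gives the first two error terms plus a remainder that vanishes as
   M -> oo; the solution u' itself is never needed.  The frequencies of w_N lie in
   the N-th stamping set, hence u^(N,s) - w_N is an admissible Galerkin test
   function and the same energy estimate bounds it.  The distance w_M - w_N is a
   geometric tail, and a'_min <= a0 turns K / a0 into the ratio of the theorem.
   The data terms are handled by the dual Poincare inequality
   |<h, v>| <= ||h|| ||grad v||, obtained by integrating by parts against
   grad Laplacian^-1 of a trigonometric polynomial close to h in L2. *)
Require Import Defs.
From HB Require Import structures.
From mathcomp Require Import all_boot all_order all_algebra.
From mathcomp Require Import complex.
From mathcomp Require Import all_classical all_reals all_analysis.
From mathcomp Require Import ess_sup_inf measurable_realfun.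
From mathcomp Require Import ring lra.

Set Implicit Arguments.
Unset Strict Implicit.
Unset Printing Implicit Defensive.
Import Order.TTheory GRing.Theory Num.Theory numFieldNormedType.Exports.
Import Normc.
Local Open Scope classical_set_scope.
Local Open Scope ring_scope.

(** Everything compared with [u] is a trigonometric polynomial, kept as a finite list of
    coefficients, so neither Lax-Milgram nor completeness of a Sobolev space enters. [u] is the only
    abstract function, and what is known of its weak gradient is extracted by testing with real
    trigonometric polynomials. Their density in L2 therefore carries both the uniqueness of weak
    gradients and the dual Poincare inequality. A partial sum is not a solution, so coercivity does
    not bound its gradient by ||f'|| / a'_min. Constants make up for this: the ratio K / a0 <= 1/3
    sums to at most 3/2, while the first term solves a constant-coefficient problem, where the
    spectral gap 2 pi >= 4 of the torus gives 4 a0 B <= ||f'|| for its gradient norm B. The slack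
    between 4 and 3/2 lets the final bound keep the factor ||f'|| / a'_min without a further
    constant. *)

Section L2real.
Context d (T : measurableType d) (R : realType) (mu : {finite_measure set T -> \bar R}).
Implicit Types f g h : T -> R.

Definition Lint f := mu.-integrable setT (EFin \o f).

Definition sqint f := measurable_fun setT f /\ Lint (fun x => f x ^+ 2).

Lemma Lint_measurable f : Lint f -> measurable_fun setT f.
Proof. by move=> /measurable_int /measurable_EFinP. Qed.

Lemma Lint_le f g : measurable_fun setT f -> Lint g ->
  (forall x, `|f x| <= g x) -> Lint f.
Proof.
move=> mf ig fg; apply: (le_integrable measurableT _ _ ig).
  exact/measurable_EFinP.
by move=> x _ /=; rewrite lee_fin (le_trans (fg x)) ?ler_norm.
Qed.

Lemma LintD f g : Lint f -> Lint g -> Lint (fun x => f x + g x).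
Proof. exact: integrableD. Qed.

Lemma LintZ k f : Lint f -> Lint (fun x => k * f x).
Proof. exact: (@integrableZl _ _ _ _ _ measurableT k (EFin \o f)). Qed.

Lemma LintN f : Lint f -> Lint (fun x => - f x).
Proof. exact: (@integrableN _ _ _ _ _ (EFin \o f)). Qed.

Lemma LintB f g : Lint f -> Lint g -> Lint (fun x => f x - g x).
Proof. by move=> ? ?; apply: LintD => //; apply: LintN. Qed.

Lemma Lint_sum (I : Type) (s : seq I) (F : I -> T -> R) :
  (forall i, Lint (F i)) -> Lint (fun x => \sum_(i <- s) F i x).
Proof.
move=> iF; elim: s => [|i s IH].
  by under eq_fun do rewrite big_nil; exact: integrable0.
by under eq_fun do rewrite big_cons; exact: LintD.
Qed.

Lemma Lint_bounded f K : measurable_fun setT f -> (forall x, `|f x| <= K) -> Lint f.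
Proof.
move=> mf fK; apply: (@Lint_le _ (cst K)) => //.
exact: finite_measure_integrable_cst.
Qed.

Lemma Rint_sum (I : Type) (s : seq I) (F : I -> T -> R) :
  (forall i, Lint (F i)) ->
  (\int[mu]_x \sum_(i <- s) F i x = \sum_(i <- s) \int[mu]_x F i x)%R.
Proof.
move=> iF; elim: s => [|i s IH].
  under eq_Rintegral do rewrite big_nil.
  by rewrite big_nil Rintegral_cst// mul0r.
under eq_Rintegral do rewrite big_cons.
rewrite RintegralD ?IH ?big_cons//; [exact: iF|exact: (Lint_sum s iF)].
Qed.

Lemma LintM f g : sqint f -> sqint g -> Lint (fun x => f x * g x).
Proof.
move=> [mf if2] [mg ig2]; apply: (@Lint_le _ (fun x => f x ^+ 2 + g x ^+ 2)).
- exact: measurable_funM.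
- exact: LintD.
- by move=> x; rewrite ler_norml; apply/andP; split; nra.
Qed.

Lemma sqint_bounded f K : measurable_fun setT f -> (forall x, `|f x| <= K) -> sqint f.
Proof.
move=> mf fK; split=> //; apply: (@Lint_bounded _ (K ^+ 2)).
  exact: measurable_funX.
by move=> x; rewrite normrX lerXn2r ?nnegrE// (le_trans _ (fK x)).
Qed.

Lemma sqint_Lint f : sqint f -> Lint f.
Proof.
move=> sf; rewrite (_ : f = fun x => f x * cst 1 x); last by apply/funext => x; rewrite mulr1.
by apply: LintM => //; apply: (@sqint_bounded _ 1) => // x; rewrite normr1.
Qed.

Lemma sqintZ k f : sqint f -> sqint (fun x => k * f x).
Proof.
move=> [mf if2]; split; first exact: measurable_funM.
by under eq_fun do rewrite exprMn; exact: LintZ.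
Qed.

Lemma sqintN f : sqint f -> sqint (fun x => - f x).
Proof. by move=> /(sqintZ (-1)); under eq_fun do rewrite mulN1r. Qed.

Lemma sqintD f g : sqint f -> sqint g -> sqint (fun x => f x + g x).
Proof.
move=> sf sg; split; first exact: measurable_funD sf.1 sg.1.
under eq_fun do rewrite sqrrD.
apply: LintD (sg.2); apply: LintD (sf.2) _.
by under eq_fun do rewrite -mulr_natl; apply: LintZ; exact: LintM.
Qed.

Lemma sqintB f g : sqint f -> sqint g -> sqint (fun x => f x - g x).
Proof. by move=> ? ?; apply: sqintD => //; exact: sqintN. Qed.

Lemma Rint_sqrD_le f g : sqint f -> sqint g ->
  (\int[mu]_x (f x + g x) ^+ 2 <=
   2 * (\int[mu]_x f x ^+ 2) + 2 * \int[mu]_x g x ^+ 2)%R.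
Proof.
move=> sf sg; rewrite -!RintegralZl//; [|exact: sg.2|exact: sf.2].
rewrite -RintegralD//; [|by apply: LintZ; exact: sf.2|by apply: LintZ; exact: sg.2].
apply: le_Rintegral => //.
- exact: (sqintD sf sg).2.
- by apply: LintD; apply: LintZ; [exact: sf.2|exact: sg.2].
- by move=> x _; have := sqr_ge0 (f x - g x); nra.
Qed.

End L2real.

(** * L2 density of an algebra of bounded functions *)

Section Threshold.
Variable R : realType.
Implicit Types (x r t : R) (n : nat).

Lemma ge_bernoulli x n : -1 <= x -> 1 + n%:R * x <= (1 + x) ^+ n.
Proof.
move=> x1; elim: n => [|n IH]; first by rewrite mul0r addr0 expr0.
rewrite exprS -natr1.
have : 0 <= (1 + x) * ((1 + x) ^+ n - (1 + n%:R * x)).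
  by rewrite mulr_ge0 ?subr_ge0//; lra.
have : 0 <= n%:R * x ^+ 2 by rewrite mulr_ge0 ?sqr_ge0.
nra.
Qed.

(** Linear growth is traded for a slightly larger ratio: for r < s < 1, Bernoulli gives n (s/r - 1)
    <= (s/r)^n, hence n r^n <= c s^n. *)
Lemma cvg_natrMexpr r : 0 <= r < 1 -> n%:R * r ^+ n @[n --> \oo] --> (0 : R).
Proof.
move=> /andP[]; rewrite le_eqVlt => /predU1P[<- _|r0 r1].
  apply: cvg_near_cst; exists 1%N => // -[|n] //= _.
  by rewrite expr0n mulr0.
pose s := (1 + r) / 2.
have s0 : 0 < s by rewrite /s; lra.
have s1 : s < 1 by rewrite /s; lra.
have rs : r < s by rewrite /s; lra.
clearbody s.
pose c := (s / r - 1)^-1.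
have c0 : 0 < c by rewrite invr_gt0 subr_gt0 ltr_pdivlMr ?mul1r.
apply: (@squeeze_cvgr _ _ _ _ (cst 0) (fun n => c * s ^+ n)).
- near=> n; rewrite /= mulr_ge0 ?exprn_ge0 ?(ltW r0)//=.
  have E : r ^+ n = s ^+ n / (s / r) ^+ n.
    by rewrite expr_div_n invf_div mulrCA divff ?mulr1// expf_neq0// gt_eqF.
  have q0 : 0 < (s / r) ^+ n by rewrite exprn_gt0// divr_gt0.
  rewrite E mulrCA mulrC ler_pM2r ?exprn_gt0// ler_pdivrMr//.
  rewrite -ler_pdivrMl// invrK.
  have := @ge_bernoulli (s / r - 1) n; rewrite [1 + (_ - _)]addrC subrK => B.
  have : -1 <= s / r - 1 by rewrite lerBrDr addNr divr_ge0// ltW.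
  by move=> /B; rewrite mulrC; lra.
- exact: cvg_cst.
- rewrite -[X in _ --> X](mulr0 c); apply: cvgMr.
  by apply: cvg_expr; rewrite ger0_norm ?ltW.
Unshelve. all: by end_near. Qed.

(* The polynomials of the Brosowski-Deutsch proof of Stone-Weierstrass, with
   exponents chosen so that they also converge at [t = 1/2]. *)
Definition threshold n t : R := (1 - t ^+ n) ^+ (n * 2 ^ n).

Lemma threshold_itv n t : 0 <= t <= 1 -> 0 <= threshold n t <= 1.
Proof.
move=> /andP[t0 t1]; rewrite exprn_ge0 ?exprn_ile1 ?subr_ge0 ?gerBl ?exprn_ge0//;
by rewrite exprn_ile1.
Qed.

(** With M = n 2^n one has M t^n = n (2t)^n, so 1/2 is critical. Below it, Bernoulli bounds (1 -
    t^n)^M from below by 1 - n (2t)^n. From 1/2 on, (1 + t^n)^M >= n + 1, while its product with (1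
    - t^n)^M is at most 1. *)
Lemma cvg_threshold t : 0 <= t <= 1 ->
  threshold n t @[n --> \oo] --> (if t < 2^-1 then 1 else 0 : R).
Proof.
move=> /andP[t0 t1]; have mE n : (n * 2 ^ n)%:R * t ^+ n = n%:R * (2 * t) ^+ n.
  by rewrite natrM natrX exprMn mulrA.
have tn n : 0 <= t ^+ n <= 1 by rewrite exprn_ge0 ?exprn_ile1.
case: ltP => t2.
- apply: (@squeeze_cvgr _ _ _ _ (fun n => 1 - n%:R * (2 * t) ^+ n) (cst 1)).
  + near=> n; have [_ ->] := andP (threshold_itv n (introT andP (conj t0 t1))).
    rewrite andbT -mE; have := @ge_bernoulli (- t ^+ n) (n * 2 ^ n).
    by rewrite mulrN; apply; have := tn n; lra.
  + rewrite -[X in _ --> X](subr0 1); apply: cvgB; first exact: cvg_cst.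
    by apply: cvg_natrMexpr; rewrite mulr_ge0//=; lra.
  + exact: cvg_cst.
- apply: (@squeeze_cvgr _ _ _ _ (cst 0) (@harmonic R)).
  + near=> n; have [-> _] := andP (threshold_itv n (introT andP (conj t0 t1))) => /=.
    have B : n.+1%:R <= (1 + t ^+ n) ^+ (n * 2 ^ n).
      have := @ge_bernoulli (t ^+ n) (n * 2 ^ n); rewrite mE => B.
      apply: le_trans (B _); last by have := tn n; lra.
      rewrite -natr1 addrC lerD2l -[leLHS]mulr1 ler_wpM2l// exprn_ege1//; lra.
    have p0 : 0 < (1 + t ^+ n) ^+ (n * 2 ^ n) by rewrite (lt_le_trans _ B).
    rewrite -[threshold n t](mulfK (lt0r_neq0 p0)).
    rewrite -[leRHS]mul1r; apply: ler_pM.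
    * by rewrite mulr_ge0 ?(ltW p0)//; have [] := andP (threshold_itv n (introT andP (conj t0 t1))).
    * by rewrite invr_ge0 ltW.
    * by rewrite -exprMn exprn_ile1//; have := tn n; nra.
    * by rewrite lef_pV2 ?posrE.
  + exact: cvg_cst.
  + exact: cvg_harmonic.
Unshelve. all: by end_near. Qed.

End Threshold.

Section Density.
Import HBNNSimple.
Context d (T : measurableType d) (R : realType) (mu : {finite_measure set T -> \bar R}).
Variables (A : (T -> R) -> Prop) (Q : set T).
Hypothesis Acst : forall c, A (cst c).
Hypothesis AD : forall f g, A f -> A g -> A (fun x => f x + g x).
Hypothesis AM : forall f g, A f -> A g -> A (fun x => f x * g x).
Hypothesis Ameas : forall f, A f -> measurable_fun setT f.
Hypothesis Abnd : forall f, A f -> exists K : R, forall x, `|f x| <= K.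
Hypothesis QT : {ae mu, forall x, Q x}.
Implicit Types (f g h : T -> R) (e k : R).

Let Asqint f : A f -> sqint mu f.
Proof. by move=> Af; have [K fK] := Abnd Af; exact: sqint_bounded (Ameas Af) fK. Qed.

Let AX f n : A f -> A (fun x => f x ^+ n).
Proof.
move=> Af; elim: n => [|n IH]; first exact: (Acst 1).
rewrite (_ : (fun x => _) = fun x => f x * f x ^+ n); first exact: (AM Af IH).
by apply/funext => x; rewrite exprS.
Qed.

Definition l2_approximable h := sqint mu h /\
  forall e : R, 0 < e -> exists2 g, A g & (\int[mu]_x (h x - g x) ^+ 2 <= e)%R.

Lemma l2_approximable_alg f : A f -> l2_approximable f.
Proof.
move=> Af; split=> [|e e0]; first exact: Asqint.
exists f => //; under eq_Rintegral do rewrite subrr expr0n.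
by rewrite Rintegral_cst// mul0r ltW.
Qed.

Lemma l2_approximable_lim h : sqint mu h ->
  (forall e : R, 0 < e -> exists2 f, l2_approximable f &
    (\int[mu]_x (h x - f x) ^+ 2 <= e)%R) -> l2_approximable h.
Proof.
(* Squaring a sum of two errors costs a factor 2 on each, and 2 (e/4) + 2 (e/4) = e. *)
move=> sh H; split=> // e e0; have e4 : 0 < e / 4 by lra.
have [f [sf Hf] hf] := H _ e4; have [g Ag fg] := Hf _ e4; exists g => //.
have sg := Asqint Ag.
rewrite (@eq_Rintegral _ _ _ mu _ (fun x => ((h x - f x) + (f x - g x)) ^+ 2)); last first.
  by move=> x _; congr (_ ^+ 2); ring.
by apply: le_trans (Rint_sqrD_le (sqintB sh sf) (sqintB sf sg)) _; lra.
Qed.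

Lemma l2_approximableD f g :
  l2_approximable f -> l2_approximable g -> l2_approximable (fun x => f x + g x).
Proof.
move=> [sf Hf] [sg Hg]; split=> [|e e0]; first exact: sqintD.
have e4 : 0 < e / 4 by lra.
have [f' Af' ff'] := Hf _ e4; have [g' Ag' gg'] := Hg _ e4.
exists (fun x => f' x + g' x); first exact: AD.
under eq_Rintegral => x _ do rewrite opprD addrACA.
apply: le_trans (Rint_sqrD_le (sqintB sf (Asqint Af')) (sqintB sg (Asqint Ag'))) _.
lra.
Qed.

Lemma l2_approximableZ k f : l2_approximable f -> l2_approximable (fun x => k * f x).
Proof.
move=> [sf Hf]; split=> [|e e0]; first exact: sqintZ.
(* The [+ 1] covers [k = 0]. *)
have k0 : 0 < k ^+ 2 + 1 by have := sqr_ge0 k; lra.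
have [g Ag fg] := Hf (e / (k ^+ 2 + 1)) (divr_gt0 e0 k0).
exists (fun x => k * g x); first exact: (AM (Acst k) Ag).
have sB := sqintB sf (Asqint Ag).
under eq_Rintegral => x _ do rewrite -mulrBr exprMn.
rewrite RintegralZl//; last exact: sB.2.
have I0 : 0 <= \int[mu]_x (f x - g x) ^+ 2 by apply: Rintegral_ge0 => x _; exact: sqr_ge0.
move: fg; rewrite ler_pdivlMr//; apply: le_trans; rewrite mulrC ler_wpM2l//; lra.
Qed.

Lemma l2_approximable_sum n (F : 'I_n -> T -> R) :
  (forall i, l2_approximable (F i)) -> l2_approximable (fun x => \sum_i F i x).
Proof.
elim: n F => [|n IH] F HF.
  under eq_fun do rewrite big_ord0.
  exact: (l2_approximable_alg (Acst 0)).
under eq_fun do rewrite big_ord_recl.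
by apply: l2_approximableD => //; apply: IH.
Qed.

(** Since |h - f_n| <= 2k, the function 4 k^2 is an integrable majorant of the squared errors, and
    dominated convergence gives convergence in L2. *)
Lemma l2_approximable_dominated (f : nat -> T -> R) h (k : T -> R) :
  sqint mu k -> (forall n, l2_approximable (f n)) -> measurable_fun setT h ->
  (forall n x, `|f n x| <= k x) -> (forall x, `|h x| <= k x) ->
  (forall x, Q x -> f n x @[n --> \oo] --> h x) -> l2_approximable h.
Proof.
move=> sk Hf mh fk hk fh.
have sh : sqint mu h.
  split=> //; apply: (@Lint_le _ _ _ _ _ (fun x => k x ^+ 2)) (sk.2) _.
    exact: measurable_funX.
  by move=> x; rewrite normrX lerXn2r ?nnegrE// (le_trans _ (hk x)).
apply: l2_approximable_lim => // e e0.
case: (@dominated_convergence _ _ _ mu setT measurableT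
  (fun n x => ((h x - f n x) ^+ 2)%:E) (cst 0%E) (fun x => (4 * k x ^+ 2)%:E)).
- move=> n; apply/measurable_EFinP/measurable_funX/measurable_funB => //.
  exact: (Hf n).1.1.
- exact: measurable_cst.
- apply: filterS QT => x Qx _; apply/fine_cvgP; split; first exact: nearW.
  rewrite /comp/= -[X in _ --> X](mulr0 0).
  have D : h x - f n x @[n --> \oo] --> (0 : R).
    by rewrite -(subrr (h x)); apply: cvgB; [exact: cvg_cst|exact: fh].
  exact: cvgM.
- by apply: (@LintZ _ _ _ _ 4 (fun x => k x ^+ 2)); exact: sk.2.
- apply: aeW => x n _; rewrite lee_fin ger0_norm ?sqr_ge0//.
  have /andP[] : - (k x) <= h x <= k x by rewrite -ler_norml.
  have /andP[] : - (k x) <= f n x <= k x by rewrite -ler_norml.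
  nra.
- move=> _ _; rewrite integral0 => /fine_cvgP[_]/= /cvgrPdist_le/(_ _ e0)[N _ HN].
  exists (f N) => //; have /= := HN N (leqnn N).
  by rewrite sub0r normrN => H; apply: le_trans H; exact: ler_norm.
Qed.

(* A pi-system: by dominated convergence the indicators of its members are
   approximable, and [threshold] puts the sublevel sets of elements of [A] in it. *)
Definition alg_limit_set (E : set T) := measurable E /\
  exists f : nat -> T -> R, [/\ forall n, A (f n),
    forall n x, 0 <= f n x <= 1 & forall x, Q x -> f n x @[n --> \oo] --> (\1_E x : R)].

Lemma alg_limit_setT : alg_limit_set setT.
Proof.
split=> //; exists (fun=> cst 1); split=> // [n x|x _]; first by rewrite ler01 lexx.
by rewrite indicT; exact: cvg_cst.
Qed.

Lemma alg_limit_setC E : alg_limit_set E -> alg_limit_set (~` E).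
Proof.
move=> [mE [f [Af f01 fE]]]; split; first exact: measurableC.
exists (fun n x => 1 + (-1) * f n x); split.
- by move=> n; exact: (AD (Acst 1) (AM (Acst (-1)) (Af n))).
- by move=> n x; have := f01 n x; lra.
- move=> x Qx; have -> : \1_(~` E) x = 1 + (-1) * \1_E x :> R.
    by rewrite !indicE in_setC; case: (x \in E) => /=; ring.
  by apply: cvgD; [exact: cvg_cst|apply: cvgMr; exact: fE].
Qed.

Lemma alg_limit_setI : setI_closed alg_limit_set.
Proof.
move=> E F [mE [f [Af f01 fE]]] [mF [g [Ag g01 gF]]]; split; first exact: measurableI.
exists (fun n x => f n x * g n x); split.
- by move=> n; exact: (AM (Af n) (Ag n)).
- by move=> n x; have := f01 n x; have := g01 n x; nra.
- by move=> x Qx; rewrite indicI; apply: cvgM; [exact: fE|exact: gF].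
Qed.

Lemma alg_limit_set_lt g s : A g -> alg_limit_set [set x | g x < s].
Proof.
move=> Ag; have [K gK] := Abnd Ag.
have mE : measurable [set x | g x < s].
  rewrite -[X in measurable X]setTI (_ : [set x | g x < s] = g @^-1` `]-oo, s[).
    exact: Ameas.
  by apply/seteqP; split=> x; rewrite /= in_itv.
split=> //.
(* The affine image [t] of [g] has values in [0, 1] and sends the level s to 1/2, the jump of
   [threshold]; the [+ 1] keeps the denominator positive. *)
pose c : R := (2 * (`|K| + `|s| + 1))^-1.
have c0 : 0 < c by rewrite invr_gt0; have := normr_ge0 K; have := normr_ge0 s; lra.
pose t x : R := 2^-1 + c * (g x + - s).
have At : A t by exact: (AD (Acst _) (AM (Acst _) (AD Ag (Acst _)))).
have t01 x : 0 <= t x <= 1.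
  have Kg := gK x; have KK := ler_norm K.
  have /andP[g1 g2] : - `|K| <= g x <= `|K| by rewrite -ler_norml (le_trans Kg).
  have /andP[s1 s2] : - `|s| <= s <= `|s| by rewrite -ler_norml.
  have E : c * (2 * (`|K| + `|s| + 1)) = 1.
    by rewrite mulVf//; have := normr_ge0 K; have := normr_ge0 s; lra.
  have : 0 <= c * (`|K| + `|s| + 1 + (g x - s)) by rewrite mulr_ge0 ?(ltW c0)//; lra.
  have : 0 <= c * (`|K| + `|s| + 1 - (g x - s)) by rewrite mulr_ge0 ?(ltW c0)//; lra.
  by rewrite /t; lra.
exists (fun n x => threshold n (t x)); split.
- move=> n; apply: (@AX (fun x => 1 - t x ^+ n)).
  rewrite (_ : (fun x => _) = fun x => 1 + (-1) * t x ^+ n).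
    exact: (AD (Acst 1) (AM (Acst (-1)) (AX n At))).
  by apply/funext => x; rewrite mulN1r.
- by move=> n x; exact: threshold_itv.
- move=> x _; rewrite (_ : \1_ _ x = if t x < 2^-1 then 1 else 0 :> R); first exact: cvg_threshold.
  have -> : (t x < 2^-1) = (g x < s) by rewrite /t gtrDl pmulr_rlt0// subr_lt0.
  by rewrite indicE; case: ifP => gs; [rewrite mem_set|rewrite memNset//= gs].
Qed.

Hypothesis Agen : forall E, measurable E -> <<s alg_limit_set >> E.

(** Dynkin's pi-lambda theorem: complements and countable disjoint unions preserve approximability
    by linear operations and limits, whereas an intersection would require multiplying L2
    approximations. The pi-system takes care of that. *)
Lemma l2_approximable_indic E : measurable E -> l2_approximable (\1_E : T -> R).
Proof.
have ind1 (F : set T) x : `|\1_F x : R| <= 1.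
  by rewrite indicE; case: (_ \in _); rewrite ?normr1 ?normr0.
have s1 : sqint mu (cst 1) by apply: (@sqint_bounded _ _ _ _ _ 1) => // x; rewrite normr1.
suff : <<s alg_limit_set >> `<=` [set E | measurable E /\ l2_approximable (\1_E : T -> R)].
  by move=> H mE; have [] := H _ (Agen mE).
rewrite -(setI_closed_g_dynkin_g_sigma_algebra alg_limit_setI).
apply: smallest_sub; last first.
  move=> F [mF [f [Af f01 fF]]]; split=> //.
  apply: (l2_approximable_dominated s1 _ _ _ _ fF) => //.
  - by move=> n; exact: l2_approximable_alg.
  - by move=> n x; have := f01 n x => /andP[f0 f1]; rewrite ger0_norm.
split.
- split=> //; rewrite (_ : \1_ _ = cst 1); first exact: l2_approximable_alg.
  by rewrite indicT.
- move=> F [mF aF]; split; first exact: measurableC.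
  rewrite (_ : \1_ _ = fun x => cst 1 x + (-1) * \1_F x).
    by apply: l2_approximableD; [exact: l2_approximable_alg|exact: l2_approximableZ].
  by apply/funext => x; rewrite !indicE in_setC; case: (x \in F) => /=; ring.
- move=> F tF aF; have mF n : measurable (F n) := (aF n).1.
  split; first exact: bigcup_measurable.
  (* By disjointness the partial sums at a point of [F k] jump from 0 to 1 at n = k + 1; outside the
     union they vanish. Hence they are dominated by 1. *)
  have sumE1 (n : nat) x (k : nat) : F k x -> \sum_(i < n) \1_(F i) x = (k < n)%:R :> R.
    move=> Fkx; elim: n => [|n IH]; first by rewrite big_ord0.
    rewrite big_ord_recr/= IH ltnS (_ : \1_(F n) x = (k == n)%:R).
      by case: (ltngtP k n) => _; rewrite ?addr0 ?add0r.
    have [<-|kn] := eqVneq; first by rewrite indicE mem_set.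
    rewrite indicE memNset// => Fnx; case/eqP: kn.
    by apply: tF => //; exists x.
  have sumE n x : (exists k : nat, \sum_(i < n) \1_(F i) x = (k < n)%:R :> R) \/
      \sum_(i < n) \1_(F i) x = 0 :> R.
    have [[k _ Fkx]|nFx] := pselect ((\bigcup_n F n) x).
      by left; exists k; exact: sumE1.
    by right; rewrite big1// => i _; rewrite indicE memNset// => Fix; apply: nFx; exists i.
  apply: (@l2_approximable_dominated (fun n x => \sum_(i < n) \1_(F i) x) _ (cst 1)) => //.
  + by move=> n; apply: l2_approximable_sum => i; exact: (aF i).2.
  + exact/measurable_indic/bigcup_measurable.
  + move=> n x; have [[k ->]|->] := sumE n x; last by rewrite normr0.
    by case: (k < n)%N; rewrite ?normr1 ?normr0.
  + move=> x _; have [[k _ Fkx]|nFx] := pselect ((\bigcup_n F n) x).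
      apply: cvg_near_cst; exists k.+1 => // n /= kn.
      by rewrite (sumE1 n x k)// kn indicE mem_set//; exists k.
    rewrite indicE memNset//; apply: cvg_near_cst; apply: nearW => n.
    by rewrite big1// => i _; rewrite indicE memNset// => Fix; apply: nFx; exists i.
Qed.

Lemma sqint_l2_approximable h : sqint mu h -> l2_approximable h.
Proof.
suff pos g : sqint mu g -> (forall x, 0 <= g x) -> l2_approximable g.
  move=> sh; rewrite (_ : h = fun x => (`|h x| + h x) / 2 + (-1) * ((`|h x| - h x) / 2)).
    have sn : sqint mu (fun x => `|h x|).
      split; first exact: measurableT_comp sh.1.
      by under eq_fun do rewrite real_normK ?num_real//; exact: sh.2.
    apply: l2_approximableD; last apply: l2_approximableZ.
      apply: pos => [|x]; last by have := ler_norm (- h x); rewrite normrN; lra.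
      by under eq_fun do rewrite mulrC; apply: sqintZ; exact: sqintD.
    apply: pos => [|x]; last by have := ler_norm (h x); lra.
    by under eq_fun do rewrite mulrC; apply: sqintZ; exact: sqintB.
  by apply/funext => x; field.
(* The simple functions increasing to [g] are finite combinations of indicators and are dominated by
   [g] itself. *)
move=> sg g0; have mg : measurable_fun setT (EFin \o g) by apply/measurable_EFinP; exact: sg.1.
pose f n : T -> R := nnsfun_approx measurableT mg n.
have fg n x : f n x <= g x.
  by rewrite -lee_fin /f nnsfun_approxE; apply: le_approx => // y _; rewrite lee_fin.
apply: (@l2_approximable_dominated f g g sg) => //.
- move=> n; rewrite (funext (fimfunEord (nnsfun_approx measurableT mg n)) : f n = _).
  apply: l2_approximable_sum => i; apply: l2_approximableZ.
  exact: l2_approximable_indic.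
- exact: sg.1.
- by move=> n x; rewrite ger0_norm.
- by move=> x; rewrite ger0_norm.
- move=> x _; have /fine_cvgP[_] : EFin \o f^~ x @ \oo --> (EFin \o g) x.
    by apply: cvg_nnsfun_approx => // y _; rewrite lee_fin.
  exact.
Qed.

End Density.

(** * Real and imaginary parts *)

Section ComplexParts.
Variable R : rcfType.
Implicit Types x y : R[i].
Local Open Scope complex_scope.

Lemma cReD x y : complex.Re (x + y) = complex.Re x + complex.Re y.
Proof. by case: x y => ? ? [? ?]. Qed.
Lemma cImD x y : complex.Im (x + y) = complex.Im x + complex.Im y.
Proof. by case: x y => ? ? [? ?]. Qed.
Lemma cReN x : complex.Re (- x) = - complex.Re x.
Proof. by case: x. Qed.
Lemma cImN x : complex.Im (- x) = - complex.Im x.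
Proof. by case: x. Qed.
Lemma cReM x y : complex.Re (x * y) =
  complex.Re x * complex.Re y - complex.Im x * complex.Im y.
Proof. by case: x y => ? ? [? ?]. Qed.
Lemma cImM x y : complex.Im (x * y) =
  complex.Re x * complex.Im y + complex.Im x * complex.Re y.
Proof. by case: x y => ? ? [? ?]. Qed.
Lemma Re_conjc x : complex.Re x^* = complex.Re x.
Proof. by case: x. Qed.
Lemma Im_conjc x : complex.Im x^* = - complex.Im x.
Proof. by case: x. Qed.
Lemma Re_sum (I : Type) (s : seq I) (F : I -> R[i]) :
  complex.Re (\sum_(i <- s) F i) = \sum_(i <- s) complex.Re (F i).
Proof. by elim/big_rec2: _ => // i a b _ <-; rewrite cReD. Qed.
Lemma Im_sum (I : Type) (s : seq I) (F : I -> R[i]) :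
  complex.Im (\sum_(i <- s) F i) = \sum_(i <- s) complex.Im (F i).
Proof. by elim/big_rec2: _ => // i a b _ <-; rewrite cImD. Qed.

Lemma complex_ext x y :
  complex.Re x = complex.Re y -> complex.Im x = complex.Im y -> x = y.
Proof. by case: x y => ? ? [? ?] /= -> ->. Qed.

Lemma sqr_normc x : normc x ^+ 2 = complex.Re x ^+ 2 + complex.Im x ^+ 2.
Proof. by case: x => a b; rewrite /= sqr_sqrtr// addr_ge0 ?sqr_ge0. Qed.

Lemma normc_ge0 x : 0 <= normc x.
Proof. by case: x => a b; exact: sqrtr_ge0. Qed.

Lemma Re_le_normc x : `|complex.Re x| <= normc x.
Proof.
rewrite -(@ler_pXn2r _ 2) ?nnegrE ?normc_ge0// sqr_normc real_normK ?num_real//.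
by rewrite lerDl sqr_ge0.
Qed.

Lemma Im_le_normc x : `|complex.Im x| <= normc x.
Proof.
rewrite -(@ler_pXn2r _ 2) ?nnegrE ?normc_ge0// sqr_normc real_normK ?num_real//.
by rewrite lerDr sqr_ge0.
Qed.

Lemma normc_conjc x : normc x^* = normc x.
Proof. by case: x => a b /=; rewrite sqrrN. Qed.

Lemma normcN x : normc (- x) = normc x.
Proof. by case: x => a b /=; rewrite !sqrrN. Qed.

Lemma normc_real (a : R) : normc a%:C = `|a|.
Proof. by rewrite /= expr0n addr0 sqrtr_sqr. Qed.

Lemma ler_normcD x y : normc (x + y) <= normc x + normc y.
Proof.
have : `|x + y| <= `|x| + `|y| := ler_normD x y.
by case: x y => a b [c e]; rewrite lecE => /andP[].
Qed.

Lemma ler_normc_sum (I : Type) (s : seq I) (F : I -> R[i]) :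
  normc (\sum_(i <- s) F i) <= \sum_(i <- s) normc (F i).
Proof.
elim/big_rec2: _ => [|i a b _ H]; first by rewrite normc0.
by rewrite (le_trans (ler_normcD _ _))// lerD2l.
Qed.

Lemma normcE x : `|x| = (normc x)%:C.
Proof. by case: x. Qed.

Lemma mulc_conjc x : x * x^* = (normc x ^+ 2)%:C.
Proof.
rewrite sqr_normc; apply: complex_ext; rewrite ?cReM ?cImM Re_conjc Im_conjc/=; ring.
Qed.

End ComplexParts.

(** * Trigonometric polynomials *)

Section TrigPoly.
Variables (R : realType) (d : nat).
Local Notation C := R[i].
Local Notation T := (pt R d).
Local Open Scope complex_scope.
Implicit Types (k l : freq d) (s t : seq (freq d * C)) (x : T).

Definition phase k x : R := 2 * pi * \sum_j (k j)%:~R * tnth x j.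

Lemma echarE k x : echar k x = cos (phase k x) +i* sin (phase k x).
Proof. by []. Qed.

Lemma phaseD k l x : phase (k + l) x = phase k x + phase l x.
Proof.
rewrite /phase -mulrDr -big_split/=; congr (_ * _).
by apply: eq_bigr => j _; rewrite ffunE intrD mulrDl.
Qed.

Lemma phase0 x : phase 0 x = 0.
Proof. by rewrite /phase big1 ?mulr0// => j _; rewrite ffunE mul0r. Qed.

Lemma phaseN k x : phase (- k) x = - phase k x.
Proof. by apply/eqP; rewrite -addr_eq0 -phaseD addNr phase0. Qed.

Lemma echarD k l x : echar (k + l) x = echar k x * echar l x.
Proof. by rewrite !echarE phaseD cosD sinD; apply: complex_ext; rewrite ?cReM ?cImM/=; ring. Qed.

Lemma echar0 x : echar 0 x = 1 :> C.
Proof. by rewrite echarE phase0 cos0 sin0. Qed.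

Lemma echarN k x : echar (- k) x = (echar k x)^*.
Proof. by rewrite !echarE phaseN cosN sinN. Qed.

Lemma normc_echar k x : normc (echar k x) = 1 :> R.
Proof. by rewrite /= cos2Dsin2 sqrtr1. Qed.

Lemma measurable_phase k : measurable_fun setT (phase k).
Proof.
apply: measurable_funM => //; apply: measurable_sum => j.
by apply: measurable_funM => //; exact: measurable_tnth.
Qed.

Lemma measurable_cos_phase k : measurable_fun setT (fun x => cos (phase k x)).
Proof.
apply: (measurableT_comp _ (measurable_phase k)).
exact: (continuous_measurable_fun (@continuous_cos R)).
Qed.

Lemma measurable_sin_phase k : measurable_fun setT (fun x => sin (phase k x)).
Proof.
apply: (measurableT_comp _ (measurable_phase k)).
exact: (continuous_measurable_fun (@continuous_sin R)).
Qed.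

(* Polynomials are lists of (frequency, coefficient) pairs, in which a
   frequency may occur several times. *)
Definition tpoly s x : C := \sum_(p <- s) p.2 * echar p.1 x.

Lemma tpoly_cat s t x : tpoly (s ++ t) x = tpoly s x + tpoly t x.
Proof. exact: big_cat. Qed.

Definition tscale (c : C) s := [seq (p.1, c * p.2) | p <- s].

Lemma tpoly_scale c s x : tpoly (tscale c s) x = c * tpoly s x.
Proof. by rewrite /tpoly big_map mulr_sumr; apply: eq_bigr => p _; rewrite mulrA. Qed.

Definition tmul s t := [seq (p.1 + q.1, p.2 * q.2) | p <- s, q <- t].

Lemma tpoly_mul s t x : tpoly (tmul s t) x = tpoly s x * tpoly t x.
Proof.
rewrite /tpoly /tmul big_allpairs_dep mulr_suml; apply: eq_bigr => p _.
by rewrite mulr_sumr; apply: eq_bigr => q _ /=; rewrite echarD mulrACA.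
Qed.

Definition tconj s := [seq (- p.1, p.2^*) | p <- s].

Lemma tpoly_conj s x : tpoly (tconj s) x = (tpoly s x)^*.
Proof.
rewrite /tpoly big_map rmorph_sum; apply: eq_bigr => p _.
by rewrite rmorphM /= echarN.
Qed.

Definition twoipi (n : int) : C := 0 +i* (2 * pi * n%:~R).

Definition tderiv (j : 'I_d) s := [seq (p.1, twoipi (p.1 j) * p.2) | p : freq d * C <- s].

Definition tfreqs s : seq (freq d) := [seq p.1 | p <- s].

Lemma tpoly_bounded s : exists K : R, forall x, normc (tpoly s x) <= K.
Proof.
exists (\sum_(p <- s) normc p.2) => x; apply: le_trans (ler_normc_sum _ _) _.
by apply: ler_sum => p _; rewrite normcM normc_echar mulr1.
Qed.

Lemma measurable_Re_tpoly s : measurable_fun setT (fun x => complex.Re (tpoly s x)).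
Proof.
rewrite (_ : (fun x => _) = fun x => \sum_(p <- s)
  (complex.Re p.2 * cos (phase p.1 x) - complex.Im p.2 * sin (phase p.1 x))).
  apply: measurable_sum => p; apply: measurable_funB; apply: measurable_funM => //.
    exact: measurable_cos_phase.
  exact: measurable_sin_phase.
by apply/funext => x; rewrite Re_sum; apply: eq_bigr => p _; rewrite cReM.
Qed.

Lemma measurable_Im_tpoly s : measurable_fun setT (fun x => complex.Im (tpoly s x)).
Proof.
rewrite (_ : (fun x => _) = fun x => \sum_(p <- s)
  (complex.Re p.2 * sin (phase p.1 x) + complex.Im p.2 * cos (phase p.1 x))).
  apply: measurable_sum => p; apply: measurable_funD; apply: measurable_funM => //.
    exact: measurable_sin_phase.
  exact: measurable_cos_phase.
by apply/funext => x; rewrite Im_sum; apply: eq_bigr => p _; rewrite cImM.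
Qed.

End TrigPoly.

(** * Integration over the torus *)

Section HaarIntegral.
Variable R : realType.

Local Notation unif := (uniform_prob (@ltr01 R)).

Lemma haar_integrable_prod d (f : pt R d.+1 -> \bar R) :
  (haar R d.+1).-integrable setT f ->
  (unif \x haar R d)%E.-integrable setT (f \o @pt_cons R d).
Proof.
move=> /integrableP[mf fi]; apply/integrableP; split.
  by apply: measurableT_comp => //; exact: measurable_pt_cons.
apply: le_lt_trans fi; rewrite le_eqVlt; apply/orP; left; apply/eqP/esym.
rewrite [LHS](ge0_integral_pushforward (@measurable_pt_cons R d))//.
exact: measurableT_comp.
Qed.

Lemma haar_integral12 d (f : pt R d.+1 -> \bar R) :
  (haar R d.+1).-integrable setT f ->
  (\int[haar R d.+1]_x f x = \int[unif]_t \int[haar R d]_y f (pt_cons (t, y)))%E.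
Proof.
move=> fi; have fp := haar_integrable_prod fi.
rewrite [LHS](integral_pushforward (@measurable_pt_cons R d))//; last by case/integrableP : fi.
by rewrite preimage_setT -integral12_prod_meas1.
Qed.

Lemma haar_integral21 d (f : pt R d.+1 -> \bar R) :
  (haar R d.+1).-integrable setT f ->
  (\int[haar R d.+1]_x f x = \int[haar R d]_y \int[unif]_t f (pt_cons (t, y)))%E.
Proof.
move=> fi; have fp := haar_integrable_prod fi.
rewrite [LHS](integral_pushforward (@measurable_pt_cons R d))//; last by case/integrableP : fi.
by rewrite preimage_setT -integral21_prod_meas1.
Qed.

Lemma uniform_integral (g : R -> R) : measurable_fun setT g ->
  (\int[unif]_t (g t)%:E = \int[lebesgue_measure]_(t in `[0%R, 1%R]) (g t)%:E)%E.
Proof.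
move=> mg; have mG : measurable_fun setT (EFin \o g) by exact/measurable_EFinP.
rewrite integralE [RHS]integralE !integral_uniform//; first by rewrite subr0 invr1 !mul1e.
  exact: measurable_funeneg.
exact: measurable_funepos.
Qed.

Lemma uniform_integral_deriv (g g' : R -> R) :
  (forall t : R, is_derive t 1 g (g' t)) -> continuous g' -> g 1 = g 0 ->
  (\int[unif]_t (g' t)%:E = 0)%E.
Proof.
move=> dg cg' g10; rewrite uniform_integral; last exact: continuous_measurable_fun.
rewrite (@continuous_FTC2 _ g' g)//.
- by rewrite g10 subee.
- exact: continuous_subspaceT.
- have cg : continuous g by move=> t; apply/differentiable_continuous/derivable1_diffP; exact: ex_derive.
  split.
  + by move=> t _; exact: ex_derive.
  + by apply: cvg_at_right_filter; exact: cg.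
  + by apply: cvg_at_left_filter; exact: cg.
- by move=> t _; rewrite derive1E; exact: derive_val.
Qed.

(** Moving one coordinate turns partial derivatives on tuples into derivatives of functions of one
    real variable. *)
Definition tupd d (x : pt R d) (j : 'I_d) (t : R) : pt R d :=
  [tuple if i == j then t else tnth x i | i < d].

Lemma tupd_cons0 d (t s : R) (y : pt R d) :
  tupd (pt_cons (t, y)) ord0 s = pt_cons (s, y).
Proof.
apply/eq_from_tnth => i; rewrite tnth_mktuple.
by case: (unliftP ord0 i) => [k ->|->]; rewrite ?eqxx// !tnthS.
Qed.

Lemma tupd_consS d (t s : R) (y : pt R d) (j : 'I_d) :
  tupd (pt_cons (t, y)) (lift ord0 j) s = pt_cons (t, tupd y j s).
Proof.
apply/eq_from_tnth => i; rewrite tnth_mktuple.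
case: (unliftP ord0 i) => [k ->|->]; last by rewrite !tnth0.
by rewrite !tnthS tnth_mktuple (inj_eq lift_inj).
Qed.

(** Fubini with the j-th coordinate integrated innermost: there [g'] is the derivative of a function
    with equal end values, so the fundamental theorem of calculus gives 0. The induction peels off a
    first coordinate different from j; only almost every section is then known to be integrable,
    which is enough. *)
Lemma haar_integral_partial d (j : 'I_d) (g g' : pt R d -> R) :
  (haar R d).-integrable setT (EFin \o g') ->
  (forall x (t : R), is_derive t 1 (fun s => g (tupd x j s)) (g' (tupd x j t))) ->
  (forall x, continuous (fun s => g' (tupd x j s))) ->
  (forall x, g (tupd x j 1) = g (tupd x j 0)) ->
  (\int[haar R d]_x (g' x)%:E = 0)%E.
Proof.
elim: d j g g' => [[]//|d IH] j g g' ig' dg cg' per.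
case: (unliftP ord0 j) => [k jk|j0].
- rewrite (haar_integral12 ig').
  have /ae_integrable1 aeI := haar_integrable_prod ig'.
  rewrite (@ae_eq_integral _ _ _ unif setT (cst 0%E))//.
  + by rewrite integral0.
  + have := measurable_fubini_F (haar_integrable_prod ig').
    exact.
  + apply: filterS aeI => t it _ /=.
    apply: (IH k (fun y => g (pt_cons (t, y)))) => //.
    * move=> y s; have := dg (pt_cons (t, y)) s; rewrite jk tupd_consS.
      by under eq_fun do rewrite tupd_consS.
    * move=> y; have := cg' (pt_cons (t, y)); rewrite jk.
      by under eq_fun do rewrite tupd_consS.
    * by move=> y; have := per (pt_cons (t, y)); rewrite jk !tupd_consS.
- rewrite (haar_integral21 ig').
  rewrite (eq_integral (cst 0%E)) ?integral0// => y _ /=.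
  apply: (@uniform_integral_deriv (fun t => g (pt_cons (t, y)))).
  + move=> s; have := dg (pt_cons (0, y)) s; rewrite j0 tupd_cons0.
    by under eq_fun do rewrite tupd_cons0.
  + have := cg' (pt_cons (0, y)); rewrite j0.
    by under eq_fun do rewrite tupd_cons0.
  + by have := per (pt_cons (0, y)); rewrite j0 !tupd_cons0.
Qed.

(** Half-open, because the characters do not distinguish the coordinates 0 and 1: on this set of
    full measure they separate points. *)
Definition cube d : set (pt R d) := [set x | forall j, 0 <= tnth x j < 1].

Lemma uniform_setC_itv : unif (~` `[0, 1[%classic) = 0%E.
Proof.
rewrite /uniform_prob integral_uniform_pdf.
(* The uniform density lives on [0, 1], of which only the end point 1 is left. *)
rewrite (_ : ~` _ `&` _ = [set 1]).
  apply: null_set_integral => //; last exact: lebesgue_measure_set1.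
  by apply/measurable_EFinP/measurable_funTS; exact: measurable_uniform_pdf.
apply/seteqP; split=> [x|_ ->]; rewrite /= !in_itv/=.
  by case=> /negP; rewrite negb_and -leNgt -ltNge => h /andP[x0 x1]; lra.
by rewrite ltxx andbF lexx ler01.
Qed.

Lemma ae_cube d : {ae haar R d, forall x, cube x}.
Proof.
apply: filter_forall; elim: d => [[]//|d IH] j.
pose N m (i : 'I_m) := (fun x : pt R m => tnth x i) @^-1` (~` `[0, 1[%classic).
have mN m (i : 'I_m) : measurable (N m i).
  rewrite -[X in measurable X]setTI; apply: measurable_tnth => //.
  exact: measurableC.
exists (N _ j); split; [exact: mN| |by move=> x /= nx; rewrite /N/= in_itv].
rewrite /= /distribution /pushforward.
case: (unliftP ord0 j) => [k ->|->].
- have [A [mA A0 HA]] := IH k.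
  have Nk0 : haar R d (N _ k) = 0%E.
    apply: (subset_measure0 (mN d k) mA _ A0) => x Nx; apply: HA => /= h.
    by move: Nx; rewrite /N/= in_itv/= h.
  rewrite (_ : _ @^-1` _ = setT `*` N _ k); last first.
    by apply/seteqP; split=> [[t y]|[t y] []]; rewrite /N/= tnthS.
  rewrite (product_measure1E _ _ measurableT (mN d k)).
  by rewrite [X in (_ * X)%E]Nk0 mule0.
- rewrite (_ : _ @^-1` _ = (~` `[0, 1[%classic) `*` setT).
    rewrite product_measure1E//; last exact: measurableC.
    by rewrite [X in (X * _)%E]uniform_setC_itv mul0e.
  by apply/seteqP; split=> [[t y]|[t y] []]; rewrite /N/= tnth0.
Qed.

End HaarIntegral.

(** * Density of trigonometric polynomials in L2 *)

Section TrigDensity.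
Variables (R : realType) (d : nat).
Local Notation C := R[i].
Local Notation T := (pt R d).
Local Open Scope complex_scope.
Implicit Types (k : freq d) (x : T).

(** Real values but complex coefficients: this is a real algebra, as the density argument requires,
    and products are computed on coefficient lists. *)
Definition rtrig (f : T -> R) := exists s, forall x, (f x)%:C = tpoly s x.

Lemma rtrig_cst c : rtrig (cst c).
Proof. by exists [:: (0, c%:C)] => x; rewrite /tpoly big_seq1/= echar0 mulr1. Qed.

Lemma rtrigD f g : rtrig f -> rtrig g -> rtrig (fun x => f x + g x).
Proof.
by move=> [s fs] [t gt]; exists (s ++ t) => x; rewrite tpoly_cat -fs -gt rmorphD.
Qed.

Lemma rtrigM f g : rtrig f -> rtrig g -> rtrig (fun x => f x * g x).
Proof.
by move=> [s fs] [t gt]; exists (tmul s t) => x; rewrite tpoly_mul -fs -gt rmorphM.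
Qed.

Lemma rtrigN f : rtrig f -> rtrig (fun x => - f x).
Proof.
move=> [s fs]; exists (tscale (-1) s) => x.
by rewrite tpoly_scale mulN1r -fs rmorphN.
Qed.

Lemma rtrig_measurable f : rtrig f -> measurable_fun setT f.
Proof.
move=> [s fs]; rewrite (_ : f = fun x => complex.Re (tpoly s x)).
  exact: measurable_Re_tpoly.
by apply/funext => x; rewrite -fs.
Qed.

Lemma rtrig_bounded f : rtrig f -> exists K : R, forall x, `|f x| <= K.
Proof.
move=> [s fs]; have [K HK] := tpoly_bounded s; exists K => x.
by rewrite -normc_real fs.
Qed.

Lemma rtrig_cos k : rtrig (fun x => cos (phase k x)).
Proof.
exists [:: (k, (2^-1)%:C); (- k, (2^-1)%:C)] => x.
rewrite /tpoly big_cons big_seq1/= echarN echarE.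
by apply: complex_ext; rewrite ?(cReD, cImD, cReM, cImM)/=; field.
Qed.

Lemma rtrig_sin k : rtrig (fun x => sin (phase k x)).
Proof.
exists [:: (k, 0 -i* 2^-1); (- k, 0 +i* 2^-1)] => x.
rewrite /tpoly big_cons big_seq1/= echarN echarE.
by apply: complex_ext; rewrite ?(cReD, cImD, cReM, cImM)/=; field.
Qed.

Definition ebasis (j : 'I_d) : freq d := [ffun i => (i == j)%:Z].

Lemma phase_ebasis j x : phase (ebasis j) x = 2 * pi * tnth x j.
Proof.
rewrite /phase (bigD1 j)//= ffunE eqxx mul1r big1 ?addr0// => i ij.
by rewrite ffunE (negbTE ij) mul0r.
Qed.

Lemma sin_2pi_lt0 (t : R) : 2^-1 < t < 1 -> sin (2 * pi * t) < 0.
Proof.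
move=> t1; have p0 := pi_gt0 R.
rewrite (_ : 2 * pi * t = (2 * pi * t - pi) + pi); last by ring.
by rewrite sinDpi oppr_lt0 sin_gt0_pi//; apply/andP; split; nra.
Qed.

Lemma sin_2pi_ge0 (t : R) : 0 <= t <= 2^-1 -> 0 <= sin (2 * pi * t).
Proof.
by move=> t1; have p0 := pi_gt0 R; rewrite sin_ge0_pi//; apply/andP; split; nra.
Qed.

Lemma ltr_cos_2pi_half (t c : R) : 0 <= t <= 2^-1 -> 0 <= c <= 2^-1 ->
  (cos (2 * pi * c) < cos (2 * pi * t)) = (t < c).
Proof.
move=> t1 c1; have p0 := pi_gt0 R.
rewrite ltr_cos ?ltr_pM2l ?mulr_gt0// in_itv/=; apply/andP; split; nra.
Qed.

Lemma ltr_cos_2pi_half' (t c : R) : 2^-1 <= t <= 1 -> 2^-1 <= c <= 1 ->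
  (cos (2 * pi * t) < cos (2 * pi * c)) = (t < c).
Proof.
move=> t1 c1; have p0 := pi_gt0 R.
rewrite (_ : 2 * pi * t = (2 * pi * t - pi) + pi); last by ring.
rewrite (_ : 2 * pi * c = (2 * pi * c - pi) + pi); last by ring.
rewrite !cosDpi ltrN2 ltr_cos ?in_itv/=; first by rewrite ltrD2r ltr_pM2l// mulr_gt0.
  by apply/andP; split; nra.
by apply/andP; split; nra.
Qed.

Local Notation P := (alg_limit_set rtrig (@cube R d)).

Let Plt := alg_limit_set_lt (@cube R d) rtrig_cst rtrigD rtrigM rtrig_measurable rtrig_bounded.
Let PC := @alg_limit_setC _ _ _ rtrig (@cube R d) rtrig_cst rtrigD rtrigM.
Let PI := @alg_limit_setI _ _ _ rtrig (@cube R d) rtrigM.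

Let P_cube E F : measurable E -> P F ->
  (forall x, cube x -> E x <-> F x) -> P E.
Proof.
move=> mE [mF [f [Af f01 fF]]] EF; split=> //; exists f; split=> // x Qx.
rewrite (_ : \1_E x = \1_F x); first exact: fF.
rewrite !indicE; congr (nat_of_bool _)%:R.
by apply/idP/idP; rewrite !inE => /(EF x Qx).
Qed.

(** On [cube] the sign of sin(2 pi x) tells in which half of the circle x lies, and cos(2 pi x) is
    monotone on each half. For 0 < c <= 1/2, x < c means sin >= 0 and cos > cos(2 pi c); for 1/2 < c
    < 1, x >= c means sin < 0 and cos >= cos(2 pi c). *)
Lemma alg_limit_set_coord j c : P [set x | tnth x j < c].
Proof.
have mE : measurable [set x : T | tnth x j < c].
  rewrite -[X in measurable X]setTI (_ : [set _ | _] = (fun x => tnth x j) @^-1` `]-oo, c[).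
    exact: measurable_tnth.
  by apply/seteqP; split=> x; rewrite /= in_itv.
have PT : P setT := alg_limit_setT _ rtrig_cst.
have [c0|c0] := leP c 0.
  apply: (P_cube mE (PC PT)) => x /(_ j) /andP[x0 x1]; split=> //=.
  by move=> xc; rewrite leNgt (lt_le_trans xc) in x0.
have [c1|c1] := leP 1 c.
  by apply: (P_cube mE PT) => x /(_ j) /andP[x0 x1]; split=> //= _; exact: lt_le_trans c1.
pose k := ebasis j.
have Psin : P [set x | sin (phase k x) < 0] := Plt 0 (rtrig_sin k).
have [c2|c2] := leP c 2^-1.
  have Pcos : P [set x | - cos (phase k x) < - cos (2 * pi * c)].
    exact: (Plt _ (rtrigN (rtrig_cos k))).
  apply: (P_cube mE (PI (PC Psin) Pcos)) => x /(_ j) /andP[x0 x1].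
  rewrite /= !phase_ebasis; split=> [xc|[/negP + +]].
    by split; [apply/negP; rewrite -leNgt sin_2pi_ge0//|rewrite ltrN2 ltr_cos_2pi_half//]; lra.
  rewrite -leNgt ltrN2 => s0; have [x2|x2] := leP (tnth x j) 2^-1.
    by rewrite ltr_cos_2pi_half//; lra.
  by have := @sin_2pi_lt0 (tnth x j); rewrite x2 x1 => /(_ isT); rewrite ltNge s0.
have Pcos : P [set x | cos (phase k x) < cos (2 * pi * c)] := Plt _ (rtrig_cos k).
apply: (P_cube mE (PC (PI Psin (PC Pcos)))) => x /(_ j) /andP[x0 x1].
rewrite /= !phase_ebasis; split=> [xc [s0]|].
  case: (leP (tnth x j) 2^-1) => x2.
    by have := @sin_2pi_ge0 (tnth x j); rewrite x0 x2 => /(_ isT); rewrite leNgt s0.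
  by rewrite ltr_cos_2pi_half'//; lra.
apply: contra_notP => /negP; rewrite -leNgt => cx; split.
  by apply: sin_2pi_lt0; rewrite (lt_le_trans c2 cx).
by apply/negP; rewrite ltr_cos_2pi_half' -?leNgt//; lra.
Qed.

Lemma trig_dense (h : T -> R) (e : R) : sqint (haar R d) h -> 0 < e ->
  exists2 g, rtrig g & (\int[haar R d]_x (h x - g x) ^+ 2 <= e)%R.
Proof.
move=> sh; have [_] : l2_approximable (haar R d) rtrig h; last exact.
apply: (@sqint_l2_approximable _ _ _ _ _ (@cube R d)) => //.
- exact: rtrig_cst.
- exact: rtrigD.
- exact: rtrigM.
- exact: rtrig_measurable.
- exact: rtrig_bounded.
- exact: ae_cube.
move=> E mE.
(* The identity is measurable from the generated sigma-algebra because its coordinates are; so the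
   half-spaces generate all measurable sets. *)
have mid : measurable_fun setT (idfun : g_sigma_algebraType P -> T).
  apply/measurable_fun_tnthP => j.
  apply: (measurability _ (RGenInftyO.measurableE R)) => _ [_ [c ->] <-].
  rewrite setTI; apply: sub_sigma_algebra.
  rewrite (_ : _ @^-1` _ = [set x | tnth x j < c]); first exact: alg_limit_set_coord.
  by apply/seteqP; split=> x; rewrite /= in_itv.
by have := mid measurableT E mE; rewrite setTI.
Qed.

End TrigDensity.

(** * Periodic test functions and integration by parts *)

Section PointRow.
Variables (R : realType) (d : nat).
Local Notation T := (pt R d).
Implicit Types (x : T) (psi phi : 'rV[R]_d -> R).

(** The measure lives on tuples, the topology and the derivatives of test functions on row vectors;
    this map joins them. *)
Definition pt_row x : 'rV[R]_d := \row_i tnth x i.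

(** An open set is the countable union of the boxes with rational centre and radius 1/(n+1) that it
    contains, and a box is measurable coordinate by coordinate. *)
Lemma measurable_pt_row_open (U : set 'rV[R]_d) : open U ->
  measurable (pt_row @^-1` U).
Proof.
move=> oU.
pose B (p : d.-tuple rat * nat) : set T :=
  [set x | forall i, `|tnth x i - ratr (tnth p.1 i)| < p.2.+1%:R^-1].
have mB p : measurable (B p).
  rewrite (_ : B p = \bigcap_(i in [set: 'I_d])
      (fun x => tnth x i) @^-1` ball (ratr (tnth p.1 i) : R) p.2.+1%:R^-1).
    apply: fin_bigcap_measurable; first exact: finite_finset.
    move=> i _; rewrite -[X in measurable X]setTI; apply: measurable_tnth => //.
    exact: measurable_ball.
  apply/seteqP; split=> x /= Hx i; last by have := Hx i I; rewrite /ball/= distrC.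
  by move=> _; rewrite /ball/= distrC.
rewrite (_ : _ @^-1` _ =
    \bigcup_(p in [set: d.-tuple rat * nat]) (if `[< B p `<=` pt_row @^-1` U >] then B p else set0)).
  apply: countable_bigcupT_measurable; first exact: countableP.
  by move=> p; case: ifP.
apply/seteqP; split=> [x /= Ux|x [p _]]; last by case: ifPn => // /asboolP H /H.
(* A box of radius m < e/2 whose centre is within m of x stays within e of x. *)
have /nbhs_ballP[e /= e0 xeU] : nbhs (pt_row x) U by exact: open_nbhs_nbhs.
have [n n1] : exists n, n.+1%:R^-1 < e / 2.
  have e2 : 0 < e / 2 by lra.
  have [N _ /(_ N (leqnn N))] := near_infty_natSinv_lt (PosNum e2).
  by exists N.
have [m mE /andP[m0 m1]] : exists2 m : R, m = n.+1%:R^-1 & 0 < m < e / 2.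
  by exists n.+1%:R^-1; rewrite // n1 invr_gt0 ltr0n.
have /choice[q Hq] (i : 'I_d) : exists q : rat, `|tnth x i - ratr q| < m.
  have [|q] := @rat_in_itvoo R (tnth x i - m) (tnth x i + m); first lra.
  by rewrite in_itv/= => /andP[q1 q2]; exists q; rewrite ltr_norml; apply/andP; split; lra.
exists ([tuple q i | i < d], n) => //.
rewrite asboolT; first by move=> i; rewrite /= tnth_mktuple -mE.
move=> y By; apply: xeU; split=> // i j.
rewrite !mxE /ball/=; have := By j; have := Hq j; rewrite /= tnth_mktuple -mE.
rewrite !ltr_norml => /andP[a1 a2] /andP[b1 b2]; apply/andP; split; lra.
Qed.

Lemma measurable_continuous_pt_row psi : continuous psi ->
  measurable_fun setT (fun x => psi (pt_row x)).
Proof.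
move=> cpsi; apply: (measurability _ (RGenInftyO.measurableE R)) => _ [_ [c ->] <-].
rewrite setTI; apply: (measurable_pt_row_open (U := psi @^-1` `]-oo, c[)).
by apply: open_comp => [v _|]; [exact: cpsi|rewrite set_itvE; exact: open_lt].
Qed.

Lemma bounded_continuous_cube psi : continuous psi ->
  exists K : R, forall x, cube x -> `|psi (pt_row x)| <= K.
Proof.
move=> cpsi.
have := @rV_compact R d (fun=> `[0, 1]%classic) (fun=> @segment_compact R 0 1).
move/(continuous_compact (continuous_subspaceT cpsi))/compact_bounded.
move=> [M [_ /(_ (M + 1)) H]]; exists (M + 1) => x Qx.
apply: H; first lra.
exists (pt_row x) => // i; rewrite /= in_itv/= mxE.
by have /andP[-> /ltW ->] := Qx i.
Qed.

Lemma Lint_ae_bounded (f : T -> R) (K : R) : measurable_fun setT f ->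
  {ae haar R d, forall x, `|f x| <= K} -> Lint (haar R d) f.
Proof.
move=> mf fK; apply/integrableP; split; first exact/measurable_EFinP.
apply: (@le_lt_trans _ _ (\int[haar R d]_x `|K|%:E)%E).
  apply: ae_ge0_le_integral => //.
  - by apply/measurable_EFinP; exact: measurableT_comp.
  - by apply: filterS fK => x fK _; rewrite lee_fin (le_trans fK)// ler_norm.
by rewrite integral_cst// [X in (_ * X)%E]probability_setT mule1 ltry.
Qed.

Lemma Lint_pt_row psi : continuous psi -> Lint (haar R d) (fun x => psi (pt_row x)).
Proof.
move=> cpsi; have [K HK] := bounded_continuous_cube cpsi.
apply: (@Lint_ae_bounded _ K); first exact: measurable_continuous_pt_row.
by apply: filterS (@ae_cube R d) => x /HK.
Qed.

(** Just what makes the integral of [g'] vanish when [g'] is integrable. The notion is stable under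
    products, and the product rule then yields integration by parts. *)
Definition periodic_partial (j : 'I_d) (g g' : T -> R) :=
  [/\ forall x (t : R), is_derive t 1 (fun s => g (tupd x j s)) (g' (tupd x j t)),
      forall x, continuous (fun s => g' (tupd x j s)) &
      forall x, g (tupd x j 1) = g (tupd x j 0)].

Lemma periodic_partialM j g g' h h' :
  periodic_partial j g g' -> periodic_partial j h h' ->
  periodic_partial j (fun x => g x * h x) (fun x => g x * h' x + g' x * h x).
Proof.
move=> [dg cg pg] [dh ch ph].
have cont (u u' : T -> R) x : (forall x (t : R), is_derive t 1 (fun s => u (tupd x j s)) (u' (tupd x j t))) ->
    continuous (fun s => u (tupd x j s)).
  by move=> du t; apply/differentiable_continuous/derivable1_diffP; exact: ex_derive.
split=> [x t|x t|x]; last by rewrite pg ph.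
  by rewrite [g' _ * _]mulrC; exact: (is_deriveM (dg x t) (dh x t)).
apply: cvgD; apply: cvgM.
- exact: (cont g g' x dg).
- exact: ch.
- exact: cg.
- exact: (cont h h' x dh).
Qed.

Lemma periodic_partial_ibp j g g' h h' :
  periodic_partial j g g' -> periodic_partial j h h' ->
  Lint (haar R d) (fun x => g x * h' x) -> Lint (haar R d) (fun x => g' x * h x) ->
  (\int[haar R d]_x (g x * h' x) = - \int[haar R d]_x (g' x * h x))%R.
Proof.
move=> pg ph i1 i2; have [dM cM pM] := periodic_partialM pg ph.
have /(congr1 fine)/= E := @haar_integral_partial R d j (fun x => g x * h x) _ (LintD i1 i2) dM cM pM.
by apply/eqP; rewrite -addr_eq0 -RintegralD//; apply/eqP.
Qed.

Lemma pt_row_tupd x j (t : R) :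
  pt_row (tupd x j t) = pt_row (tupd x j 0) + t *: delta_mx 0 j.
Proof.
apply/rowP => i; rewrite !mxE !tnth_mktuple eqxx/=.
by case: eqP => _; rewrite ?mulr1 ?mulr0 ?add0r ?addr0.
Qed.

Lemma periodic_partial_test j phi : test_function phi ->
  periodic_partial j (fun x => phi (pt_row x)) (fun x => 'D_(delta_mx 0 j) phi (pt_row x)).
Proof.
move=> [smo per]; have [_ dphi] := smo [::]; have [cD _] := smo [:: j].
split=> [x t|x|x].
- pose v := pt_row (tupd x j 0).
  (* Along the coordinate line both difference quotients are the same function of h, so
     differentiability and the derivative transfer together. *)
  have E : (fun h : R => h^-1 *: (((fun s => phi (pt_row (tupd x j s))) \o shift t) (h *: 1) -
        phi (pt_row (tupd x j t)))) =
      (fun h : R => h^-1 *: ((phi \o shift (pt_row (tupd x j t))) (h *: delta_mx 0 j) -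
        phi (pt_row (tupd x j t)))).
    apply/funext => h; congr (_ *: (phi _ - _)).
    rewrite /= (pt_row_tupd x j (_ + _)) (pt_row_tupd x j t).
    by rewrite [h *: 1]mulr1 scalerDl addrCA.
  have dt := dphi j (pt_row (tupd x j t)).
  split; first by rewrite /derivable E; exact: dt.
  by rewrite /derive E.
- rewrite (_ : (fun s => _) = 'D_(delta_mx 0 j) phi \o
      (fun s => pt_row (tupd x j 0) + s *: delta_mx 0 j)); last first.
    by apply/funext => s /=; rewrite pt_row_tupd.
  move=> s; apply: continuous_comp; last exact: cD.
  by apply: cvgD; [exact: cvg_cst|apply: cvgZr_tmp; exact: cvg_id].
- by rewrite pt_row_tupd scale1r per [in RHS]pt_row_tupd scale0r addr0.
Qed.

End PointRow.

(** * Derivatives of trigonometric polynomials *)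

Section TrigCalculus.
Variables (R : realType) (d : nat).
Local Notation C := R[i].
Local Notation T := (pt R d).
Local Open Scope complex_scope.
Implicit Types (k : freq d) (s : seq (freq d * C)) (x : T) (j : 'I_d).

Lemma phase_tupd k j x (t : R) :
  phase k (tupd x j t) = phase k (tupd x j 0) + 2 * pi * (k j)%:~R * t.
Proof.
rewrite /phase -[_ * _ * _ * t]mulrA -mulrDr; congr (_ * _).
rewrite (bigD1 j)//= [in RHS](bigD1 j)//= !tnth_mktuple eqxx mulr0 add0r addrC; congr (_ + _).
by apply: eq_bigr => i ij; rewrite !tnth_mktuple (negbTE ij).
Qed.

Lemma tupd_id x j : tupd x j (tnth x j) = x.
Proof.
by apply: eq_from_tnth => i; rewrite tnth_mktuple; case: eqP => [->|].
Qed.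

Lemma cosDz (a : R) (n : int) : cos (a + 2 * pi * n%:~R) = cos a.
Proof.
have cn (m : nat) (b : R) : cos (b + 2 * pi * m%:R) = cos b.
  by rewrite -(periodicn (@cosD2pi R) m b) -mulr_natr; congr (cos (_ + _)); ring.
case: n => m; first exact: cn.
by rewrite NegzE mulrNz mulrN -[LHS](cn m.+1); congr cos; exact: subrK.
Qed.

Lemma sinDz (a : R) (n : int) : sin (a + 2 * pi * n%:~R) = sin a.
Proof.
by rewrite -[sin a]cosBpihalf -(cosDz _ n) -cosBpihalf; congr cos; ring.
Qed.

Lemma echar_tupdD1 k j x (t : R) : echar k (tupd x j (t + 1)) = echar k (tupd x j t) :> C.
Proof.
by rewrite !echarE (phase_tupd k j x (t + 1)) mulrDr mulr1 addrA cosDz sinDz -phase_tupd.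
Qed.

Lemma tpoly_tupdD1 s j x (t : R) : tpoly s (tupd x j (t + 1)) = tpoly s (tupd x j t).
Proof. by apply: eq_bigr => p _; rewrite echar_tupdD1. Qed.

Let is_derive_phase k j x (t : R) :
  is_derive t 1 (fun r => phase k (tupd x j r)) (2 * pi * (k j)%:~R).
Proof.
rewrite (_ : (fun r => _) = cst (phase k (tupd x j 0)) + (2 * pi * (k j)%:~R) \*: id).
  apply: is_derive_eq.
  by rewrite add0r /GRing.scale/= mulr1.
by apply/funext => r; rewrite phase_tupd.
Qed.

Lemma is_derive_cos_phase k j x (t : R) :
  is_derive t 1 (fun r => cos (phase k (tupd x j r)))
    (- (2 * pi * (k j)%:~R) * sin (phase k (tupd x j t))).
Proof.
apply: (is_derive_eq (is_derive1_comp (is_derive_cos _) (is_derive_phase k j x t))).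
ring.
Qed.

Lemma is_derive_sin_phase k j x (t : R) :
  is_derive t 1 (fun r => sin (phase k (tupd x j r)))
    (2 * pi * (k j)%:~R * cos (phase k (tupd x j t))).
Proof.
apply: (is_derive_eq (is_derive1_comp (is_derive_sin _) (is_derive_phase k j x t))).
exact: mulrC.
Qed.

Lemma is_derive_Re_tpoly s j x (t : R) :
  is_derive t 1 (fun r => complex.Re (tpoly s (tupd x j r)))
    (complex.Re (tpoly (tderiv j s) (tupd x j t))).
Proof.
elim: s => [|p s IH].
  rewrite (_ : (fun r => _) = cst 0); last by apply/funext => r; rewrite /tpoly big_nil.
  by rewrite /tpoly big_nil; exact: is_derive_cst.
rewrite (_ : (fun r => _) = (complex.Re p.2 \*: (fun r => cos (phase p.1 (tupd x j r)))
   - complex.Im p.2 \*: (fun r => sin (phase p.1 (tupd x j r))))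
   + (fun r => complex.Re (tpoly s (tupd x j r)))); last first.
  by apply/funext => r; rewrite /tpoly big_cons cReD cReM.
apply: (is_derive_eq (is_deriveD (is_deriveB (is_deriveZ _ (is_derive_cos_phase _ _ _ _))
  (is_deriveZ _ (is_derive_sin_phase _ _ _ _))) IH)).
rewrite /tpoly /= big_cons cReD; congr (_ + _).
by rewrite !cReM !cImM/= /GRing.scale/=; ring.
Qed.

Lemma continuous_Re_tpoly_tupd s j x : continuous (fun t : R => complex.Re (tpoly s (tupd x j t))).
Proof.
move=> t; apply/differentiable_continuous/derivable1_diffP.
by have [] := is_derive_Re_tpoly s j x t.
Qed.

Lemma periodic_partial_Re_tpoly j s :
  periodic_partial j (fun x => complex.Re (tpoly s x))
    (fun x => complex.Re (tpoly (tderiv j s) x)).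
Proof.
split=> [x t|x|x].
- exact: is_derive_Re_tpoly.
- exact: continuous_Re_tpoly_tupd.
- by rewrite -[in LHS](add0r 1) tpoly_tupdD1.
Qed.

Definition row_pt (v : 'rV[R]_d) : T := [tuple v ord0 i | i < d].

Lemma row_ptK x : row_pt (pt_row x) = x.
Proof. by apply: eq_from_tnth => i; rewrite tnth_mktuple mxE. Qed.

Lemma row_pt_shift v j (h : R) :
  row_pt (v + h *: delta_mx ord0 j) = tupd (row_pt v) j (v ord0 j + h).
Proof.
apply: eq_from_tnth => i; rewrite !tnth_mktuple !mxE eqxx/=.
by case: eqP => [->|]; rewrite ?mulr1 ?mulr0 ?addr0.
Qed.

Lemma continuous_Re_tpoly_row s : continuous (fun v => complex.Re (tpoly s (row_pt v))).
Proof.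
have cD (f g : 'rV[R]_d -> R) : continuous f -> continuous g -> continuous (fun v => f v + g v).
  by move=> cf cg v; exact: continuousD (cf v) (cg v).
have cM c (f : 'rV[R]_d -> R) : continuous f -> continuous (fun v => c * f v).
  by move=> cf v; exact: continuousM (@cst_continuous _ _ c v) (cf v).
have cphase k : continuous (fun v => phase k (row_pt v)).
  apply: (cM _ (fun v => \sum_i (k i)%:~R * tnth (row_pt v) i)).
  elim: (index_enum _) => [|i r IH].
    by under eq_fun do rewrite big_nil; exact: cst_continuous.
  under eq_fun do rewrite big_cons.
  apply: cD => //; apply: cM; under eq_fun do rewrite tnth_mktuple.
  exact: coord_continuous.
elim: s => [|p s IH].
  by under eq_fun do rewrite /tpoly big_nil; exact: cst_continuous.
rewrite (_ : (fun v => _) = fun v => (complex.Re p.2 * cos (phase p.1 (row_pt v))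
   + (- complex.Im p.2) * sin (phase p.1 (row_pt v)))
   + complex.Re (tpoly s (row_pt v))); last first.
  by apply/funext => r; rewrite /tpoly big_cons cReD cReM mulNr.
apply: (cD _ _ _ IH); apply: cD; apply: cM => v.
  by apply: continuous_comp; [exact: cphase|exact: continuous_cos].
by apply: continuous_comp; [exact: cphase|exact: continuous_sin].
Qed.

Lemma is_derive_Re_tpoly_row s v j :
  is_derive v (delta_mx ord0 j) (fun v => complex.Re (tpoly s (row_pt v)))
    (complex.Re (tpoly (tderiv j s) (row_pt v))).
Proof.
have := is_derive_Re_tpoly s j (row_pt v) (v ord0 j).
pose f v := complex.Re (tpoly s (row_pt v)).
pose g (r : R) := complex.Re (tpoly s (tupd (row_pt v) j r)).
rewrite -/f -/g.
have E : (fun h : R => h^-1 *: ((g \o shift (v ord0 j)) (h *: 1) - g (v ord0 j))) =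
    (fun h : R => h^-1 *: ((f \o shift v) (h *: delta_mx ord0 j) - f v)).
  apply/funext => h; congr (_ *: (_ - _)).
    by rewrite /f /g/= [_ + v]addrC row_pt_shift [_ + v _ _]addrC [h *: 1]mulr1.
  have vj : v ord0 j = tnth (row_pt v) j by rewrite tnth_mktuple.
  by rewrite /g/= vj tupd_id.
have vj : v ord0 j = tnth (row_pt v) j by rewrite tnth_mktuple.
rewrite [X in tupd _ _ X]vj tupd_id; move=> [dg Dg]; split; first by rewrite /derivable -E; exact: dg.
by rewrite /derive -E.
Qed.

(** The class is stable under partial derivatives, which act on lists by [tderiv]; an induction on
    the sequence of directions therefore reaches all iterated derivatives. *)
Lemma test_function_Re_tpoly s : test_function (fun v => complex.Re (tpoly s (row_pt v))).
Proof.
split=> [r|j v]; last first.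
  rewrite -[delta_mx _ _]scale1r row_pt_shift tpoly_tupdD1.
  have -> : v 0 j = tnth (row_pt v) j by rewrite tnth_mktuple.
  by rewrite tupd_id.
have [s' ->] : exists s', foldr (fun j h => 'D_(delta_mx 0 j) h)
    (fun v => complex.Re (tpoly s (row_pt v))) r = (fun v => complex.Re (tpoly s' (row_pt v))).
  elim: r => [|j r [s' IH]]; first by exists s.
  exists (tderiv j s'); rewrite /= IH; apply/funext => v.
  by have [_ ->] := is_derive_Re_tpoly_row s' v j.
split; first exact: continuous_Re_tpoly_row.
by move=> j v; have [] := is_derive_Re_tpoly_row s' v j.
Qed.

(** Im z = Re(-i z): facts about real parts, applied to a rotated list, also cover imaginary
    parts. *)
Lemma tpoly_Im s x : complex.Im (tpoly s x) = complex.Re (tpoly (tscale (0 -i* 1) s) x).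
Proof. by rewrite tpoly_scale cReM/=; ring. Qed.

Lemma weak_partialP j (u h : T -> C) : weak_partial j u h <->
  forall phi, test_function phi ->
   (\int[haar R d]_x (complex.Re (u x) * 'D_(delta_mx 0 j) phi (pt_row x)) =
      - \int[haar R d]_x (complex.Re (h x) * phi (pt_row x)))%R /\
   (\int[haar R d]_x (complex.Im (u x) * 'D_(delta_mx 0 j) phi (pt_row x)) =
      - \int[haar R d]_x (complex.Im (h x) * phi (pt_row x)))%R.
Proof.
have ER (w : T -> C) (psi : 'rV[R]_d -> R) :
   cintegral (fun x => w x * (psi (pt_row x))%:C) =
   (\int[haar R d]_x (complex.Re (w x) * psi (pt_row x)))%R +i*
   (\int[haar R d]_x (complex.Im (w x) * psi (pt_row x)))%R.
  rewrite /cintegral; congr (_ +i* _); apply: eq_Rintegral => x _.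
    by rewrite cReM/=; ring.
  by rewrite cImM/=; ring.
split=> [wp phi tp|H phi tp].
  have := wp phi tp; rewrite (ER u ('D_(delta_mx 0 j) phi)) (ER h phi) => E.
  by have := congr1 (@complex.Re R) E; have := congr1 (@complex.Im R) E.
rewrite (ER u ('D_(delta_mx 0 j) phi)) (ER h phi).
by have [-> ->] := H phi tp.
Qed.

Lemma weak_partial_tpoly j s : weak_partial j (tpoly s) (tpoly (tderiv j s)).
Proof.
apply/weak_partialP => phi tp.
have pp := periodic_partial_test j tp; have [smo _] := tp.
have [cphi _] := smo [::]; have [cD _] := smo [:: j].
have int s' psi : continuous psi ->
    Lint (haar R d) (fun x => complex.Re (tpoly s' x) * psi (pt_row x)).
  move=> cpsi; have [K HK] := bounded_continuous_cube cpsi.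
  have [M HM] := tpoly_bounded s'.
  apply: (@Lint_ae_bounded _ _ _ (M * K)).
    apply: measurable_funM; first exact: measurable_Re_tpoly.
    exact: measurable_continuous_pt_row.
  apply: filterS (@ae_cube R d) => x /HK xK; rewrite normrM ler_pM//.
  exact: le_trans (Re_le_normc _) (HM x).
have re s' : (\int[haar R d]_x (complex.Re (tpoly s' x) * 'D_(delta_mx 0 j) phi (pt_row x)) =
      - \int[haar R d]_x (complex.Re (tpoly (tderiv j s') x) * phi (pt_row x)))%R.
  apply: (periodic_partial_ibp (periodic_partial_Re_tpoly j s') pp).
    exact: (int s' ('D_(delta_mx 0 j) phi) cD).
  exact: (int (tderiv j s') phi cphi).
split; first exact: re.
under eq_Rintegral do rewrite tpoly_Im; rewrite re; congr (- _).
apply: eq_Rintegral => x _; rewrite tpoly_Im; congr (complex.Re _ * _).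
rewrite /tpoly /tscale /tderiv !big_map; apply: eq_bigr => p _ /=.
by rewrite mulrCA.
Qed.

End TrigCalculus.

(** * Complex vector fields in L2 *)

Section ComplexL2.
Context dsp (T : measurableType dsp) (R : realType) (mu : {finite_measure set T -> \bar R}).
Local Notation C := R[i].
Local Open Scope complex_scope.
Implicit Types (f g : T -> R) (u v w : T -> C).

Lemma Rint_ae_ge0 f : Lint mu f -> {ae mu, forall x, 0 <= f x} -> 0 <= (\int[mu]_x f x)%R.
Proof.
move=> fi f0; rewrite /Rintegral (@ae_eq_integral _ _ _ mu _ (fun x => `|f x|%:E)%E) //.
- by apply/fine_ge0/integral_ge0 => x _; rewrite lee_fin.
- by apply/measurable_EFinP; exact: Lint_measurable fi.
- by apply/measurable_EFinP; apply: measurableT_comp => //; exact: Lint_measurable fi.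
- by apply: filterS f0 => x x0 _; rewrite ger0_norm.
Qed.

Lemma Rint_ae_le f g : Lint mu f -> Lint mu g -> {ae mu, forall x, f x <= g x} ->
  (\int[mu]_x f x <= \int[mu]_x g x)%R.
Proof.
move=> fi gi fg; rewrite -subr_ge0 -RintegralB//; apply: Rint_ae_ge0; first exact: LintB.
by apply: filterS fg => x; rewrite subr_ge0.
Qed.

Lemma Rint_ae_eq f g : Lint mu f -> Lint mu g -> {ae mu, forall x, f x = g x} ->
  (\int[mu]_x f x = \int[mu]_x g x)%R.
Proof.
by move=> fi gi fg; apply/eqP; rewrite eq_le; apply/andP; split; apply: Rint_ae_le => //;
  apply: filterS fg => x ->.
Qed.

Lemma Lint_ae_le f g : measurable_fun setT f -> Lint mu g ->
  {ae mu, forall x, `|f x| <= g x} -> Lint mu f.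
Proof.
move=> mf /integrableP[/measurable_EFinP mg gi] fg.
apply/integrableP; split; first exact/measurable_EFinP.
apply: le_lt_trans gi; apply: ae_ge0_le_integral => //.
- by apply/measurable_EFinP; exact: measurableT_comp.
- by apply/measurable_EFinP; exact: measurableT_comp.
- by apply: filterS fg => x fg _; rewrite lee_fin (le_trans fg)// ler_norm.
Qed.

Definition cmeas u := measurable_fun setT (fun x => complex.Re (u x)) /\
  measurable_fun setT (fun x => complex.Im (u x)).

Lemma cmeasM u v : cmeas u -> cmeas v -> cmeas (fun x => u x * v x).
Proof.
move=> [? ?] [? ?]; split.
  by under eq_fun do rewrite cReM; apply: measurable_funB; exact: measurable_funM.
by under eq_fun do rewrite cImM; apply: measurable_funD; exact: measurable_funM.
Qed.

Lemma cmeasD u v : cmeas u -> cmeas v -> cmeas (fun x => u x + v x).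
Proof.
move=> [? ?] [? ?]; split.
  by under eq_fun do rewrite cReD; exact: measurable_funD.
by under eq_fun do rewrite cImD; exact: measurable_funD.
Qed.

Lemma cmeasN u : cmeas u -> cmeas (fun x => - u x).
Proof.
move=> [? ?]; split.
  by under eq_fun do rewrite cReN; exact: measurable_funN.
by under eq_fun do rewrite cImN; exact: measurable_funN.
Qed.

Lemma cmeas_conj u : cmeas u -> cmeas (fun x => (u x)^*).
Proof.
move=> [? ?]; split; first by under eq_fun do rewrite Re_conjc.
by under eq_fun do rewrite Im_conjc; exact: measurable_funN.
Qed.

Lemma cmeas_real f : measurable_fun setT f -> cmeas (fun x => (f x)%:C).
Proof. by move=> ?; split. Qed.

Lemma cmeas_normc u : cmeas u -> measurable_fun setT (fun x => normc (u x)).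
Proof.
move=> [mr mi]; rewrite (_ : (fun x => _) = fun x =>
  Num.sqrt (complex.Re (u x) ^+ 2 + complex.Im (u x) ^+ 2)).
  apply: measurableT_comp; first exact: (continuous_measurable_fun (@sqrt_continuous R)).
  by apply: measurable_funD; exact: measurable_funX.
by apply/funext => x; case: (u x).
Qed.

Definition cL2 u := cmeas u /\ Lint mu (fun x => normc (u x) ^+ 2).

Lemma cL2P u : cL2 u <->
  sqint mu (fun x => complex.Re (u x)) /\ sqint mu (fun x => complex.Im (u x)).
Proof.
split=> [[[mr mi] ui]|[[mr ri] [mi ii]]].
  split; split=> //; apply: Lint_le ui _; try exact: measurable_funX.
    by move=> x; rewrite ger0_norm ?sqr_ge0// sqr_normc lerDl sqr_ge0.
  by move=> x; rewrite ger0_norm ?sqr_ge0// sqr_normc lerDr sqr_ge0.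
by split=> //; under eq_fun do rewrite sqr_normc; exact: LintD.
Qed.

Lemma cL2D u v : cL2 u -> cL2 v -> cL2 (fun x => u x + v x).
Proof.
move=> /cL2P[? ?] /cL2P[? ?]; apply/cL2P; split.
  by under eq_fun do rewrite cReD; exact: sqintD.
by under eq_fun do rewrite cImD; exact: sqintD.
Qed.

Lemma cL2N u : cL2 u -> cL2 (fun x => - u x).
Proof.
move=> /cL2P[? ?]; apply/cL2P; split.
  by under eq_fun do rewrite cReN; exact: sqintN.
by under eq_fun do rewrite cImN; exact: sqintN.
Qed.

Lemma cL2B u v : cL2 u -> cL2 v -> cL2 (fun x => u x - v x).
Proof. by move=> ? ?; apply: cL2D => //; exact: cL2N. Qed.

Lemma cL2_bounded u (K : R) : cmeas u -> (forall x, normc (u x) <= K) -> cL2 u.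
Proof.
move=> [mr mi] uK; apply/cL2P; split; apply: (@sqint_bounded _ _ _ _ _ K) => // x.
  exact: le_trans (Re_le_normc _) (uK x).
exact: le_trans (Im_le_normc _) (uK x).
Qed.

Definition ess_bounded u (K : R) := cmeas u /\ {ae mu, forall x, normc (u x) <= K}.

Section Fields.
Variable m : nat.
Implicit Types F G H : 'I_m -> T -> C.

(** The number m of components is free: m = d serves gradients and m = 1 scalar functions, so one
    Cauchy-Schwarz inequality covers both. *)
Definition vL2 F := forall j, cL2 (F j).
Definition vsq F x : R := \sum_j normc (F j x) ^+ 2.
Definition vnorm F : R := Num.sqrt (\int[mu]_x vsq F x)%R.
(** The real part suffices: an energy estimate tests the equation against the very function being
    estimated, and coercivity bounds a real quantity. *)
Definition vprod (u : T -> C) F G x : R := complex.Re (u x * \sum_j F j x * (G j x)^*).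
Definition vdot u F G : R := (\int[mu]_x vprod u F G x)%R.

Lemma vsq_ge0 F x : 0 <= vsq F x.
Proof. by apply: sumr_ge0 => j _; exact: sqr_ge0. Qed.

Lemma Lint_vsq F : vL2 F -> Lint mu (vsq F).
Proof. by move=> LF; apply: Lint_sum => j; exact: (LF j).2. Qed.

Lemma vnorm_ge0 F : 0 <= vnorm F. Proof. exact: sqrtr_ge0. Qed.

Lemma sqr_vnorm F : vnorm F ^+ 2 = (\int[mu]_x vsq F x)%R.
Proof. by rewrite sqr_sqrtr//; apply: Rintegral_ge0 => x _; exact: vsq_ge0. Qed.

(** Weighted arithmetic-geometric mean, from t^-1 (t a - b)^2 >= 0. The weight t stays free so that
    it can be optimised after integration. *)
Lemma normr_vprod_le u F G (t : R) x : 0 < t ->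
  `|vprod u F G x| <= normc (u x) * ((t * vsq F x + t^-1 * vsq G x) / 2).
Proof.
move=> t0; apply: le_trans (Re_le_normc _) _; rewrite normcM ler_wpM2l ?normc_ge0//.
apply: le_trans (ler_normc_sum _ _) _.
rewrite /vsq !mulr_sumr -big_split/= mulr_suml; apply: ler_sum => j _.
rewrite normcM normc_conjc; move: (normc (F j x)) (normc (G j x)) => a b.
rewrite ler_pdivlMr// -subr_ge0.
have -> : t * a ^+ 2 + t^-1 * b ^+ 2 - a * b * 2 = t^-1 * (t * a - b) ^+ 2.
  by field; rewrite gt_eqF.
by rewrite mulr_ge0 ?invr_ge0 ?sqr_ge0 ?ltW.
Qed.

Lemma cmeas_sum I (r : seq I) (F : I -> T -> C) :
  (forall i, cmeas (F i)) -> cmeas (fun x => \sum_(i <- r) F i x).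
Proof.
move=> mF; elim: r => [|i r IH].
  by under eq_fun do rewrite big_nil; split; exact: measurable_cst.
by under eq_fun do rewrite big_cons; exact: cmeasD.
Qed.

Lemma Lint_vprod u K F G : ess_bounded u K -> vL2 F -> vL2 G -> Lint mu (vprod u F G).
Proof.
move=> [mu_ uK] LF LG.
apply: (@Lint_ae_le _ (fun x => K * ((1 * vsq F x + 1^-1 * vsq G x) / 2))).
- suff: cmeas (fun x => u x * \sum_j F j x * (G j x)^*) by case.
  apply: cmeasM => //; apply: cmeas_sum => j; apply: cmeasM; first exact: (LF j).1.
  by apply: cmeas_conj; exact: (LG j).1.
- apply: LintZ; under eq_fun do rewrite mulrC.
  by apply: LintZ; apply: LintD; apply: LintZ; exact: Lint_vsq.
- apply: filterS uK => x uK; apply: le_trans (normr_vprod_le _ _ _ _ ltr01) _.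
  rewrite ler_wpM2r// divr_ge0// addr_ge0// mulr_ge0 ?invr_ge0 ?vsq_ge0//.
Qed.

(** The optimal weight Y / X degenerates when a norm vanishes, so both norms are shifted by a small
    s and t = (Y + s) / (X + s) is used. The excess is at most s K (X + Y + 1) for s <= 1, and the
    choice of s makes this at most e. *)
Lemma le_mul_of_amgm (A K X Y : R) : 0 <= K -> 0 <= X -> 0 <= Y ->
  (forall t : R, 0 < t -> A <= K * ((t * X ^+ 2 + t^-1 * Y ^+ 2) / 2)) -> A <= K * (X * Y).
Proof.
move=> K0 X0 Y0 H; apply/ler_addgt0Pr => /= e e0.
have P0 : 0 <= K * (X + Y + 1) by rewrite mulr_ge0//; lra.
have [P PE] : exists P, P = K * (X + Y + 1) by exists (K * (X + Y + 1)).
rewrite -PE in P0.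
have D0 : 0 < P + 1 + e by lra.
have [s sE0] : exists s, s = e / (P + 1 + e) by exists (e / (P + 1 + e)).
have s0 : 0 < s by rewrite sE0 divr_gt0.
have s1 : s <= 1 by rewrite sE0 ler_pdivrMr// mul1r; lra.
have sE : s * P <= e by rewrite sE0 mulrAC ler_pdivrMr// ler_pM2l//; lra.
have Xs : 0 < X + s by lra.
have Ys : 0 < Y + s by lra.
apply: le_trans (H ((Y + s) / (X + s)) (divr_gt0 Ys Xs)) _.
apply: (@le_trans _ _ (K * ((X + s) * (Y + s)))).
  rewrite ler_wpM2l// ler_pdivrMr// invf_div.
  have -> : (X + s) * (Y + s) * 2 = (Y + s) / (X + s) * (X + s) ^+ 2 + (X + s) / (Y + s) * (Y + s) ^+ 2.
    by field; rewrite !gt_eqF.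
  apply: lerD; (apply: ler_wpM2l; [by rewrite ltW// divr_gt0|rewrite lerXn2r ?nnegrE//; lra]).
have : K * (s * s) <= K * s by rewrite ler_wpM2l// ler_piMr// ltW.
by move: sE; rewrite PE; lra.
Qed.

Lemma vdot_le u K F G : 0 <= K -> ess_bounded u K -> vL2 F -> vL2 G ->
  `|vdot u F G| <= K * (vnorm F * vnorm G).
Proof.
move=> K0 bu LF LG; apply: le_mul_of_amgm; rewrite ?vnorm_ge0// => t t0.
rewrite !sqr_vnorm; have I := Lint_vprod bu LF LG.
apply: le_trans (le_normr_Rintegral _ I) _ => //.
have iF := Lint_vsq LF; have iG := Lint_vsq LG.
have iFG : Lint mu (fun x => (t * vsq F x + t^-1 * vsq G x) / 2).
  by under eq_fun do rewrite mulrC; apply: LintZ; apply: LintD; exact: LintZ.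
rewrite -!RintegralZl// -RintegralD//; [|exact: LintZ|exact: LintZ].
rewrite -RintegralZr//; last by apply: LintD; exact: LintZ.
rewrite -RintegralZl//; apply: Rint_ae_le.
- apply: (Lint_le _ (integrable_norm I)) => [|x]; last by rewrite normr_id.
  by apply: measurableT_comp => //; exact: Lint_measurable I.
- exact: LintZ.
- apply: filterS bu.2 => x ux; apply: le_trans (normr_vprod_le _ _ _ _ t0) _.
  rewrite ler_wpM2r// divr_ge0// addr_ge0// mulr_ge0 ?vsq_ge0 ?invr_ge0 ?ltW//.
Qed.

Lemma vdotDl u K F F' G : ess_bounded u K -> vL2 F -> vL2 F' -> vL2 G ->
  vdot u (fun j x => F j x + F' j x) G = vdot u F G + vdot u F' G.
Proof.
move=> bu LF LF' LG; rewrite /vdot -RintegralD//; try exact: Lint_vprod bu _ _.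
apply: eq_Rintegral => x _; rewrite /vprod -cReD -mulrDr -big_split/=.
by congr (complex.Re (_ * _)); apply: eq_bigr => j _; rewrite mulrDl.
Qed.

Lemma vdotDr u K F G G' : ess_bounded u K -> vL2 F -> vL2 G -> vL2 G' ->
  vdot u F (fun j x => G j x + G' j x) = vdot u F G + vdot u F G'.
Proof.
move=> bu LF LG LG'; rewrite /vdot -RintegralD//; try exact: Lint_vprod bu _ _.
apply: eq_Rintegral => x _; rewrite /vprod -cReD -mulrDr -big_split/=.
by congr (complex.Re (_ * _)); apply: eq_bigr => j _; rewrite rmorphD mulrDr.
Qed.

Lemma vdotD u v K K' F G : ess_bounded u K -> ess_bounded v K' -> vL2 F -> vL2 G ->
  vdot (fun x => u x + v x) F G = vdot u F G + vdot v F G.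
Proof.
move=> bu bv LF LG; rewrite /vdot -RintegralD//; first last.
- exact: Lint_vprod bv _ _.
- exact: Lint_vprod bu _ _.
by apply: eq_Rintegral => x _; rewrite /vprod -cReD -mulrDl.
Qed.

Lemma vdot_ae u K F F' G G' : ess_bounded u K -> vL2 F -> vL2 F' -> vL2 G -> vL2 G' ->
  (forall j, {ae mu, forall x, F j x = F' j x}) ->
  (forall j, {ae mu, forall x, G j x = G' j x}) -> vdot u F G = vdot u F' G'.
Proof.
move=> bu LF LF' LG LG' /filter_forall aF /filter_forall aG.
apply: Rint_ae_eq; try exact: Lint_vprod bu _ _.
apply: filterS2 aF aG => x xF xG; rewrite /vprod; congr (complex.Re (_ * _)).
by apply: eq_bigr => j _; rewrite xF xG.
Qed.

Lemma vnorm_ae F F' : vL2 F -> vL2 F' ->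
  (forall j, {ae mu, forall x, F j x = F' j x}) -> vnorm F = vnorm F'.
Proof.
move=> LF LF' /filter_forall aF; congr Num.sqrt.
apply: Rint_ae_eq; try exact: Lint_vsq.
by apply: filterS aF => x xF; apply: eq_bigr => j _; rewrite xF.
Qed.

Lemma ess_bounded1 : ess_bounded (fun=> 1) 1.
Proof.
split; first by split; exact: measurable_cst.
by apply: aeW => x; rewrite normc1.
Qed.

Lemma vdot1 F : vdot (fun=> 1) F F = vnorm F ^+ 2.
Proof.
rewrite sqr_vnorm; apply: eq_Rintegral => x _; rewrite /vprod mul1r Re_sum.
by apply: eq_bigr => j _; rewrite mulc_conjc.
Qed.

Lemma vL2D F G : vL2 F -> vL2 G -> vL2 (fun j x => F j x + G j x).
Proof. by move=> LF LG j; exact: cL2D. Qed.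

Lemma vL2N F : vL2 F -> vL2 (fun j x => - F j x).
Proof. by move=> LF j; exact: cL2N. Qed.

Lemma vL2B F G : vL2 F -> vL2 G -> vL2 (fun j x => F j x - G j x).
Proof. by move=> LF LG; apply: vL2D => //; exact: vL2N. Qed.

Lemma vnormN F : vnorm (fun j x => - F j x) = vnorm F.
Proof.
by congr Num.sqrt; apply: eq_Rintegral => x _; apply: eq_bigr => j _; rewrite normcN.
Qed.

Lemma vnormD F G : vL2 F -> vL2 G ->
  vnorm (fun j x => F j x + G j x) <= vnorm F + vnorm G.
Proof.
move=> LF LG; have LD := vL2D LF LG; have b1 := ess_bounded1.
rewrite -(@ler_pXn2r _ 2) ?nnegrE ?addr_ge0 ?vnorm_ge0// -vdot1.
rewrite (vdotDl b1)// !(vdotDr b1)// !vdot1.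
have := vdot_le ler01 b1 LF LG; have := vdot_le ler01 b1 LG LF.
move=> /(le_trans (ler_norm _)) + /(le_trans (ler_norm _)).
lra.
Qed.

Lemma vnormB F G : vL2 F -> vL2 G ->
  vnorm (fun j x => F j x - G j x) <= vnorm F + vnorm G.
Proof.
move=> LF LG; rewrite -[in leRHS](vnormN G).
exact: (vnormD LF (vL2N LG)).
Qed.

Lemma vdot_real_ge (f : T -> R) (c K : R) F : measurable_fun setT f ->
  ess_bounded (fun x => (f x)%:C) K ->
  {ae mu, forall x, c <= f x} -> vL2 F ->
  c * vnorm F ^+ 2 <= vdot (fun x => (f x)%:C) F F.
Proof.
move=> mf bf cf LF; rewrite sqr_vnorm -RintegralZl//; last exact: Lint_vsq.
apply: Rint_ae_le.
- by apply: LintZ; exact: Lint_vsq.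
- exact: (Lint_vprod bf LF LF).
- apply: filterS cf => x cx; rewrite /vprod.
  rewrite (_ : \sum_j _ = (vsq F x)%:C); first by rewrite -rmorphM ler_wpM2r ?vsq_ge0.
  by rewrite rmorph_sum; apply: eq_bigr => j _; rewrite mulc_conjc.
Qed.

End Fields.

End ComplexL2.

(** * Parseval, gradients and the inverse Laplacian on coefficient lists *)

Section TrigL2.
Variables (R : realType) (d : nat).
Local Notation C := R[i].
Local Notation T := (pt R d).
Local Notation mu := (haar R d).
Local Open Scope complex_scope.
Implicit Types (k : freq d) (s : seq (freq d * C)) (x : T) (j : 'I_d) (v h : T -> C).

Lemma cmeas_tpoly s : cmeas (tpoly s : T -> C).
Proof. by split; [exact: measurable_Re_tpoly|exact: measurable_Im_tpoly]. Qed.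

Lemma cL2_tpoly s : cL2 mu (tpoly s).
Proof. by have [K sK] := tpoly_bounded s; exact: cL2_bounded (cmeas_tpoly s) sK. Qed.

Lemma Lint_Re_tpoly s : Lint mu (fun x => complex.Re (tpoly s x)).
Proof.
have [K sK] := tpoly_bounded s.
apply: (@Lint_bounded _ _ _ _ _ K); first exact: measurable_Re_tpoly.
by move=> x; apply: le_trans (Re_le_normc _) (sK x).
Qed.

Lemma Rint_Re_tpoly_deriv j s : (\int[mu]_x complex.Re (tpoly (tderiv j s) x) = 0)%R.
Proof.
have [dg cg pg] := periodic_partial_Re_tpoly j s.
have /(congr1 fine)/= E := @haar_integral_partial R d j (fun x => complex.Re (tpoly s x)) _
  (Lint_Re_tpoly _) dg cg pg.
by rewrite -[RHS]E.
Qed.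

(** A character of nonzero frequency is, up to the factor 2 pi i k_j, its own j-th derivative for
    some j with k_j != 0, and derivatives integrate to 0. *)
Lemma Rint_Re_echar c k : (\int[mu]_x complex.Re (c * echar k x) = if k == 0 then complex.Re c else 0)%R.
Proof.
case: eqP => [->|/eqP k0].
  under eq_Rintegral do rewrite echar0 mulr1.
  by rewrite Rintegral_cst// [X in fine X]probability_setT mulr1.
have [j kj] : exists j, k j != 0.
  apply/existsP; apply: contraNT k0 => /existsPn H.
  by apply/eqP/ffunP => j; rewrite ffunE; apply/eqP; have := H j; rewrite negbK.
have a0 : twoipi R (k j) != 0.
  apply: contraNneq kj => /(congr1 (@complex.Im R))/eqP/=.
  by rewrite !mulf_eq0 pnatr_eq0 (gt_eqF (pi_gt0 R)) intr_eq0.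
rewrite -(Rint_Re_tpoly_deriv j [:: (k, c / twoipi R (k j))]).
apply: eq_Rintegral => x _; rewrite /tpoly/= big_seq1/=.
by rewrite [twoipi _ _ * _]mulrC divfK.
Qed.

Lemma Rint_Re_tpoly s :
  (\int[mu]_x complex.Re (tpoly s x) = complex.Re (\sum_(p <- s | p.1 == 0) p.2))%R.
Proof.
under eq_Rintegral do rewrite /tpoly Re_sum.
rewrite Rint_sum.
  rewrite [in RHS]big_mkcond Re_sum; apply: eq_bigr => p _; rewrite Rint_Re_echar.
  by case: ifP.
by move=> p; have := Lint_Re_tpoly [:: p]; under eq_fun do rewrite /tpoly big_seq1.
Qed.

Lemma cintegral_tpoly s : cintegral (tpoly s : T -> C) = \sum_(p <- s | p.1 == 0) p.2.
Proof.
apply: complex_ext => /=; first exact: Rint_Re_tpoly.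
under eq_Rintegral do rewrite tpoly_Im.
rewrite Rint_Re_tpoly /tscale big_map/= -mulr_sumr cReM/=.
by rewrite mul0r sub0r mulN1r opprK.
Qed.

Lemma fourier_tpoly s k : fourier (tpoly s : T -> C) k = \sum_(p <- s | p.1 == k) p.2.
Proof.
rewrite /fourier (_ : (fun x => _) = tpoly (tmul s [:: (- k, 1)])).
  rewrite cintegral_tpoly big_mkcond /tmul big_allpairs_dep/=.
  rewrite [RHS]big_mkcond; apply: eq_bigr => p _.
  by rewrite big_seq1/= subr_eq0 mulr1.
by apply/funext => x; rewrite tpoly_mul /tpoly big_seq1/= mul1r echarN.
Qed.

Lemma big_uniq_key (s : seq (freq d * C)) (F : freq d * C -> C) p : uniq (tfreqs s) -> p \in s ->
  \sum_(q <- s | q.1 == p.1) F q = F p.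
Proof.
move=> us ps; have us' := map_uniq us.
rewrite big_mkcond (bigD1_seq p)//= eqxx big1_seq ?addr0// => q /andP[qp qs].
case: eqP => // E; case/eqP: qp.
elim: s us ps qs {us'} => [//|r s IH]/= /andP[rs us]; rewrite !inE.
move=> /orP[/eqP pr|ps] /orP[/eqP qr|qs].
- by rewrite pr qr.
- by case/negP: rs; rewrite -pr -E; apply/mapP; exists q.
- by case/negP: rs; rewrite -qr E; apply/mapP; exists p.
- exact: IH.
Qed.

(** In |p|^2 = p p^* the integral keeps the pairs of equal frequencies; uniqueness of the
    frequencies leaves only the diagonal. *)
Lemma parseval_tpoly s : uniq (tfreqs s) ->
  (\int[mu]_x normc (tpoly s x) ^+ 2 = \sum_(p <- s) normc p.2 ^+ 2)%R.
Proof.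
move=> us.
rewrite (@eq_Rintegral _ _ _ mu _ (fun x => complex.Re (tpoly (tmul s (tconj s)) x))); last first.
  by move=> x _; rewrite tpoly_mul tpoly_conj mulc_conjc.
rewrite Rint_Re_tpoly big_mkcond /tmul big_allpairs_dep/= Re_sum big_seq [RHS]big_seq.
apply: eq_bigr => p ps.
rewrite -big_mkcond /tconj big_map/= (eq_bigl (fun q : freq d * C => q.1 == p.1)); last first.
  by move=> q; rewrite subr_eq0 eq_sym.
by rewrite (big_uniq_key (fun q => p.2 * q.2^*) us ps) mulc_conjc.
Qed.

(** Merges repeated frequencies, so that Parseval applies to the same function. *)
Definition tnormalize s : seq (freq d * C) :=
  [seq (k, \sum_(p <- s | p.1 == k) p.2) | k <- undup (tfreqs s)].

Lemma tfreqs_normalize s : tfreqs (tnormalize s) = undup (tfreqs s).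
Proof. by rewrite /tfreqs /tnormalize -map_comp map_id_in. Qed.

Lemma tpoly_normalize s x : tpoly (tnormalize s) x = tpoly s x.
Proof.
rewrite /tpoly /tnormalize big_map/=.
under eq_bigr do rewrite mulr_suml.
rewrite (exchange_big_dep xpredT)//= big_seq [RHS]big_seq; apply: eq_bigr => p ps.
have pu : p.1 \in undup (tfreqs s) by rewrite mem_undup; apply/mapP; exists p.
rewrite -big_filter (@eq_filter _ _ (pred1 p.1)); last by move=> i; rewrite eq_sym.
by rewrite filter_pred1_uniq ?undup_uniq// big_seq1.
Qed.

Definition tgrad s : 'I_d -> T -> C := fun j => tpoly (tderiv j s).

Lemma vL2_tgrad s : vL2 mu (tgrad s).
Proof. by move=> j; exact: cL2_tpoly. Qed.

(** The eigenvalue of minus the Laplacian on the character of frequency k. *)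
Definition freq_sq k : R := \sum_j (2 * pi * (k j)%:~R) ^+ 2.

Lemma freq_sq_ge0 k : 0 <= freq_sq k.
Proof. by apply: sumr_ge0 => j _; exact: sqr_ge0. Qed.

Lemma freq_sq_ge k : k != 0 -> (2 * pi) ^+ 2 <= freq_sq k.
Proof.
move=> k0; have [j kj] : exists j, k j != 0.
  apply/existsP; apply: contraNT k0 => /existsPn H.
  by apply/eqP/ffunP => j; rewrite ffunE; apply/eqP; have := H j; rewrite negbK.
rewrite /freq_sq (bigD1 j)//= ler_wpDr//; first by apply: sumr_ge0 => i _; exact: sqr_ge0.
rewrite [leRHS]exprMn ler_peMr ?sqr_ge0//.
rewrite -[_ ^+ 2]ger0_norm ?sqr_ge0// normrX -intr_norm exprn_ege1//.
by rewrite ler1z; move: kj; rewrite -normr_gt0.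
Qed.

Lemma freq_sq0 : freq_sq 0 = 0.
Proof. by rewrite /freq_sq big1// => j _; rewrite ffunE mulr0 expr0n. Qed.

Lemma normc_twoipi n : normc (twoipi R n) ^+ 2 = (2 * pi * n%:~R) ^+ 2.
Proof. by rewrite sqr_normc/= expr0n add0r. Qed.

Lemma vnorm_tgrad s : uniq (tfreqs s) ->
  vnorm mu (tgrad s) ^+ 2 = \sum_(p <- s) freq_sq p.1 * normc p.2 ^+ 2.
Proof.
move=> us; rewrite sqr_vnorm /vsq Rint_sum; last by move=> j; exact: (cL2_tpoly _).2.
under eq_bigr => j _ do rewrite parseval_tpoly ?/tfreqs -?map_comp//.
under eq_bigr => j _ do rewrite /tderiv big_map.
rewrite exchange_big/=; apply: eq_bigr => p _; rewrite /freq_sq mulr_suml.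
by apply: eq_bigr => j _; rewrite normcM exprMn normc_twoipi.
Qed.

(* Inverts the Laplacian; the zero frequency is dropped because [x / 0 = 0]. *)
Definition tsolve s : seq (freq d * C) := [seq (p.1, p.2 * (- (freq_sq p.1)^-1)%:C) | p : freq d * C <- s].

Definition tdiv (P : 'I_d -> seq (freq d * C)) : seq (freq d * C) :=
  flatten [seq tderiv j (P j) | j <- index_enum 'I_d].

Lemma tpoly_div P x : tpoly (tdiv P) x = \sum_j tpoly (tderiv j (P j)) x.
Proof. by rewrite /tdiv /tpoly big_flatten big_map. Qed.

(** Differentiating twice in direction j multiplies the coefficient at k by -(2 pi k_j)^2; the sum
    over j is the eigenvalue that [tsolve] divides by. At frequency 0 the hypothesis makes both
    sides vanish. *)
Lemma tdiv_tsolve s x : (forall p, p \in s -> p.1 = 0 -> p.2 = 0) ->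
  tpoly (tdiv (fun j => tderiv j (tsolve s))) x = tpoly s x.
Proof.
move=> s0; rewrite tpoly_div /tpoly.
under eq_bigr => j _ do rewrite /tderiv /tsolve !big_map.
rewrite exchange_big/= big_seq [RHS]big_seq; apply: eq_bigr => p ps /=.
have [p10|p10] := eqVneq p.1 0.
  by rewrite (s0 _ ps p10) [RHS]mul0r big1// => j _; rewrite !(mul0r, mulr0).
rewrite -mulr_suml; congr (_ * _).
have f0 : freq_sq p.1 != 0.
  by rewrite gt_eqF// (lt_le_trans _ (freq_sq_ge p10))// exprn_gt0 ?mulr_gt0 ?pi_gt0.
rewrite (eq_bigr (fun j => (- (2 * pi * (p.1 j)%:~R) ^+ 2)%:C * (p.2 * (- (freq_sq p.1)^-1)%:C))).
  rewrite -mulr_suml -rmorph_sum/= sumrN -/(freq_sq _) mulrCA -rmorphM/= mulrNN mulfV//.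
  exact: mulr1.
move=> j _; rewrite mulrA; congr (_ * _).
by apply: complex_ext; rewrite ?cReM ?cImM/=; ring.
Qed.

(** By Parseval the squared coefficient |c_k|^2 becomes |c_k|^2 / [freq_sq k], and (2 pi)^2 is the
    smallest nonzero eigenvalue. *)
Lemma vnorm_tgrad_tsolve s : uniq (tfreqs s) ->
  2 * pi * vnorm mu (tgrad (tsolve s)) <= vnorm mu (fun _ : 'I_1 => tpoly s).
Proof.
move=> us; have p0 := pi_gt0 R.
rewrite -(@ler_pXn2r _ 2) ?nnegrE ?mulr_ge0 ?vnorm_ge0 ?(ltW p0)// [leLHS]exprMn.
rewrite vnorm_tgrad; last by rewrite /tfreqs /tsolve -map_comp.
rewrite sqr_vnorm /vsq; under [leRHS]eq_Rintegral do rewrite big_ord1.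
rewrite parseval_tpoly// mulr_sumr /tsolve big_map; apply: ler_sum => p _ /=.
rewrite normcM normc_real normrN ger0_norm ?invr_ge0 ?freq_sq_ge0//.
have [->|p10] := eqVneq p.1 0; first by rewrite freq_sq0 mul0r mulr0 sqr_ge0.
have g := freq_sq_ge p10; have q0 : 0 < (2 * pi) ^+ 2 :> R by rewrite exprn_gt0 ?mulr_gt0.
have f0 := lt_le_trans q0 g.
rewrite (_ : _ * (_ * _) = (2 * pi) ^+ 2 / freq_sq p.1 * normc p.2 ^+ 2).
  by rewrite ler_piMl ?sqr_ge0// ler_pdivrMr// mul1r.
by field; rewrite gt_eqF.
Qed.

End TrigL2.

(** * The L2 norm as the square root of an integral *)

Section Lnorm2.
Context dsp (T : measurableType dsp) (R : realType) (mu : {finite_measure set T -> \bar R}).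
Implicit Types f : T -> R.

Let sqr_poweR f x : (`|(f x)%:E| `^ 2 = (f x ^+ 2)%:E)%E.
Proof.
by rewrite /= -[2]/(2%:R) powR_mulrn// real_normK ?num_real.
Qed.

Lemma Lnorm2E f : Lint mu (fun x => f x ^+ 2) ->
  Lnorm mu 2%:E (fun x => (f x)%:E) = (Num.sqrt (\int[mu]_x f x ^+ 2)%R)%:E.
Proof.
move=> fi; rewrite unlock /Lnorm; under eq_integral do rewrite sqr_poweR.
rewrite -(fineK (integrable_fin_num measurableT fi)) poweR_EFin.
by rewrite powR12_sqrt// fine_ge0// integral_ge0// => x _; rewrite lee_fin sqr_ge0.
Qed.

Lemma Lint_Lnorm2 f : measurable_fun setT f ->
  (Lnorm mu 2%:E (fun x => (f x)%:E) < +oo)%E -> Lint mu (fun x => f x ^+ 2).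
Proof.
move=> mf; rewrite unlock /Lnorm; under eq_integral do rewrite sqr_poweR.
move=> foo; apply/integrableP; split; first exact/measurable_EFinP/measurable_funX.
under eq_integral do rewrite /= ger0_norm ?sqr_ge0//.
rewrite ltNge leye_eq; apply/eqP => E; move: foo.
by rewrite E poweRyr ?ltxx// invr_neq0.
Qed.

Lemma in_L2_finite (u : T -> R[i]) : cL2 mu u <->
  [/\ measurable_fun setT (fun x => complex.Re (u x)),
      measurable_fun setT (fun x => complex.Im (u x)) &
      (Lnorm mu 2%:E (fun x => (normc (u x))%:E) < +oo)%E].
Proof.
split=> [[[mr mi] ui]|[mr mi uoo]]; first by split=> //; rewrite Lnorm2E// ltry.
by split=> //; apply: Lint_Lnorm2 => //; exact: cmeas_normc.
Qed.

End Lnorm2.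

(** * Weak derivatives and the dual Poincare inequality *)

Section WeakDerivative.
Variables (R : realType) (d : nat).
Local Notation C := R[i].
Local Notation T := (pt R d).
Local Notation mu := (haar R d).
Local Open Scope complex_scope.
Implicit Types (k : freq d) (s : seq (freq d * C)) (x : T) (j : 'I_d) (u v h : T -> C).

Lemma in_L2P u : in_L2 u <-> cL2 mu u.
Proof. by split=> /in_L2_finite. Qed.

Lemma weak_partial_tpoly_pairing j v h s : weak_partial j v h -> cL2 mu v -> cL2 mu h ->
  (\int[mu]_x complex.Re (tpoly s x * (h x)^*) =
   - \int[mu]_x complex.Re (tpoly (tderiv j s) x * (v x)^*))%R.
Proof.
move=> /weak_partialP wp /cL2P[vr vi] /cL2P[hr hi].
have tL2 s' : sqint mu (fun x => complex.Re (tpoly s' x)) by have /cL2P[] := cL2_tpoly s'.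
have E (w : T -> C) s' x : complex.Re (tpoly s' x * (w x)^*) =
    complex.Re (w x) * complex.Re (tpoly s' x) +
    complex.Im (w x) * complex.Re (tpoly (tscale (0 -i* 1) s') x).
  by rewrite cReM Re_conjc Im_conjc -tpoly_Im; ring.
have sc : tscale (0 -i* 1) (tderiv j s) = tderiv j (tscale (0 -i* 1) s).
  by rewrite /tscale /tderiv -!map_comp; apply: eq_map => p /=; rewrite mulrCA.
have D s' x : 'D_(delta_mx 0 j) (fun r => complex.Re (tpoly s' (row_pt r))) (pt_row x) =
    complex.Re (tpoly (tderiv j s') x).
  by have [_ ->] := is_derive_Re_tpoly_row s' (pt_row x) j; rewrite row_ptK.
have W s' : (\int[mu]_x (complex.Re (v x) * complex.Re (tpoly (tderiv j s') x)) =
      - \int[mu]_x (complex.Re (h x) * complex.Re (tpoly s' x)))%R /\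
    (\int[mu]_x (complex.Im (v x) * complex.Re (tpoly (tderiv j s') x)) =
      - \int[mu]_x (complex.Im (h x) * complex.Re (tpoly s' x)))%R.
  have [w1 w2] := wp _ (test_function_Re_tpoly s'); split.
    under eq_Rintegral do rewrite -D; rewrite w1; congr (- _).
    by apply: eq_Rintegral => x _; rewrite row_ptK.
  under eq_Rintegral do rewrite -D; rewrite w2; congr (- _).
  by apply: eq_Rintegral => x _; rewrite row_ptK.
under eq_Rintegral do rewrite E.
under [in RHS]eq_Rintegral do rewrite E sc.
rewrite !RintegralD//; try exact: LintM.
by rewrite (W s).1 (W _).2 opprD !opprK.
Qed.

(** If f is orthogonal to g, the integral of f^2 is at most that of (f - g)^2, which density makes
    arbitrarily small. *)
Lemma sqint_orthogonal_trig_eq0 (f : T -> R) : sqint mu f ->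
  (forall s, \int[mu]_x (f x * complex.Re (tpoly s x)) = 0)%R -> {ae mu, forall x, f x = 0}.
Proof.
move=> sf f0.
have I0 : (\int[mu]_x f x ^+ 2 = 0)%R.
  apply/eqP; rewrite eq_le; apply/andP; split; last by apply: Rintegral_ge0 => x _; exact: sqr_ge0.
  apply/ler_addgt0Pr => e e0; rewrite add0r.
  have [g rg fg] := trig_dense sf e0; apply: le_trans fg.
  have [s gs] := rg.
  have sg : sqint mu g.
    by have [K gK] := rtrig_bounded rg; exact: sqint_bounded (rtrig_measurable rg) gK.
  rewrite [leRHS](@eq_Rintegral _ _ _ mu _ (fun x => (f x ^+ 2 + g x ^+ 2) + (-2) * (f x * g x))); last first.
    by move=> x _; ring.
  rewrite RintegralD//; [|by apply: LintD; [exact: sf.2|exact: sg.2]|by apply: LintZ; exact: LintM].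
  rewrite RintegralD//; [|exact: sf.2|exact: sg.2].
  rewrite RintegralZl//; last exact: LintM.
  have -> : (\int[mu]_x (f x * g x) = 0)%R.
    by rewrite -(f0 s); apply: eq_Rintegral => x _; rewrite -gs.
  by rewrite mulr0 addr0 lerDl; apply: Rintegral_ge0 => x _; exact: sqr_ge0.
have mf2 : measurable_fun setT (fun x => (f x ^+ 2)%:E) by apply/measurable_EFinP/measurable_funX; exact: sf.1.
have : (\int[mu]_x `|(f x ^+ 2)%:E| = 0)%E.
  under eq_integral do rewrite /= ger0_norm ?sqr_ge0//.
  by rewrite -(fineK (integrable_fin_num measurableT sf.2)) -/(Rintegral _ _ _) I0.
move=> /(ae_eq_integral_abs mu measurableT mf2); apply: filterS => x /(_ I) [/eqP].
by rewrite sqrf_eq0 => /eqP.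
Qed.

Lemma weak_partial_unique j u h h' : cL2 mu h -> cL2 mu h' ->
  weak_partial j u h -> weak_partial j u h' -> {ae mu, forall x, h x = h' x}.
Proof.
move=> Lh Lh' /weak_partialP wh /weak_partialP wh'.
have [hr hi] := (cL2P mu h).1 Lh; have [hr' hi'] := (cL2P mu h').1 Lh'.
have main (f f' : T -> R) : sqint mu f -> sqint mu f' ->
    (forall phi, test_function phi -> - (\int[mu]_x (f x * phi (pt_row x)))%R =
       - (\int[mu]_x (f' x * phi (pt_row x)))%R) ->
    {ae mu, forall x, f x = f' x}.
  move=> sf sf' ff'.
  have := @sqint_orthogonal_trig_eq0 (fun x => f x - f' x) (sqintB sf sf').
  move=> H; apply: filterS (H _) => [x /eqP|s]; first by rewrite subr_eq0 => /eqP.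
  have /cL2P[st _] := cL2_tpoly s.
  under eq_Rintegral do rewrite mulrBl.
  rewrite RintegralB//; try exact: LintM.
  apply/eqP; rewrite subr_eq0; apply/eqP.
  have /oppr_inj := ff' _ (test_function_Re_tpoly s).
  by congr (_ = _); apply: eq_Rintegral => x _; rewrite row_ptK.
have aeR := main _ _ hr hr' (fun phi tp => etrans (esym (wh phi tp).1) (wh' phi tp).1).
have aeI := main _ _ hi hi' (fun phi tp => etrans (esym (wh phi tp).2) (wh' phi tp).2).
by apply: filterS2 aeR aeI => x; exact: complex_ext.
Qed.

(** Carries a weak gradient explicitly instead of the chosen [wpartial], so that trigonometric
    polynomials keep their computed one. *)
Definition vgrad v (D : 'I_d -> T -> C) := [/\ cL2 mu v, vL2 mu D & forall j, weak_partial j v (D j)].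

Local Notation one := (fun=> 1 : C).
Local Notation sc v := (fun _ : 'I_1 => v).

Lemma vgrad_tpoly s : vgrad (tpoly s) (tgrad s).
Proof.
by split=> [|j|j]; [exact: cL2_tpoly|exact: cL2_tpoly|exact: weak_partial_tpoly].
Qed.

Lemma weak_partialB j u v h h' : cL2 mu u -> cL2 mu v -> cL2 mu h -> cL2 mu h' ->
  weak_partial j u h -> weak_partial j v h' ->
  weak_partial j (fun x => u x - v x) (fun x => h x - h' x).
Proof.
move=> /cL2P[ur ui] /cL2P[vr vi] /cL2P[hr hi] /cL2P[hr' hi'] /weak_partialP wu /weak_partialP wv.
apply/weak_partialP => phi tp; have [[cD _] [cphi _]] := (tp.1 [:: j], tp.1 [::]).
have sqp (psi : 'rV[R]_d -> R) : continuous psi -> sqint mu (fun x => psi (pt_row x)).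
  move=> cpsi; split; first exact: measurable_continuous_pt_row.
  have c2 : continuous (fun r : 'rV[R]_d => psi r * psi r : R).
    by move=> r; exact: continuousM (cpsi r) (cpsi r).
  by under eq_fun do rewrite expr2; exact: (Lint_pt_row c2).
have sD : sqint mu (fun x => 'D_(delta_mx 0 j) phi (pt_row x)) := sqp _ cD.
have sp : sqint mu (fun x => phi (pt_row x)) := sqp _ cphi.
have B (f f' g : T -> R) : sqint mu f -> sqint mu f' -> sqint mu g ->
  (\int[mu]_x ((f x - f' x) * g x) = \int[mu]_x (f x * g x) - \int[mu]_x (f' x * g x))%R.
  move=> sf sf' sg; under eq_Rintegral do rewrite mulrBl.
  by rewrite RintegralB//; exact: LintM.
have [[u1 u2] [v1 v2]] := (wu phi tp, wv phi tp).
split.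
  under eq_Rintegral do rewrite cReD cReN.
  under [in RHS]eq_Rintegral do rewrite cReD cReN.
  by rewrite !B// u1 v1 opprB opprK addrC.
under eq_Rintegral do rewrite cImD cImN.
under [in RHS]eq_Rintegral do rewrite cImD cImN.
by rewrite !B// u2 v2 opprB opprK addrC.
Qed.

Lemma vgradB u v D D' : vgrad u D -> vgrad v D' ->
  vgrad (fun x => u x - v x) (fun j x => D j x - D' j x).
Proof.
move=> [Lu LD wu] [Lv LD' wv]; split; [exact: cL2B|exact: vL2B|move=> j].
exact: weak_partialB.
Qed.

Lemma vgrad_in_H1 v D : vgrad v D -> in_H1 v.
Proof.
move=> [Lv LD wv]; split; first exact/in_L2P.
by move=> j; exists (D j); split=> //; exact/in_L2P.
Qed.

Lemma in_H1_vgrad v : in_H1 v -> vgrad v (fun j => wpartial j v).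
Proof.
move=> [/in_L2P Lv H].
have W j : in_L2 (wpartial j v) /\ weak_partial j v (wpartial j v) by exact: (xgetPex _ (H j)).
by split=> [//|j|j]; [apply/in_L2P; exact: (W j).1|exact: (W j).2].
Qed.

Lemma vgrad_unique v D D' : vgrad v D -> vgrad v D' ->
  forall j, {ae mu, forall x, D j x = D' j x}.
Proof.
by move=> [_ LD wD] [_ LD' wD'] j; exact: weak_partial_unique (LD j) (LD' j) (wD j) (wD' j).
Qed.

(** Green's formula on the torus. The classical derivatives fall on the polynomial field; [D] enters
    only as a weak gradient. *)
Lemma vdot_tpoly_div v D (P : 'I_d -> seq (freq d * C)) : vgrad v D ->
  vdot mu one (fun j => tpoly (P j)) D = - vdot mu one (sc (tpoly (tdiv P))) (sc v).
Proof.
move=> [Lv LD wD]; rewrite /vdot /vprod.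
have I j (w : T -> C) s : cL2 mu w -> Lint mu (fun x => complex.Re (tpoly s x * (w x)^*)).
  move=> Lw; have := @Lint_vprod _ _ _ mu 1 one 1 (sc (tpoly s)) (sc w) (ess_bounded1 _).
  rewrite /vprod; under [X in _ -> _ -> Lint _ X]eq_fun do rewrite mul1r big_ord1.
  by apply=> // i; exact: cL2_tpoly.
under eq_Rintegral do rewrite mul1r Re_sum.
rewrite Rint_sum; last by move=> j; exact: I.
under [in RHS]eq_Rintegral do rewrite mul1r big_ord1 tpoly_div mulr_suml Re_sum.
rewrite Rint_sum; last by move=> j; exact: I.
rewrite -sumrN; apply: eq_bigr => j _.
exact: weak_partial_tpoly_pairing.
Qed.

End WeakDerivative.

Section Poincare.
Variables (R : realType) (d : nat).
Local Notation C := R[i].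
Local Notation T := (pt R d).
Local Notation mu := (haar R d).
Local Open Scope complex_scope.
Implicit Types (k : freq d) (s : seq (freq d * C)) (x : T) (j : 'I_d) (u v h : T -> C).
Local Notation one := (fun=> 1 : C).
Local Notation sc v := (fun _ : 'I_1 => v).

Lemma vL2_sc v : cL2 mu v -> vL2 mu (sc v).
Proof. by move=> Lv j. Qed.

Lemma sqr_vnorm_sc v : vnorm mu (sc v) ^+ 2 = (\int[mu]_x normc (v x) ^+ 2)%R.
Proof. by rewrite sqr_vnorm /vsq; under eq_Rintegral do rewrite big_ord1. Qed.

Lemma complex_trig_dense h (e : R) : cL2 mu h -> 0 < e ->
  exists s, vnorm mu (sc (fun x => h x - tpoly s x)) <= e.
Proof.
(* Real and imaginary parts each receive half of the squared error. *)
move=> /cL2P[hr hi] e0; have e2 : 0 < e ^+ 2 / 2 by rewrite divr_gt0// exprn_gt0.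
have [g [sg gE] gr] := trig_dense hr e2; have [g' [sg' gE'] gi] := trig_dense hi e2.
exists (sg ++ tscale (0 +i* 1) sg').
rewrite -(@ler_pXn2r _ 2) ?nnegrE ?vnorm_ge0 ?(ltW e0)// sqr_vnorm_sc.
have rg : sqint mu g.
  have r : rtrig g by exists sg.
  by have [K gK] := rtrig_bounded r; exact: sqint_bounded (rtrig_measurable r) gK.
have rg' : sqint mu g'.
  have r : rtrig g' by exists sg'.
  by have [K gK] := rtrig_bounded r; exact: sqint_bounded (rtrig_measurable r) gK.
rewrite (@eq_Rintegral _ _ _ mu _ (fun x => (complex.Re (h x) - g x) ^+ 2 + (complex.Im (h x) - g' x) ^+ 2)).
  by rewrite RintegralD//; [lra|exact: (sqintB hr rg).2|exact: (sqintB hi rg').2].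
move=> x _; rewrite sqr_normc tpoly_cat tpoly_scale -gE -gE' cReD cImD cReN cImN cReD cImD cReM cImM/=.
by congr (_ ^+ 2 + _ ^+ 2); ring.
Qed.

Lemma vdot_cst_mean0 c v : cL2 mu v -> cintegral v = 0 -> vdot mu one (sc (fun=> c)) (sc v) = 0.
Proof.
move=> Lv [vr vi]; have [sr si] := (cL2P mu v).1 Lv.
rewrite /vdot (@eq_Rintegral _ _ _ mu _ (fun x => complex.Re c * complex.Re (v x) + complex.Im c * complex.Im (v x))).
  rewrite RintegralD//; [|by apply: LintZ; exact: sqint_Lint|by apply: LintZ; exact: sqint_Lint].
  by rewrite !RintegralZl//; [rewrite vr vi !mulr0 addr0|exact: sqint_Lint|exact: sqint_Lint].
by move=> x _; rewrite /vprod mul1r big_ord1 cReM Re_conjc Im_conjc; ring.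
Qed.

Lemma vdot_one_le m (F G : 'I_m -> T -> C) : vL2 mu F -> vL2 mu G ->
  `|vdot mu one F G| <= vnorm mu F * vnorm mu G.
Proof. by move=> LF LG; have := vdot_le ler01 (ess_bounded1 mu) LF LG; rewrite mul1r. Qed.

Lemma vdot_tgrad_tsolve v D s : vgrad v D -> (forall p, p \in s -> p.1 = 0 -> p.2 = 0) ->
  vdot mu one (tgrad (tsolve s)) D = - vdot mu one (sc (tpoly s)) (sc v).
Proof.
move=> vD s0; rewrite (vdot_tpoly_div (fun j => tderiv j (tsolve s)) vD).
by congr (- vdot _ _ _ _); apply/funext => _; apply/funext => x; exact: tdiv_tsolve.
Qed.

(** The frequency 0 of the polynomial pairs to 0 with a mean-zero v. The rest is the divergence of a
    gradient, so Green's formula moves the derivative onto v. *)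
Lemma vdot_tpoly_mean0_le v D s : vgrad v D -> cintegral v = 0 ->
  `|vdot mu one (sc (tpoly s)) (sc v)| <= vnorm mu (sc (tpoly s)) * vnorm mu D.
Proof.
move=> vD v0; have [Lv LD _] := vD.
have [s' us' E] : exists2 s', uniq (tfreqs s') & tpoly s = tpoly s'.
  exists (tnormalize s); first by rewrite tfreqs_normalize undup_uniq.
  by apply/funext => x; rewrite tpoly_normalize.
rewrite {s}E; pose s0 := [seq p : freq d * C <- s' | p.1 != 0]; pose s1 := [seq p : freq d * C <- s' | p.1 == 0].
have sE : sc (tpoly s') = fun i x => sc (fun=> \sum_(p <- s1) p.2) i x + sc (tpoly s0) i x.
  apply/funext => _; apply/funext => x /=.
  rewrite /tpoly /s0 /s1 !big_filter (bigID (fun p => p.1 == 0))/=; congr (_ + _).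
  by apply: eq_bigr => p /eqP ->; rewrite echar0 mulr1.
have us0 : uniq (tfreqs s0).
  by rewrite /tfreqs /s0 -(filter_map (fun p => p.1) (fun k => k != 0)) filter_uniq.
have n0 : vnorm mu (sc (tpoly s0)) <= vnorm mu (sc (tpoly s')).
  rewrite -(@ler_pXn2r _ 2) ?nnegrE ?vnorm_ge0// !sqr_vnorm_sc !parseval_tpoly//.
  rewrite /s0 big_filter big_mkcond; apply: ler_sum => p _.
  by case: ifP => // _; exact: sqr_ge0.
have b1 := ess_bounded1 mu.
rewrite [X in `|vdot _ _ X _|]sE (vdotDl b1); first last.
- exact: vL2_sc.
- by apply: vL2_sc; exact: cL2_tpoly.
- apply: vL2_sc; apply: (@cL2_bounded _ _ _ _ _ (normc (\sum_(p <- s1) p.2))) => //.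
rewrite vdot_cst_mean0// add0r -normrN -(vdot_tgrad_tsolve vD); last first.
  by move=> p; rewrite mem_filter => /andP[/eqP].
apply: le_trans (vdot_one_le (vL2_tgrad _) LD) _.
rewrite ler_wpM2r ?vnorm_ge0//; apply: le_trans n0.
(* The factor 2 pi is given away here: only 1 <= 2 pi is kept. *)
apply: le_trans (vnorm_tgrad_tsolve us0); rewrite ler_peMl ?vnorm_ge0//.
by have := pi_ge2 R; lra.
Qed.

Lemma poincare_dual v D h : vgrad v D -> cintegral v = 0 -> cL2 mu h ->
  `|vdot mu one (sc h) (sc v)| <= vnorm mu (sc h) * vnorm mu D.
Proof.
move=> vD v0 Lh; have [Lv LD _] := vD; have b1 := ess_bounded1 mu.
apply/ler_addgt0Pr => e e0.
have D0 := vnorm_ge0 mu D; have w0 := vnorm_ge0 mu (sc v).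
(* The approximation error is paid twice: times ||D|| when the norm of the polynomial is replaced by
   that of h, and times ||v|| when the difference is paired with v. *)
have c0 : 0 < vnorm mu D + vnorm mu (sc v) + 1 by lra.
have [s hs] := complex_trig_dense Lh (divr_gt0 e0 c0).
have Ls := cL2_tpoly s; have LB := cL2B Lh Ls.
have hE : sc h = fun i x => sc (tpoly s) i x + sc (fun x => h x - tpoly s x) i x.
  by apply/funext => _; apply/funext => x /=; rewrite addrC subrK.
rewrite [X in `|vdot _ _ X _|]hE (vdotDl b1); [|exact: vL2_sc|exact: vL2_sc|exact: vL2_sc].
have H1 := vdot_tpoly_mean0_le s vD v0.
have H2 := vdot_one_le (vL2_sc LB) (vL2_sc Lv).
have H3 : vnorm mu (sc (tpoly s)) <= vnorm mu (sc h) + vnorm mu (sc (fun x => h x - tpoly s x)).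
  rewrite (_ : sc (tpoly s) = fun i x => sc h i x - sc (fun x => h x - tpoly s x) i x).
    exact: vnormB (vL2_sc Lh) (vL2_sc LB).
  by apply/funext => _; apply/funext => x /=; rewrite opprB addrC subrK.
apply: le_trans (ler_normD _ _) _.
move: hs; rewrite ler_pdivlMr// => hs.
have n0 := vnorm_ge0 mu (sc (fun x => h x - tpoly s x)).
have := ler_wpM2r D0 H3; nra.
Qed.

End Poincare.

(** * The Neumann series *)

Section Neumann.
Variables (R : realType) (d : nat).
Local Notation C := R[i].
Local Notation T := (pt R d).
Local Notation mu := (haar R d).
Local Open Scope complex_scope.
Implicit Types (k : freq d) (s : seq (freq d * C)) (x : T) (j : 'I_d) (v h : T -> C).
Local Notation one := (fun=> 1 : C).
Local Notation sc v := (fun _ : 'I_1 => v).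

Lemma vdotZl m u K (F G : 'I_m -> T -> C) (c : R) : ess_bounded mu u K -> vL2 mu F -> vL2 mu G ->
  vdot mu u (fun i x => c%:C * F i x) G = c * vdot mu u F G.
Proof.
move=> bu LF LG; rewrite /vdot -RintegralZl//; last exact: Lint_vprod bu LF LG.
apply: eq_Rintegral => x _; rewrite /vprod.
rewrite (_ : \sum_j _ = c%:C * \sum_j F j x * (G j x)^*); last first.
  by rewrite mulr_sumr; apply: eq_bigr => j _; rewrite mulrA.
by rewrite mulrCA cReM/=; ring.
Qed.

Lemma tgrad_cat s t j x : tgrad (s ++ t) j x = tgrad s j x + tgrad t j x.
Proof. by rewrite /tgrad /tderiv map_cat tpoly_cat. Qed.

Variables (a0 : R) (sb sf : seq (freq d * C)) (K : R).
Hypothesis a0_gt0 : 0 < a0.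
Hypothesis sbK : ess_bounded mu (tpoly sb) K.
Hypothesis K_ge0 : 0 <= K.
Hypothesis sf_uniq : uniq (tfreqs sf).
Hypothesis sf_mean0 : forall p, p \in sf -> p.1 = 0 -> p.2 = 0.

(* The terms of the Neumann series of [- div ((a0 + b) grad u) = f], where
   [b = tpoly sb] and [f = tpoly sf]. *)
Fixpoint neumann_term n : seq (freq d * C) :=
  tsolve (tscale (- a0^-1)%:C
    (if n is n'.+1 then tdiv (fun j => tmul sb (tderiv j (neumann_term n'))) else sf)).

Fixpoint neumann_sum n : seq (freq d * C) :=
  if n is n'.+1 then neumann_sum n' ++ neumann_term n else neumann_term 0.

Let vdot_tgrad_scaled v D s : vgrad v D -> (forall p, p \in s -> p.1 = 0 -> p.2 = 0) ->
  a0 * vdot mu one (tgrad (tsolve (tscale (- a0^-1)%:C s))) D = vdot mu one (sc (tpoly s)) (sc v).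
Proof.
move=> vD s0; have [Lv LD _] := vD; rewrite (vdot_tgrad_tsolve vD); last first.
  by move=> _ /mapP[p ps ->] /= /(s0 _ ps) ->; rewrite mulr0.
rewrite (_ : sc (tpoly (tscale _ _)) = fun i x => (- a0^-1)%:C * sc (tpoly s) i x); last first.
  by apply/funext => _; apply/funext => x; rewrite tpoly_scale.
rewrite (vdotZl _ (ess_bounded1 mu)); [|by apply: vL2_sc; exact: cL2_tpoly|exact: vL2_sc].
by rewrite mulNr opprK mulVKf// gt_eqF.
Qed.

Lemma vdot_neumann_term0 v D : vgrad v D ->
  a0 * vdot mu one (tgrad (neumann_term 0)) D = vdot mu one (sc (tpoly sf)) (sc v).
Proof. by move=> vD; exact: vdot_tgrad_scaled. Qed.

Lemma vdot_neumann_termS v D n : vgrad v D ->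
  a0 * vdot mu one (tgrad (neumann_term n.+1)) D = - vdot mu (tpoly sb) (tgrad (neumann_term n)) D.
Proof.
move=> vD; rewrite [neumann_term _]/= (vdot_tgrad_scaled vD); last first.
  (* A divergence has no mean: at frequency 0 its coefficients carry the factor [twoipi 0]. *)
  by move=> p /flattenP[_ /mapP[j _ ->] /mapP[q _ ->]] /= ->; rewrite ffunE /twoipi mulr0 mul0r.
rewrite -[LHS]opprK -(vdot_tpoly_div (fun j => tmul sb (tderiv j (neumann_term n))) vD).
congr (- _); apply: eq_Rintegral => x _; rewrite /vprod mul1r mulr_sumr.
by congr (complex.Re _); apply: eq_bigr => j _; rewrite tpoly_mul mulrA.
Qed.

(** This estimate retains the spectral gap 2 pi; the constants of the final bound depend on it. *)
Lemma vnorm_neumann_term0 : 2 * pi * a0 * vnorm mu (tgrad (neumann_term 0)) <=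
  vnorm mu (sc (tpoly sf)).
Proof.
have us : uniq (tfreqs (tscale (- a0^-1)%:C sf)) by rewrite /tfreqs -map_comp.
have := vnorm_tgrad_tsolve us; rewrite -[tsolve _]/(neumann_term 0).
rewrite -(ler_pM2l a0_gt0) => H; rewrite [leLHS](_ : _ = a0 * (2 * pi * vnorm mu (tgrad (neumann_term 0)))); last by ring.
apply: le_trans H _; rewrite le_eqVlt; apply/orP; left; apply/eqP.
apply/eqP; rewrite -(@eqrXn2 _ 2) ?mulr_ge0 ?vnorm_ge0 ?(ltW a0_gt0)// exprMn !sqr_vnorm_sc.
rewrite -RintegralZl//; last exact: (cL2_tpoly _).2.
apply/eqP; apply: eq_Rintegral => x _; rewrite tpoly_scale normcM normc_real normrN.
by rewrite ger0_norm ?invr_ge0 ?(ltW a0_gt0)// exprMn mulrA -exprMn divff ?gt_eqF// expr1n mul1r.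
Qed.

(** The equation of the term is tested with the term itself; Cauchy-Schwarz then allows division by
    its gradient norm, if nonzero. *)
Lemma vnorm_neumann_termS n : a0 * vnorm mu (tgrad (neumann_term n.+1)) <=
  K * vnorm mu (tgrad (neumann_term n)).
Proof.
set X := vnorm mu (tgrad (neumann_term n.+1)); have X0 : 0 <= X := vnorm_ge0 _ _.
have vg := vgrad_tpoly (neumann_term n.+1).
have := vdot_neumann_termS n vg; rewrite vdot1 -/X => E.
have := vdot_le K_ge0 sbK (vL2_tgrad (neumann_term n)) (vL2_tgrad (neumann_term n.+1)).
rewrite -normrN -E -/X ger0_norm ?mulr_ge0 ?sqr_ge0 ?(ltW a0_gt0)// => H.
have [XE|Xn0] := eqVneq X 0; first by rewrite XE mulr0 mulr_ge0// vnorm_ge0.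
have Xp : 0 < X by rewrite lt_def Xn0.
by rewrite -(ler_pM2r Xp) -!mulrA -expr2.
Qed.

(** Telescoping: the [a0] part of each new term cancels the [tpoly sb] part of the preceding one. *)
Lemma vdot_neumann_sum v D n : vgrad v D ->
  vdot mu (fun x => a0%:C + tpoly sb x) (tgrad (neumann_sum n)) D =
  vdot mu one (sc (tpoly sf)) (sc v) + vdot mu (tpoly sb) (tgrad (neumann_term n)) D.
Proof.
move=> vD; have [_ LD _] := vD.
have ba : ess_bounded mu (fun=> a0%:C : C) a0.
  split; first by split; exact: measurable_cst.
  by apply: aeW => x; rewrite normc_real gtr0_norm.
have bab : ess_bounded mu (fun x => a0%:C + tpoly sb x) (a0 + K).
  split; first exact: cmeasD ba.1 sbK.1.
  by apply: filterS2 ba.2 sbK.2 => x ? ?; rewrite (le_trans (ler_normcD _ _))// lerD.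
have split_ s : vdot mu (fun x => a0%:C + tpoly sb x) (tgrad s) D =
    a0 * vdot mu one (tgrad s) D + vdot mu (tpoly sb) (tgrad s) D.
  rewrite (vdotD ba sbK (vL2_tgrad s) LD); congr (_ + _).
  rewrite -(vdotZl _ (ess_bounded1 mu) (vL2_tgrad s) LD).
  apply: eq_Rintegral => x _; rewrite /vprod mul1r mulr_sumr.
  by congr (complex.Re _); apply: eq_bigr => j _; rewrite mulrA.
elim: n => [|n IH].
  by rewrite -[neumann_sum 0]/(neumann_term 0) split_ (vdot_neumann_term0 vD).
rewrite -[neumann_sum n.+1]/(neumann_sum n ++ neumann_term n.+1).
rewrite (_ : tgrad (_ ++ _) = fun j x => tgrad (neumann_sum n) j x + tgrad (neumann_term n.+1) j x); last first.
  by apply/funext => j; apply/funext => x; exact: tgrad_cat.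
rewrite (vdotDl bab)//; [|exact: vL2_tgrad|exact: vL2_tgrad].
by rewrite IH split_ (vdot_neumann_termS _ vD); ring.
Qed.

Let q := K / a0.
Let B := vnorm mu (tgrad (neumann_term 0)).

Lemma vnorm_neumann_term n : vnorm mu (tgrad (neumann_term n)) <= q ^+ n * B.
Proof.
elim: n => [|n IH]; first by rewrite mul1r.
rewrite exprS -mulrA /q mulrAC ler_pdivlMr// mulrC.
by apply: le_trans (vnorm_neumann_termS n) _; rewrite ler_wpM2l.
Qed.

Hypothesis q_le : 3 * K <= a0.

Let q01 : 0 <= q <= 3^-1.
Proof.
by rewrite divr_ge0 ?(ltW a0_gt0)//= ler_pdivrMr// mulrC ler_pdivlMr// mulrC.
Qed.

Lemma vnorm_neumann_sum_tail n m :
  vnorm mu (fun j x => tgrad (neumann_sum (n + m)) j x - tgrad (neumann_sum n) j x) <=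
  3 / 2 * q ^+ n.+1 * B.
Proof.
have B0 : 0 <= B := vnorm_ge0 _ _.
have /andP[q0 q3] := q01.
(* 3/2 = 1 / (1 - 1/3). Keeping the factor 1 - q^m makes the induction close, its step being q^m <=
   3/2 (q^m - q^(m+1)), that is q <= 1/3. *)
suff H : vnorm mu (fun j x => tgrad (neumann_sum (n + m)) j x - tgrad (neumann_sum n) j x) <=
    3 / 2 * (1 - q ^+ m) * (q ^+ n.+1 * B).
  apply: le_trans H _; rewrite -mulrA -[leRHS]mulrA ler_wpM2l// ler_piMl ?mulr_ge0 ?exprn_ge0//.
  by rewrite gerBl exprn_ge0.
elim: m => [|m IH].
  rewrite addn0 expr0 subrr mulr0 mul0r /vnorm /vsq.
  under eq_Rintegral do under eq_bigr do rewrite subrr normc0 expr0n.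
  under eq_Rintegral do rewrite sumr_const mul0rn.
  by rewrite Rintegral_cst// mul0r sqrtr0.
rewrite addnS (_ : (fun j x => _) = fun j x => tgrad (neumann_term (n + m).+1) j x +
    (tgrad (neumann_sum (n + m)) j x - tgrad (neumann_sum n) j x)); last first.
  by apply/funext => j; apply/funext => x; rewrite -[neumann_sum _.+1]/(neumann_sum (n + m) ++ neumann_term (n + m).+1) tgrad_cat; ring.
apply: le_trans (vnormD (vL2_tgrad _) (vL2B (vL2_tgrad _) (vL2_tgrad _))) _.
apply: le_trans (lerD (vnorm_neumann_term _) IH) _.
rewrite -addSn exprD [q ^+ m.+1]exprS.
have P0 : 0 <= q ^+ n.+1 * B by rewrite mulr_ge0 ?exprn_ge0.
have Q0 : 0 <= q ^+ m by rewrite exprn_ge0.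
move: (q ^+ n.+1) P0 (q ^+ m) Q0 => y P0 z Q0.
have : 0 <= (3^-1 - q) * z * (y * B) by apply: mulr_ge0 => //; apply: mulr_ge0; rewrite ?subr_ge0.
lra.
Qed.

Lemma vnorm_neumann_sum n : vnorm mu (tgrad (neumann_sum n)) <= 3 / 2 * B.
Proof.
have B0 : 0 <= B := vnorm_ge0 _ _.
have /andP[q0 q3] := q01.
rewrite (_ : tgrad _ = fun j x => tgrad (neumann_term 0) j x + (tgrad (neumann_sum (0 + n)) j x - tgrad (neumann_sum 0) j x)).
  apply: le_trans (vnormD (vL2_tgrad _) (vL2B (vL2_tgrad _) (vL2_tgrad _))) _.
  apply: le_trans (lerD (lexx _) (vnorm_neumann_sum_tail 0 n)) _.
  (* B + 3/2 q B <= 3/2 B, again by q <= 1/3. *)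
  by rewrite expr1 -/B; nra.
by apply/funext => j; apply/funext => x; rewrite add0n; ring.
Qed.

(* [v] is the difference between a solution and a partial sum: [u] (with
   [al = a]) and [uNs] (with [al = a^s]) are both compared in this way. *)
Lemma energy_estimate (al : T -> R) (almin Kal Kd : R) (phi v : T -> C) (D : 'I_d -> T -> C) n :
  measurable_fun setT al -> ess_bounded mu (fun x => (al x)%:C) Kal ->
  0 < almin -> {ae mu, forall x, almin <= al x} -> 0 <= Kd ->
  ess_bounded mu (fun x => (al x)%:C - (a0%:C + tpoly sb x)) Kd ->
  vgrad v D -> cintegral v = 0 -> cL2 mu phi ->
  vdot mu (fun x => (al x)%:C) (fun j x => D j x + tgrad (neumann_sum n) j x) D =
    vdot mu one (sc phi) (sc v) ->
  almin * vnorm mu D <= vnorm mu (sc (fun x => phi x - tpoly sf x))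
    + Kd * vnorm mu (tgrad (neumann_sum n)) + K * vnorm mu (tgrad (neumann_term n)).
Proof.
move=> mal bal al0 alae Kd0 bd vD v0 Lphi E; have [Lv LD _] := vD.
have Lw := vL2_tgrad (neumann_sum n); have Lf := cL2_tpoly sf.
have bab : ess_bounded mu (fun x => a0%:C + tpoly sb x) (a0 + K).
  split; first by apply: cmeasD sbK.1; split; exact: measurable_cst.
  apply: filterS sbK.2 => x ?; rewrite (le_trans (ler_normcD _ _))// lerD//.
  by rewrite normc_real gtr0_norm.
have X0 := vnorm_ge0 mu D; set X := vnorm mu D in X0 *.
have low := vdot_real_ge mal bal alae LD; rewrite -/X in low.
rewrite (vdotDl bal LD Lw LD) in E.
(* Splitting [al] as its deviation from a0 + b plus a0 + b writes the energy of [D] as three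
   pairings: the data error with v, minus the coefficient error on the partial sum, minus the
   residual b times the last term. *)
have E2 : vdot mu (fun x => (al x)%:C) (tgrad (neumann_sum n)) D =
    vdot mu (fun x => (al x)%:C - (a0%:C + tpoly sb x)) (tgrad (neumann_sum n)) D +
    vdot mu (fun x => a0%:C + tpoly sb x) (tgrad (neumann_sum n)) D.
  rewrite -(vdotD bd bab Lw LD); congr (vdot _ _ _ _).
  by apply/funext => x; rewrite subrK.
rewrite (vdot_neumann_sum n vD) in E2.
have E3 : vdot mu one (sc phi) (sc v) = vdot mu one (sc (fun x => phi x - tpoly sf x)) (sc v) +
    vdot mu one (sc (tpoly sf)) (sc v).
  rewrite -(vdotDl (ess_bounded1 mu) (vL2_sc (cL2B Lphi Lf)) (vL2_sc Lf) (vL2_sc Lv)).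
  by congr (vdot _ _ _ _); apply/funext => _; apply/funext => x; rewrite subrK.
have H1 := le_trans (ler_norm _) (poincare_dual vD v0 (cL2B Lphi Lf)).
have H2 := vdot_le Kd0 bd Lw LD; have H3 := vdot_le K_ge0 sbK (vL2_tgrad (neumann_term n)) LD.
move: H2 H3; rewrite !ler_norml => /andP[H2 _] /andP[H3 _].
rewrite -/X in H1 H2 H3.
(* The three bounds all carry a factor X, which is divided out. *)
have [XE|Xn0] := eqVneq X 0.
  by rewrite XE mulr0 !addr_ge0 ?mulr_ge0 ?vnorm_ge0.
have Xp : 0 < X by rewrite lt_def Xn0.
rewrite -(ler_pM2r Xp) -mulrA -expr2; lra.
Qed.

End Neumann.

(** * Norms as real numbers, frequency lists and means *)

Section Norms.
Variables (R : realType) (d : nat).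
Local Notation C := R[i].
Local Notation T := (pt R d).
Local Notation mu := (haar R d).
Local Open Scope complex_scope.
Implicit Types (k : freq d) (s : seq (freq d * C)) (x : T) (j : 'I_d) (u v h g : T -> C).
Local Notation sc v := (fun _ : 'I_1 => v).

Lemma haarT : mu [set: T] = 1%E. Proof. exact: probability_setT. Qed.

Lemma cnorm2E g : cL2 mu g -> cnorm 2%:E g = (vnorm mu (sc g))%:E.
Proof.
move=> [_ ig]; rewrite /cnorm (Lnorm2E ig) /vnorm /vsq.
by under [in RHS]eq_Rintegral do rewrite big_ord1.
Qed.

(** Turns the essential supremum into a real number [K], its finiteness coming from some almost
    everywhere bound [M]. *)
Lemma cnorm_infty_bounded g (M : R) : cmeas g -> {ae mu, forall x, normc (g x) <= M} ->
  exists K : R, [/\ 0 <= K, K <= M, cnorm +oo%E g = K%:E & ess_bounded mu g K].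
Proof.
move=> mg gM.
have E : cnorm +oo%E g = ess_sup mu (fun x => (normc (g x))%:E).
  rewrite /cnorm unlock ifT; last by rewrite [X in (_ < X)%E]haarT lte01.
  congr ess_sup.
  by apply/funext => x /=; rewrite ger0_norm ?normc_ge0.
have g0 : (0 <= cnorm +oo%E g)%E by exact: Lnorm_ge0.
have gM' : (cnorm +oo%E g <= M%:E)%E by rewrite E; apply/ess_supP; apply: filterS gM => x; rewrite lee_fin.
have fin : cnorm +oo%E g \is a fin_num by rewrite ge0_fin_numE// (le_lt_trans gM') ?ltry.
exists (fine (cnorm +oo%E g)); rewrite fine_ge0// fineK// -lee_fin fineK//; split=> //.
split=> //; have := @ess_sup_ge _ _ _ mu (fun x => (normc (g x))%:E).
by apply: filterS => x; rewrite -E -{1}(fineK fin) lee_fin.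
Qed.

Lemma Lfun_infty_bounded (a : T -> R) : a \in Lfun mu +oo%E ->
  measurable_fun setT a /\ exists M : R, {ae mu, forall x, `|a x| <= M}.
Proof.
move=> aL; have /= ma : measurable_fun setT a := set_mem (sub_Lfun_mfun aL).
split=> //; have /= := set_mem (sub_Lfun_finLfun aL).
rewrite /finite_norm unlock ifT => [aoo|]; last by rewrite [X in (_ < X)%E]haarT lte01.
have := @ess_sup_ge _ _ _ mu (abse \o (EFin \o a)).
(* As an extended real the supremum could a priori be -oo; then 0 serves as a bound. *)
have [E|nE] := eqVneq (ess_sup mu (abse \o (EFin \o a))) -oo%E.
  by rewrite E => H; exists 0; apply: filterS H => x /=; rewrite leeNy_eq.
have fin : ess_sup mu (abse \o (EFin \o a)) \is a fin_num by rewrite fin_numE nE lt_eqF.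
move=> H; exists (fine (ess_sup mu (abse \o (EFin \o a)))); apply: filterS H => x /=.
by rewrite -{1}(fineK fin) lee_fin.
Qed.

Lemma Lfun2_cL2 (f : T -> R) : f \in Lfun mu 2%:E -> cL2 mu (cplx f).
Proof.
move=> fL; have /= mf : measurable_fun setT f := set_mem (sub_Lfun_mfun fL).
have /= := set_mem (sub_Lfun_finLfun fL); rewrite /finite_norm => foo.
have If := Lint_Lnorm2 mf foo; apply/cL2P; split; first by split.
by apply: (@sqint_bounded _ _ _ _ _ 0) => // x; rewrite normr0.
Qed.

(** [H_norm] is defined by a chosen weak gradient; almost everywhere uniqueness lets any explicit
    one compute it. *)
Lemma H_normE u D : in_H1 u -> vgrad u D -> H_norm u = (vnorm mu D)%:E.
Proof.
move=> hu vD; have vw := in_H1_vgrad hu; have [_ Lw _] := vw; have [_ LD _] := vD.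
have S x : Num.sqrt (\sum_j normc (wpartial j u x) ^+ 2) ^+ 2 = vsq (fun j => wpartial j u) x.
  by rewrite sqr_sqrtr//; exact: (vsq_ge0 (fun j => wpartial j u)).
rewrite /H_norm Lnorm2E; last by under eq_fun do rewrite S; exact: Lint_vsq.
rewrite -(vnorm_ae Lw LD (vgrad_unique vw vD)) /vnorm.
by congr (Num.sqrt _)%:E; apply: eq_Rintegral => x _; rewrite S.
Qed.

Lemma finite_set_enum (D : set (freq d)) : finite_set D ->
  exists r : seq (freq d), [/\ uniq r, forall k, k \in r <-> D k &
    forall F : freq d -> C, \sum_(k \in D) F k = \sum_(k <- r) F k].
Proof.
move=> fD; exists (finmap.enum_fset (fset_set D)); split.
- exact: finmap.fset_uniq.
- move=> k; have E := in_fset_set fD k; split=> [|Dk].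
    by move=> kD; apply: set_mem; rewrite -E.
  by have := mem_set Dk; rewrite -E.
- by move=> F; rewrite fsbig_finite.
Qed.

Definition tlist (r : seq (freq d)) (b : freq d -> C) : seq (freq d * C) := [seq (k, b k) | k <- r].

Lemma tfreqs_tlist r b : tfreqs (tlist r b) = r.
Proof. by rewrite /tfreqs /tlist -map_comp map_id. Qed.

Lemma tpoly_tlist r b x : tpoly (tlist r b) x = \sum_(k <- r) b k * echar k x.
Proof. by rewrite /tpoly /tlist big_map. Qed.

Lemma finite_stamping N (b : freq d -> C) F : finite_set (supp b) -> finite_set F ->
  finite_set (stamping N b F).
Proof. by move=> fb fF; elim: N => [//|N IH] /=; exact: finite_image2. Qed.

Lemma stampingS N (b : freq d -> C) F : supp b 0 -> stamping N b F `<=` stamping N.+1 b F.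
Proof. by move=> b0 k Sk; exists k => //; exists 0 => //; rewrite addr0. Qed.

Lemma tsolve0 s p : p \in tsolve s -> p.1 = 0 -> p.2 = 0.
Proof.
by move=> /mapP[q _ ->] /= ->; rewrite freq_sq0 invr0 oppr0 mulr0.
Qed.

Lemma neumann_sum0 (a0 : R) (sb sf : seq (freq d * C)) n p : p \in neumann_sum a0 sb sf n -> p.1 = 0 -> p.2 = 0.
Proof.
elim: n => [|n IH]; first exact: tsolve0.
rewrite -[neumann_sum _ _ _ n.+1]/(neumann_sum a0 sb sf n ++ neumann_term a0 sb sf n.+1).
by rewrite mem_cat => /orP[/IH//|]; exact: tsolve0.
Qed.

(** Derivatives and [tsolve] keep frequencies, and each product with [sb] adds one element of the
    support: one term per stamping level. The frequency 0 in the support keeps the earlier terms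
    inside. *)
Lemma tfreqs_neumann_sum (a0 : R) (sb sf : seq (freq d * C)) n (b : freq d -> C) (F : set (freq d)) : supp b 0 ->
  (forall k, k \in tfreqs sb -> supp b k) -> (forall k, k \in tfreqs sf -> F k) ->
  forall k, k \in tfreqs (neumann_sum a0 sb sf n) -> stamping n b F k.
Proof.
move=> b0 sbb sfF.
have term m k : k \in tfreqs (neumann_term a0 sb sf m) -> stamping m b F k.
  elim: m k => [|m IH] k.
    rewrite [neumann_term _ _ _ _]/= /tfreqs /tsolve /tscale -!map_comp => /mapP[p ps ->] /=.
    by apply: sfF; apply/mapP; exists p.
  rewrite [neumann_term _ _ _ _]/= /tfreqs /tsolve /tscale -!map_comp => /mapP[p + ->] /=.
  move=> /flattenP[_ /mapP[j _ ->] /mapP[q + ->]] /=.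
  move=> /allpairsP[[q1 q2] /= [q1b + ->]] /= => /mapP[q3 q3m ->] /=.
  exists q3.1; first by apply: IH; apply/mapP; exists q3.
  exists q1.1; last by rewrite addrC.
  by apply: sbb; apply/mapP; exists q1.
elim: n => [|n IH] k; first exact: term.
rewrite -[neumann_sum _ _ _ n.+1]/(neumann_sum a0 sb sf n ++ neumann_term a0 sb sf n.+1).
rewrite /tfreqs map_cat mem_cat => /orP[/IH|/term//].
exact: stampingS.
Qed.

Lemma cintegral_eq0_tpoly s : (forall p, p \in s -> p.1 = 0 -> p.2 = 0) -> cintegral (tpoly s : T -> C) = 0.
Proof.
by move=> s0; rewrite cintegral_tpoly big_seq_cond big1// => p /andP[ps /eqP]; exact: s0.
Qed.

Lemma cintegralB u v : cL2 mu u -> cL2 mu v ->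
  cintegral (fun x => u x - v x) = cintegral u - cintegral v.
Proof.
move=> Lu Lv; have [ur ui] := (cL2P mu u).1 Lu; have [vr vi] := (cL2P mu v).1 Lv.
apply: complex_ext; rewrite ?cReD ?cImD ?cReN ?cImN /=.
  by under eq_Rintegral do rewrite cReD cReN; rewrite RintegralB//; exact: sqint_Lint.
by under eq_Rintegral do rewrite cImD cImN; rewrite RintegralB//; exact: sqint_Lint.
Qed.

Lemma fourier0 u : fourier u 0 = cintegral u.
Proof. by rewrite /fourier; congr cintegral; apply/funext => x; rewrite echar0 rmorph1 mulr1. Qed.

End Norms.

(** * The Galerkin system *)

Section Galerkin.
Variables (R : realType) (d : nat).
Local Notation C := R[i].
Local Notation T := (pt R d).
Local Notation mu := (haar R d).
Local Open Scope complex_scope.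
Implicit Types (k l : freq d) (s : seq (freq d * C)) (x : T) (j : 'I_d).
Local Notation one := (fun=> 1 : C).
Local Notation sc v := (fun _ : 'I_1 => v).

Lemma vdot_tpoly s t : vdot mu one (sc (tpoly s)) (sc (tpoly t)) =
  complex.Re (\sum_(p <- t) p.2^* * \sum_(q <- s | q.1 == p.1) q.2).
Proof.
rewrite /vdot (@eq_Rintegral _ _ _ mu _ (fun x => complex.Re (tpoly (tmul s (tconj t)) x))); last first.
  by move=> x _; rewrite /vprod mul1r big_ord1 tpoly_mul tpoly_conj.
rewrite Rint_Re_tpoly big_mkcond /tmul big_allpairs_dep/= exchange_big/=.
rewrite /tconj big_map/=; congr (complex.Re _); apply: eq_bigr => p _.
rewrite [in RHS]big_mkcond mulr_sumr; apply: eq_bigr => q _.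
by rewrite subr_eq0; case: ifP => _; rewrite ?mulr0// mulrC.
Qed.

Lemma big_uniq_eq (r : seq (freq d)) (b : freq d -> C) k : uniq r ->
  (k \notin r -> b k = 0) -> \sum_(l <- r | l == k) b l = b k.
Proof.
move=> ur bk; have [kr|kr] := boolP (k \in r).
  by rewrite -big_filter filter_pred1_uniq// big_seq1.
rewrite (bk kr) big_seq_cond big1// => l /andP[lr /eqP lk].
by rewrite -lk lr in kr.
Qed.

Lemma twoipiM (m n : int) : twoipi R m * twoipi R n = - ((2 * pi)%:C ^+ 2 * (m * n)%:~R).
Proof.
rewrite -rmorphXn intrM (_ : (m%:~R * n%:~R : C) = (m%:~R * n%:~R : R)%:C).
  by apply: complex_ext; rewrite ?cReN ?cImN ?cReM ?cImM/=; ring.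
by rewrite rmorphM !rmorph_int.
Qed.

(** The k-th equation of the system is the weak equation tested with the character of frequency k.
    Weighted by the conjugate coefficients of a polynomial with frequencies in [rs] and summed, the
    equations give the weak equation for that polynomial. *)
Lemma galerkin_identity (ra rs : seq (freq d)) (ah c : freq d -> C) s t :
  uniq ra -> (forall k, k \notin ra -> ah k = 0) ->
  (forall k, k \in rs -> \sum_(l <- rs) (2 * pi)%:C ^+ 2 * (freq_dot l k)%:~R * ah (k - l) * c l =
    \sum_(q <- s | q.1 == k) q.2) ->
  (forall p, p \in t -> p.1 \in rs) ->
  vdot mu (tpoly (tlist ra ah)) (tgrad (tlist rs c)) (tgrad t) = vdot mu one (sc (tpoly s)) (sc (tpoly t)).
Proof.
move=> ua ah0 eqn tS; set la := tlist ra ah; set le := tlist rs c.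
rewrite (_ : vdot _ _ _ _ = vdot mu one (fun j => tpoly (tmul la (tderiv j le))) (tgrad t)); last first.
  apply: eq_Rintegral => x _; rewrite /vprod mul1r mulr_sumr.
  by congr (complex.Re _); apply: eq_bigr => j _; rewrite tpoly_mul mulrA.
rewrite (vdot_tpoly_div (fun j => tmul la (tderiv j le)) (vgrad_tpoly t)) !vdot_tpoly.
rewrite -cReN -sumrN !big_seq; congr (complex.Re _); apply: eq_bigr => p pt.
rewrite -mulrN -(eqn _ (tS _ pt)); congr (_ * _); move: (p.1) => k.
rewrite big_mkcond /tdiv big_flatten big_map/=.
(* A product of characters contributes at k when a + l = k, whence the index k - l of the
   coefficient. *)
transitivity (- \sum_j \sum_(a <- ra) \sum_(l <- rs)
   if a == k - l then ah a * (twoipi R (k j) * twoipi R (l j) * c l) else 0).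
  congr (- _); apply: eq_bigr => j _.
  rewrite /tderiv big_map/= /tmul big_allpairs_dep/= big_map/=; apply: eq_bigr => a _.
  rewrite !big_map/=; apply: eq_bigr => l _; rewrite [a == k - l](_ : _ = (a + l == k)); last first.
    by rewrite eq_sym subr_eq eq_sym.
  by case: eqP => [->|//]; ring.
rewrite exchange_big/= (eq_bigr (fun a => \sum_(l <- rs) \sum_j
   if a == k - l then ah a * (twoipi R (k j) * twoipi R (l j) * c l) else 0)); last first.
  by move=> a _; exact: exchange_big.
rewrite exchange_big/= -sumrN; apply: eq_bigr => l _.
rewrite (eq_bigr (fun a => (if a == k - l then ah a else 0) * \sum_j twoipi R (k j) * twoipi R (l j) * c l)); last first.
  move=> a _; case: eqP => _; first by rewrite mulr_sumr.
  by rewrite mul0r big1.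
rewrite -!mulr_suml (_ : \sum_(i <- ra) _ = ah (k - l)); last first.
  by rewrite -(big_uniq_eq ua (ah0 (k - l))) [RHS]big_mkcond.
rewrite (eq_bigr (fun j => - ((2 * pi)%:C ^+ 2 * (l j * k j)%:~R))); last first.
  by move=> j _; rewrite twoipiM [k j * _]mulrC.
rewrite sumrN -mulr_sumr -rmorph_sum -/(freq_dot l k) mulNr mulrN opprK; ring.
Qed.

End Galerkin.

(** * Assembly of the error estimate *)

Lemma exists_expr_small (R : realType) (q c e : R) : 0 <= q < 1 -> 0 < e -> exists n : nat, c * q ^+ n <= e.
Proof.
move=> /andP[q0 q1] e0.
have : c * q ^+ n @[n --> \oo] --> (0 : R).
  rewrite -[X in _ --> X](mulr0 c); apply: cvgMr.
  by apply: cvg_expr; rewrite ger0_norm.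
move=> /cvgrPdist_le/(_ _ e0)[n _ /(_ n (leqnn n))] /=.
by rewrite sub0r normrN => H; exists n; exact: le_trans (ler_norm _) H.
Qed.

(** [V1], [V2], [V3] stand for the norms of u - w_(N+n), w_(N+n) - w_N and u^(N,s) - w_N. The
    hypothesis 4 a0 B <= F is used twice: m <= a0 turns it into 3/2 B <= F / m, the bound for the
    partial sums, and m <= K2 into a0 B <= K2 F / m, the origin of the factor ||a'|| in the stamping
    term. *)
Lemma error_budget (R : realFieldType)
  (amin asmin m a0 B F F1 F3 K1 K2 K3 y z V V1 V2 V3 e : R) :
  0 < amin -> 0 < asmin -> 0 < m -> m <= a0 -> m <= K2 -> 0 <= B -> 4 * a0 * B <= F ->
  0 <= K1 -> 0 <= K3 -> 0 <= y -> y <= z -> V <= V1 + V2 + V3 ->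
  amin * V1 <= F1 + K1 * (3 / 2 * B) + amin * e -> V2 <= 3 / 2 * y * B ->
  asmin * V3 <= F3 + K3 * (3 / 2 * B) + a0 * y * B ->
  V <= F1 / amin + K1 * F / (amin * m) + (1 + K2 / asmin) * z * (F / m)
    + K3 * F / (asmin * m) + F3 / asmin + e.
Proof.
move=> am0 as0 m0 ma mK B0 BF K10 K30 y0 yz VV H1 H2 H3.
have [G GE] : exists G, G = F / m by exists (F / m).
have FE : F = G * m by rewrite GE divfK// gt_eqF.
have aB : 0 <= a0 * B by rewrite mulr_ge0// (le_trans (ltW m0)).
have BG : 3 / 2 * B <= G.
  rewrite GE ler_pdivlMr//; have := ler_wpM2r B0 ma; lra.
have G0 : 0 <= G by apply: le_trans BG; rewrite mulr_ge0.
have V1le : V1 <= F1 / amin + K1 * G / amin + e.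
  rewrite -(ler_pM2l am0) !mulrDr ![amin * (_ / amin)]mulrC !divfK ?gt_eqF//.
  by apply: le_trans H1 _; rewrite lerD2r lerD2l ler_wpM2l.
have V2le : V2 <= z * G.
  apply: le_trans H2 _; rewrite mulrAC mulrC.
  by apply: ler_pM => //; rewrite mulr_ge0.
have aBK : a0 * B <= K2 * G.
  apply: (@le_trans _ _ F); first lra.
  by rewrite FE mulrC ler_wpM2r.
have V3le : V3 <= F3 / asmin + K3 * G / asmin + K2 * z * G / asmin.
  rewrite -(ler_pM2l as0) !mulrDr ![asmin * (_ / asmin)]mulrC !divfK ?gt_eqF//.
  apply: le_trans H3 _; apply: lerD; first by rewrite lerD2l ler_wpM2l.
  rewrite mulrAC [leRHS]mulrAC; apply: ler_pM => //.
rewrite FE (_ : K1 * (G * m) / (amin * m) = K1 * G / amin); last by field; rewrite !gt_eqF.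
rewrite (_ : K3 * (G * m) / (asmin * m) = K3 * G / asmin); last by field; rewrite !gt_eqF.
rewrite mulfK ?gt_eqF//.
rewrite (_ : (1 + K2 / asmin) * z * G = z * G + K2 * z * G / asmin); last by field; rewrite gt_eqF.
lra.
Qed.

Theorem corollary4 (R : realType) (d : nat) (hd : (0 < d)%N)
  (a f : pt R d -> R) (amin : R)
  (ha : a \in Lfun (haar R d) +oo%E)
  (hamin : 0 < amin)
  (hage : \forall x \ae haar R d, amin <= a x)
  (hf : f \in Lfun (haar R d) 2%:E)
  (hf0 : fourier (cplx f) 0 = 0)
  (as_ fs : pt R d -> R) (asmin : R)
  (has : trig_polynomial (cplx as_))
  (hfs : trig_polynomial (cplx fs))
  (hasmin : 0 < asmin)
  (hasge : forall x, asmin <= as_ x)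
  (hfs0 : fourier (cplx fs) 0 = 0)
  (hdom : 3 * \sum_(k \in supp (fourier (cplx as_)) `\ 0)
                `|fourier (cplx a) k| <= fourier (cplx a) 0)
  (u : pt R d -> R[i]) (hu : in_H u) (hsol : weak_solution a f u)
  (N : nat) (uNs : pt R d -> R[i])
  (huNs : sparse_spectral_approx as_ fs N uNs) :
  let a' := freq_restr (cplx a) (supp (fourier (cplx as_))) in
  let f' := freq_restr (cplx f) (supp (fourier (cplx fs))) in
  (* [a'] is real-valued; [Re] only changes its type *)
  let a'min : \bar R := ess_inf (haar R d) (fun x => (complex.Re (a' x))%:E) in
  let osc : \bar R := cnorm +oo%E (a' \- cst (fourier a' 0)) in
  (H_norm (u \- uNs)%R <=
    if a'min - 2%:E * osc == 0 then +oo else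
      cnorm 2%:E (cplx f \- f')%R / amin%:E
      + cnorm +oo (cplx a \- a')%R * cnorm 2%:E f' / (amin%:E * a'min)
      + (1 + cnorm +oo a' / asmin%:E) * (osc / (a'min - 2%:E * osc)) ^+ N.+1
          * (cnorm 2%:E f' / a'min)
      + cnorm +oo (a' \- cplx as_)%R * cnorm 2%:E f' / (asmin%:E * a'min)
      + cnorm 2%:E (f' \- cplx fs)%R / asmin%:E)%E.
Proof.
cbv zeta; set a' := freq_restr (cplx a) _; set f' := freq_restr (cplx f) _.
set a'min := ess_inf _ _; set osc := cnorm +oo%E (a' \- cst _).
have [ma [Ma aM]] := Lfun_infty_bounded ha; have Lf := Lfun2_cL2 hf.
pose ah := fourier (cplx a); pose ash := fourier (cplx as_).
pose fh := fourier (cplx f); pose fsh := fourier (cplx fs).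
have [fSa asE] := has; have [fSf fsE] := hfs.
have [ra [ura raP raS]] := finite_set_enum R fSa.
have [rf [urf rfP rfS]] := finite_set_enum R fSf.
have [rb [urb rbP rbS]] : exists r : seq (freq d), [/\ uniq r,
    forall k, k \in r <-> (supp ash `\ 0) k &
    forall F : freq d -> R[i], \sum_(k \in supp ash `\ 0) F k = \sum_(k <- r) F k].
  by apply: finite_set_enum; exact: finite_setD.
have [c [c0 ceq uE]] := huNs.
pose S := stamping N ash (supp fsh).
have [rs [urs rsP rsS]] : exists r : seq (freq d), [/\ uniq r, forall k, k \in r <-> S k &
    forall F : freq d -> R[i], \sum_(k \in S) F k = \sum_(k <- r) F k].
  by apply: finite_set_enum; exact: finite_stamping.
pose las := tlist ra ash; pose sb := tlist rb ah.
pose lf := tlist rf fh; pose lfs := tlist rf fsh; pose le := tlist rs c.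
have f'E : f' = tpoly lf.
  by apply/funext => x; rewrite /f' /freq_restr /trig rfS tpoly_tlist.
have asE' x : (as_ x)%:C%C = tpoly las x.
  by have := asE x; rewrite /cplx => ->; rewrite /freq_restr /trig raS tpoly_tlist.
have fsE' : cplx fs = tpoly lfs.
  by apply/funext => x; rewrite fsE /freq_restr /trig rfS tpoly_tlist.
have uNE : uNs = tpoly le.
  by rewrite uE; apply/funext => x; rewrite /trig rsS tpoly_tlist.
have mas : measurable_fun setT as_.
  rewrite (_ : as_ = fun x => complex.Re (tpoly las x)); first exact: measurable_Re_tpoly.
  by apply/funext => x; rewrite -asE'.
have [Mas asM] : exists M : R, forall x, `|as_ x| <= M.
  have [M HM] := tpoly_bounded las; exists M => x.
  by rewrite -normc_real asE'.
have bas : ess_bounded (haar R d) (fun x => (as_ x)%:C%C) Mas.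
  by split; [exact: cmeas_real|apply: aeW => x; rewrite normc_real].
have ba : ess_bounded (haar R d) (fun x => (a x)%:C%C) Ma.
  by split; [exact: cmeas_real|apply: filterS aM => x; rewrite normc_real].
have Rcst (r : R) : (\int[haar R d]_x cst r x)%R = r.
  by rewrite Rintegral_cst// [X in fine X]probability_setT mulr1.
have Icst (r : R) : Lint (haar R d) (cst r).
  by apply: (@Lint_bounded _ _ _ _ _ `|r|) => // x.
(* The mean of a^s is at least [asmin] > 0; with 0 in the support, the stamping sets are nested. *)
have ash0 : supp ash 0.
  apply: contraTneq hasmin => /(congr1 (@complex.Re R)); rewrite /ash fourier0 /= => E.
  rewrite -leNgt -E -(Rcst asmin); apply: le_Rintegral => //.
    exact: Icst.
  exact: Lint_bounded mas asM.
have [a0 a0E] : exists a0 : R, a0 = complex.Re (ah 0) by eexists.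
have ah0E : ah 0 = a0%:C%C.
  by apply: complex_ext; rewrite ?a0E// /ah fourier0 /= /cplx /= Rcst.
have ama0 : amin <= a0.
  rewrite a0E /ah fourier0 /= -(Rcst amin); apply: Rint_ae_le => //.
  exact: Lint_ae_bounded ma aM.
have a00 : 0 < a0 := lt_le_trans hamin ama0.
(* Isolating the frequency 0 gives a' = a0 + b with b = [tpoly sb]. *)
have pra : perm_eq ra (0 :: rb).
  apply: uniq_perm => //=.
    by rewrite urb andbT; apply/negP => /rbP[_] /=.
  move=> k; rewrite inE; apply/idP/idP.
    move=> /raP ka; case: eqP => //= k0; exact/rbP.
  by move=> /orP[/eqP->|/rbP[]]; [exact/raP|move=> ? _; exact/raP].
have a'E x : a' x = a0%:C%C + tpoly sb x.
  rewrite /a' /freq_restr /trig raS (perm_big _ pra)/= big_cons echar0 mulr1.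
  by rewrite -/ah ah0E tpoly_tlist.
have a'f : a' = tpoly (tlist ra ah).
  by apply/funext => x; rewrite /a' /freq_restr /trig raS tpoly_tlist.
have a'0 : fourier a' 0 = ah 0.
  rewrite a'f fourier_tpoly /tlist big_map/= big_uniq_eq//.
  by move/negP => n0; case: n0; exact/raP.
have oscf : (a' \- cst (fourier a' 0))%R = tpoly sb.
  by apply/funext => x; rewrite /= a'0 ah0E a'E addrC addKr.
(* The l^1 norm of the nonzero frequencies dominates |b| everywhere; this is how the hypothesis on
   the coefficients yields 3 K <= a0. *)
pose Sg : R := \sum_(k <- rb) normc (ah k).
have sbSg x : normc (tpoly sb x) <= Sg.
  rewrite tpoly_tlist; apply: le_trans (ler_normc_sum _ _) _.
  by apply: ler_sum => k _; rewrite normcM normc_echar mulr1.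
have Sga : 3 * Sg <= a0.
  move: hdom; rewrite -/ah -/ash rbS ah0E.
  rewrite (eq_bigr (fun k => (normc (ah k))%:C%C)); last by move=> k _; rewrite normcE.
  by rewrite -rmorph_sum -(rmorph_nat (real_complex R)) -rmorphM lecR.
have [K [K0 KSg oscE sbK]] := cnorm_infty_bounded (cmeas_tpoly sb) (aeW _ sbSg).
have K3a : 3 * K <= a0 by lra.
have ma' : cmeas a' by rewrite a'f; exact: cmeas_tpoly.
have a'M : {ae haar R d, forall x, normc (a' x) <= a0 + K}.
  apply: filterS sbK.2 => x ?; rewrite a'E (le_trans (ler_normcD _ _))// lerD//.
  by rewrite normc_real gtr0_norm.
have [K2 [K20 _ K2E a'K2]] := cnorm_infty_bounded ma' a'M.
have [K1 [K10 _ K1E aK1]] : exists K1 : R, [/\ 0 <= K1, K1 <= Ma + (a0 + K),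
    cnorm +oo%E (cplx a \- a')%R = K1%:E & ess_bounded (haar R d) (cplx a \- a')%R K1].
  apply: cnorm_infty_bounded; first by apply: cmeasD; [exact: ba.1|exact: cmeasN].
  apply: filterS2 ba.2 a'M => x ? ?; rewrite /= (le_trans (ler_normcD _ _))// lerD//.
  by rewrite normcN.
have [K3 [K30 _ K3E aK3]] : exists K3 : R, [/\ 0 <= K3, K3 <= a0 + K + Mas,
    cnorm +oo%E (a' \- cplx as_)%R = K3%:E & ess_bounded (haar R d) (a' \- cplx as_)%R K3].
  apply: cnorm_infty_bounded; first by apply: cmeasD => //; apply: cmeasN; exact: bas.1.
  apply: filterS2 a'M bas.2 => x ? ?; rewrite /= (le_trans (ler_normcD _ _))// lerD//.
  by rewrite normcN.
(* |b| <= K bounds a'_min from below. It is at most the mean a0 of a', and at most the supremum norm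
   of a'. *)
have [m [mE m_ge m_le mK2]] : exists m : R, [/\ a'min = m%:E, a0 - K <= m, m <= a0 & m <= K2].
  have low : ((a0 - K)%:E <= a'min)%E.
    apply/ess_infP; apply: filterS sbK.2 => x xK; rewrite lee_fin a'E cReD /= lerD2l.
    by have := Re_le_normc (tpoly sb x); rewrite ler_norml => /andP[+ _]; lra.
  have upp : (a'min <= K2%:E)%E.
    rewrite -(@ess_inf_cst _ _ _ (haar R d) K2%:E); last by rewrite [X in (_ < X)%E]haarT lte01.
    apply: le_ess_inf; apply: filterS a'K2.2 => x xK; rewrite lee_fin.
    by rewrite (le_trans (ler_norm _))// (le_trans (Re_le_normc _)).
  have fin : a'min \is a fin_num.
    by rewrite fin_numE gt_eqF ?lt_eqF//; [exact: le_lt_trans upp (ltry _)|exact: lt_le_trans (ltNyr _) low].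
  exists (fine a'min); rewrite fineK// -!lee_fin fineK//; split=> //.
  rewrite -(fineK fin) lee_fin -(Rcst (fine a'min)).
  have -> : a0 = (\int[haar R d]_x complex.Re (a' x))%R.
    by rewrite -[RHS]/(complex.Re (cintegral a')) -fourier0 a'0 ah0E.
  apply: Rint_ae_le => //; first by rewrite a'f; exact: Lint_Re_tpoly.
  apply: filterS (ess_inf_le (haar R d) (fun x => (complex.Re (a' x))%:E)) => x.
  by rewrite -/a'min -{1}(fineK fin) lee_fin.
have m0 : 0 < m by lra.
have Llf : cL2 (haar R d) f' by rewrite f'E; exact: cL2_tpoly.
have Lfs : cL2 (haar R d) (cplx fs) by rewrite fsE'; exact: cL2_tpoly.
have F1E := cnorm2E (cL2B Lf Llf); have FE := cnorm2E Llf; have F3E := cnorm2E (cL2B Llf Lfs).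
set F1 := vnorm _ _ in F1E; set F := vnorm _ _ in FE; set F3 := vnorm _ _ in F3E.
have ulf : uniq (tfreqs lf) by rewrite tfreqs_tlist.
have lf0 p : p \in lf -> p.1 = 0 -> p.2 = 0.
  by move=> /mapP[k _ ->] /= ->; exact: hf0.
pose w := neumann_sum a0 sb lf.
have [hu1 hu0] := hu; have vu := in_H1_vgrad hu1; have [Lu LG _] := vu.
pose G j := wpartial j u.
have w0 n : cintegral (tpoly (w n) : pt R d -> R[i]) = 0.
  by apply: cintegral_eq0_tpoly => p; exact: neumann_sum0.
pose B := vnorm (haar R d) (tgrad (neumann_term a0 sb lf 0)).
have B0 : 0 <= B := vnorm_ge0 _ _.
pose q := K / a0.
have q0 : 0 <= q by rewrite divr_ge0// ltW.
have qa : a0 * q = K by rewrite mulrC divfK ?gt_eqF.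
have q1 : q < 1 by rewrite ltr_pdivrMr// mul1r; lra.
(* 2 pi >= 4, from pi >= 2. *)
have BF : 4 * a0 * B <= F.
  have := vnorm_neumann_term0 sb a00 ulf; rewrite -f'E -/B -/F; apply: le_trans.
  by rewrite ler_wpM2r// ler_wpM2r ?(ltW a00)//; have := pi_ge2 R; lra.
have est1 n : amin * vnorm (haar R d) (fun j x => G j x - tgrad (w n) j x) <=
    F1 + K1 * (3 / 2 * B) + K * (q ^+ n * B).
  have vD := vgradB vu (vgrad_tpoly (w n)); have [Lv LD _] := vD.
  have v0 : cintegral (fun x => u x - tpoly (w n) x) = 0.
    by rewrite cintegralB ?w0 ?subr0 -?fourier0//; exact: cL2_tpoly.
  have bd : ess_bounded (haar R d) (fun x => (a x)%:C%C - (a0%:C%C + tpoly sb x)) K1.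
    by under eq_fun do rewrite -a'E.
  have hv := vgrad_in_H1 vD; have vw := in_H1_vgrad hv; have [_ Lw _] := vw.
  have E : vdot (haar R d) (fun x => (a x)%:C%C)
      (fun j x => (G j x - tgrad (w n) j x) + tgrad (w n) j x) (fun j x => G j x - tgrad (w n) j x) =
      vdot (haar R d) (fun=> 1) (fun _ : 'I_1 => cplx f) (fun _ : 'I_1 => fun x => u x - tpoly (w n) x).
    rewrite (_ : (fun j x => _ + _) = G); last first.
      by apply/funext => j; apply/funext => x; rewrite subrK.
    (* The weak formulation mentions the chosen [wpartial] of the test function, which agrees almost
       everywhere with the explicit gradient. *)
    rewrite (vdot_ae ba LG LG LD Lw (fun=> aeW _ (fun=> erefl)) (vgrad_unique vD vw)).
    have /(congr1 (@complex.Re R)) /= := hsol _ hv; rewrite /vdot /vprod => ->.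
    by apply: eq_Rintegral => x _; rewrite mul1r big_ord1.
  have := energy_estimate a00 sbK K0 lf0 ma ba hamin hage K10 bd vD v0 Lf E.
  move/le_trans; apply; apply: lerD; first apply: lerD.
  - by rewrite -f'E.
  - by rewrite ler_wpM2l// (vnorm_neumann_sum lf a00 sbK K0).
  - by rewrite ler_wpM2l// (vnorm_neumann_term lf a00 sbK K0).
(* The difference u^(N,s) - w_N as a single list, whose frequencies all lie in the stamping set. *)
pose lv := le ++ tscale (-1) (w N).
have lvE x : tpoly lv x = tpoly le x - tpoly (w N) x.
  by rewrite tpoly_cat tpoly_scale mulN1r.
have glvE j x : tgrad lv j x = tgrad le j x - tgrad (w N) j x.
  rewrite tgrad_cat; congr (_ + _); rewrite /tgrad /tpoly /tderiv /tscale !big_map -sumrN.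
  by apply: eq_bigr => p _ /=; rewrite mulN1r mulrN mulNr.
have lvS p : p \in lv -> p.1 \in rs.
  rewrite mem_cat => /orP[/mapP[k ks ->]//|/mapP[r rw ->]] /=; apply/rsP.
  apply: (tfreqs_neumann_sum (a0 := a0) (sb := sb) (sf := lf)) => //.
  - by move=> k; rewrite tfreqs_tlist => /rbP[].
  - by move=> k; rewrite tfreqs_tlist => /rfP.
  - by apply/mapP; exists r.
(* An entry of [le] at frequency 0 exists only if 0 is in the stamping set, and then the
   normalisation [c 0 = 0] applies. *)
have lv0 p : p \in lv -> p.1 = 0 -> p.2 = 0.
  rewrite mem_cat => /orP[/mapP[k ks ->]/= k0|/mapP[r rw ->] /= r0].
    by rewrite k0 in ks *; apply: c0; exact/rsP.
  by rewrite (neumann_sum0 rw r0) mulr0.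
have est3 : asmin * vnorm (haar R d) (tgrad lv) <= F3 + K3 * (3 / 2 * B) + K * (q ^+ N * B).
  have vD := vgrad_tpoly lv; have [Lv LD _] := vD.
  have bd : ess_bounded (haar R d) (fun x => (as_ x)%:C%C - (a0%:C%C + tpoly sb x)) K3.
    split; first by apply: cmeasD; [exact: bas.1|apply: cmeasN; under eq_fun do rewrite -a'E].
    by apply: filterS aK3.2 => x; rewrite /= -a'E -normcN opprB.
  have E : vdot (haar R d) (fun x => (as_ x)%:C%C)
      (fun j x => tgrad lv j x + tgrad (w N) j x) (tgrad lv) =
      vdot (haar R d) (fun=> 1) (fun _ : 'I_1 => cplx fs) (fun _ : 'I_1 => tpoly lv).
    rewrite (_ : (fun j x => _ + _) = tgrad le); last first.
      by apply/funext => j; apply/funext => x; rewrite glvE subrK.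
    rewrite (_ : (fun x => _%:C%C) = tpoly las); last exact/funext.
    rewrite fsE'; apply: galerkin_identity => //.
    - by move=> k; apply: contraNeq => ?; exact/raP.
    - move=> k /rsP kS; have := ceq k kS; rewrite -/S -/ash -/fsh rsS => ->.
      rewrite /lfs /tlist big_map/= big_uniq_eq// => kf.
      by apply/eqP; apply: contraNT kf => ?; exact/rfP.
  have aeas : {ae haar R d, forall x, asmin <= as_ x} by exact: aeW.
  have := energy_estimate a00 sbK K0 lf0 mas bas hasmin aeas K30 bd vD (cintegral_eq0_tpoly lv0) Lfs E.
  move/le_trans; apply; apply: lerD; first apply: lerD.
  - rewrite -f'E /F3 -vnormN le_eqVlt; apply/orP; left; apply/eqP; congr vnorm.
    by apply/funext => i; apply/funext => x; rewrite /= opprB.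
  - by rewrite ler_wpM2l// (vnorm_neumann_sum lf a00 sbK K0).
  - by rewrite ler_wpM2l// (vnorm_neumann_term lf a00 sbK K0).
have vV := vgradB vu (vgrad_tpoly le).
have VE : H_norm (u \- uNs)%R = (vnorm (haar R d) (fun j x => G j x - tgrad le j x))%:E.
  by rewrite uNE; exact: (H_normE (vgrad_in_H1 vV) vV).
rewrite VE; set V := vnorm _ _.
have oE : osc = K%:E by rewrite /osc oscf oscE.
rewrite mE oE F1E FE F3E K1E K2E K3E -EFinM -EFinB.
case: ifPn => [_|nz]; first exact: leey.
(* m - 2K >= a0 - 3K >= 0, so excluding the value 0 makes the denominator positive. *)
have mK : 0 < m - 2 * K by rewrite lt_def; move: nz; rewrite eqe => -> /=; lra.
have invE (r : R) : 0 < r -> (r%:E^-1)%E = (r^-1)%:E by move=> r0; rewrite inver gt_eqF.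
rewrite -!EFinM !invE ?mulr_gt0// -!EFinM -EFin_expe.
rewrite -[1%E]/(1%:E) -!(EFinD, EFinM) lee_fin.
apply/ler_addgt0Pr => e e0.
(* The truncation level n depends on e: after division by [amin] the residual of w_(N+n) costs at
   most e. *)
have [n Hn] := @exists_expr_small R q (K * B) (amin * e) (introT andP (conj q0 q1)) (mulr_gt0 hamin e0).
have qN n' : 0 <= q ^+ n' by rewrite exprn_ge0.
have tail := vnorm_neumann_sum_tail lf a00 sbK K0 K3a N n.
apply: (@error_budget R amin asmin m a0 B F F1 F3 K1 K2 K3 (q ^+ N.+1) _ V
  (vnorm (haar R d) (fun j x => G j x - tgrad (w (N + n)) j x))
  (vnorm (haar R d) (fun j x => tgrad (w (N + n)) j x - tgrad (w N) j x))
  (vnorm (haar R d) (tgrad lv))) => //.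
- rewrite lerXn2r ?nnegrE//; first by rewrite divr_ge0// ltW.
  by rewrite /q ler_wpM2l// lef_pV2 ?posrE//; lra.
(* u - u^(N,s) = (u - w_(N+n)) + (w_(N+n) - w_N) - (u^(N,s) - w_N). *)
- rewrite -addrA /V (_ : (fun j x => G j x - _) = fun j x => (G j x - tgrad (w (N + n)) j x) +
      ((tgrad (w (N + n)) j x - tgrad (w N) j x) - tgrad lv j x)); last first.
    by apply/funext => j; apply/funext => x; rewrite glvE; ring.
  have L1 := vL2B LG (vL2_tgrad (w (N + n))).
  have L2 := vL2B (vL2_tgrad (w (N + n))) (vL2_tgrad (w N)).
  apply: le_trans (vnormD L1 (vL2B L2 (vL2_tgrad lv))) _.
  exact: (lerD (lexx _) (vnormB L2 (vL2_tgrad lv))).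
- apply: le_trans (est1 (N + n)%N) _; rewrite lerD2l; apply: le_trans Hn.
  rewrite mulrA mulrAC ler_wpM2l ?mulr_ge0//.
  by rewrite exprD ler_piMl// exprn_ile1// ltW.
(* K q^N = a0 q^(N+1): the Galerkin residual has the same power N + 1 as the Neumann tail. *)
- by apply: le_trans est3 _; rewrite lerD2l exprS (mulrA a0) qa (mulrA K).
Qed.
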